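(* Let $L$ be a lattice in $\mathbb{R}^n$ of covolume $1$ such that every layer of $L$ is a spherical $4$-design (after rescaling to the unit sphere). Then $L$ is $\zeta$-extreme at $s$ for every real $s>\frac{n}{2}$, and the flat torus $\mathbb{R}^n/L^{*}$ associated with the dual lattice $L^{*}$ achieves a strict local minimum of the height function on the set of $n$-dimensional flat tori of covolume $1$. If moreover $\zeta(L,s)<0$ for all $0<s<\frac{n}{2}$, then $L$ is $\zeta$-extreme at $s$ for every real $s>0$ with $s\neq\frac{n}{2}$.
   Context: A finite set $X\subset \mathbb{S}^{n-1}$ is a spherical $t$-design if $\int_{\mathbb{S}^{n-1}}f(x)\,dx=\frac{1}{|X|}\sum_{x\in X}f(x)$ for every homogeneous polynomial $f$ of degree $\le t$, where $dx$ is the rotation-invariant measure on $\mathbb{S}^{n-1}$ of total mass $1$. For a lattice $L\subset\mathbb{R}^n$, let $m_1(L)<m_2(L)<\cdots$ be the distinct values of $\|x\|^2$ for $x\in L\setminus\{0\}$; the $k$-th layer is $M_k(L)=\{x\in L: \|x\|^2=m_k(L)\}$, and ''the layer is a $t$-design'' means that $\{x/\sqrt{m_k(L)}: x\in M_k(L)\}$ is a $t$-design. The Epstein zeta function is $\zeta(L,s)=\sum_{x\in L\setminus\{0\}}\|x\|^{-2s}$ for $\Re s>\frac n2$, extended meromorphically to $\mathbb{C}$ (simple pole at $s=\frac n2$). Let $\mathcal L_n^{\circ}$ be the set of lattices in $\mathbb{R}^n$ of covolume $1$ (with its natural topology as $\mathrm{SL}_n(\mathbb{R})/\mathrm{SL}_n(\mathbb{Z})$-type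 space, equivalently lattices up to the identification with positive definite quadratic forms of determinant 1 up to $\mathbf{GL}_n(\mathbb{Z})$ and isometry). A lattice $L_0\in\mathcal L_n^\circ$ is $\zeta$-extreme at $s$ if it achieves a strict local minimum of $L\mapsto\zeta(L,s)$ on $\mathcal L_n^\circ$ (up to isometry). For a compact Riemannian manifold $X$, with nonzero Laplacian eigenvalues $\lambda_j$, let $\zeta_X(s)=\sum_{\lambda_j\neq0}\lambda_j^{-s}$ (meromorphically continued); the height is $h(X)=\zeta_X'(0)$. For the flat torus $\mathbb{R}^n/L^*$, $\zeta_X(s)$ equals $\zeta(L,s)$ up to a factor $c^{-s}$ with $c$ a constant depending only on normalization. *)

(* Defs.v *)
From HB Require Import structures.
From mathcomp Require Import all_boot all_order all_algebra.
From mathcomp Require Import all_classical all_reals all_analysis.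
From mathcomp Require mpoly.

Set Implicit Arguments.
Unset Strict Implicit.
Unset Printing Implicit Defensive.

Import Order.TTheory GRing.Theory Num.Theory.
Import numFieldNormedType.Exports.
Local Open Scope classical_set_scope.
Local Open Scope ring_scope.

Section Lattices.
Variables (R : realType) (n : nat).

(** A lattice in R^n is given by a basis matrix [B] whose ROWS are the basis
    vectors; lattice vectors are the row vectors [z *m B], [z] integral. *)
Definition lvec (B : 'M[R]_n) (z : 'rV[int]_n) : 'rV[R]_n :=
  map_mx (fun a : int => a%:~R) z *m B.

Definition lattice (B : 'M[R]_n) : set 'rV[R]_n :=
  [set x | exists z : 'rV[int]_n, x = lvec B z].

Definition covol (B : 'M[R]_n) : R := `|\det B|.

Definition sqnorm (x : 'rV[R]_n) : R := \sum_(i < n) x 0 i ^+ 2.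

(** basis of the dual lattice L^* = {y | <x,y> \in Z for all x \in L} *)
Definition dual (B : 'M[R]_n) : 'M[R]_n := (invmx B)^T.

Definition isometric (B C : 'M[R]_n) : Prop :=
  exists Q : 'M[R]_n, Q^T *m Q = 1%:M /\ lattice (B *m Q) = lattice C.

Definition nzidx : set 'rV[int]_n := [set z | z != 0].

Definition epstein_series (B : 'M[R]_n) (s : R) : \bar R :=
  \esum_(z in nzidx) ((sqnorm (lvec B z)) `^ (- s))%:E.

Definition theta1 (B : 'M[R]_n) (t : R) : R :=
  fine (\esum_(z in nzidx) (expR (- pi * t * sqnorm (lvec B z)))%:E).

(** Gamma(s+1) = int_0^oo t^s e^{-t} dt  (s > -1) *)
Definition Gamma1 (s : R) : R :=
  Rintegral lebesgue_measure `]0, +oo[%classic (fun t => t `^ s * expR (- t)).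

Definition theta_int (B : 'M[R]_n) (a : R) : R :=
  Rintegral lebesgue_measure `[1, +oo[%classic
    (fun t => theta1 B t * t `^ (a - 1)).

(** The Epstein zeta function zeta(L,s) on real s.  For s > n/2 it is the
    series; otherwise it is its meromorphic continuation, given by Riemann's
    theta-function formula (valid for s > -1, s <> n/2, V = covol):
    pi^{-s} Gamma(s) zeta(L,s) = -1/s + V^{-1}/(s - n/2)
         + int_1^oo (theta_L(t)-1) t^{s-1} dt
         + V^{-1} int_1^oo (theta_{L^*}(t)-1) t^{n/2-s-1} dt,
    rewritten with Gamma(s+1) = s Gamma(s) so that it is also defined at s=0. *)
Definition epstein (B : 'M[R]_n) (s : R) : R :=
  if n%:R / 2 < s then fine (epstein_series B s)
  else pi `^ s / Gamma1 s *
       (-1 + s * ((covol B)^-1 / (s - n%:R / 2) + theta_int B s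
                  + (covol B)^-1 * theta_int (dual B) (n%:R / 2 - s))).

Definition strict_local_min (F : 'M[R]_n -> R) (B0 : 'M[R]_n) : Prop :=
  exists2 e : R, 0 < e &
    forall B : 'M[R]_n, covol B = 1 ->
      (forall i j, `|B i j - B0 i j| < e) ->
      ~ isometric B B0 -> F B0 < F B.

Definition zeta_extreme (B0 : 'M[R]_n) (s : R) : Prop :=
  strict_local_min (fun B => epstein B s) B0.

(** spectral zeta function of the flat torus R^n / Lambda (Lambda with basis
    C): the nonzero Laplace eigenvalues are 4 pi^2 |y|^2, y in Lambda^* \ 0,
    so zeta_X(s) = (4 pi^2)^{-s} zeta(Lambda^*, s) (continued). *)
Definition torus_zeta (C : 'M[R]_n) (s : R) : R :=
  (4 * pi ^+ 2) `^ (- s) * epstein (dual C) s.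

Definition torus_height (C : 'M[R]_n) : R := derive1 (torus_zeta C) 0.

Fixpoint iint (k : nat) (g : (nat -> R) -> R) : R :=
  match k with
  | 0 => g (fun _ => 0)
  | k'.+1 => iint k' (fun x => Rintegral lebesgue_measure setT
                     (fun t => g (fun i => if i == k' then t else x i)))
  end.

Definition intRn (f : 'rV[R]_n -> R) : R := iint n (fun x => f (\row_i x i)).

(** Average over S^{n-1} w.r.t. the normalized rotation-invariant measure,
    realized as the normalized cone measure:
    int_S f dsigma = (1/vol B^n) int_{B^n} f(x/|x|) dx. *)
Definition ball_ind (x : 'rV[R]_n) : R := if sqnorm x <= 1 then 1 else 0.

Definition sphere_avg (f : 'rV[R]_n -> R) : R :=
  intRn (fun x => ball_ind x * f ((Num.sqrt (sqnorm x))^-1 *: x))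
  / intRn ball_ind.

Definition spherical_design (t : nat) (X : set 'rV[R]_n) : Prop :=
  forall (k : nat) (p : mpoly.mpoly n R), (k <= t)%N ->
    all (fun m => mpoly.mdeg m == k) (mpoly.msupp p) ->
    \sum_(x \in X) mpoly.meval (x 0) p
      = (\sum_(x \in X) (1 : R)) * sphere_avg (fun x => mpoly.meval (x 0) p).

Definition layer (B : 'M[R]_n) (m : R) : set 'rV[R]_n :=
  [set x | lattice B x /\ sqnorm x = m].

Definition all_layers_design (t : nat) (B : 'M[R]_n) : Prop :=
  forall m : R, 0 < m -> layer B m !=set0 ->
    spherical_design t [set (Num.sqrt m)^-1 *: x | x in layer B m].

End Lattices.

(* Main.v *)
Require Import Defs.
From HB Require Import structures.
From mathcomp Require Import all_boot all_order all_algebra.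
From mathcomp Require Import all_classical all_reals all_analysis.
From mathcomp Require Import measurable_realfun.
From mathcomp Require Import ring lra zify.
From mathcomp Require mpoly.
From mathcomp Require complex.

(** A covolume-one basis close to [B] has, up to isometry, the form [B *m P^T *m exp_diag h] with
    [P] orthogonal, [h] small and of zero sum, and [h = 0] only for lattices isometric to that of [B].
    When all layers are 4-designs, the second and fourth moments of each layer are those of a sphere,
    so the second-order expansion in [h] of any sum of [F |x|^2] over the nonzero lattice vectors [x] has no
    linear term and its quadratic term is a multiple of [|h|^2]. For [F r = r^(-s)] with [s > n/2] the
    multiple is positive. For [s < n/2] the theta series is expanded instead; the theta functional
    equation determines the expansion for the dual lattice, whose layers are not assumed to be
    designs, and integrating by parts in Riemann's formula shows that the
    multiple for [Lam s], the sum of the two theta integrals, is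
    [4 / (n (n + 2)) * (n / 2 + s (s - n / 2) Lam s)]; it is positive when [zeta(L, s) < 0], and
    [zeta(., s)] is an increasing affine function of [Lam s]. The derivative of the torus zeta function at [0]
    is [Lam 0] up to an additive constant, so the height has the multiple [2 / (n + 2)]. *)

Set Implicit Arguments.
Unset Strict Implicit.
Unset Printing Implicit Defensive.
Import Order.TTheory GRing.Theory Num.Theory.
Import numFieldNormedType.Exports.
Local Open Scope classical_set_scope.
Local Open Scope ring_scope.

(** * Absolutely convergent sums *)

Section AbsoluteSums.
Variable R : realType.
Implicit Types T : choiceType.

(** No derivative in the lattice variable is ever taken. Where two expansions of one quantity have
    to agree, their coefficients are identified because a quadratic polynomial of cubic size near 0
    vanishes ([O3_poly]). The remainders of the theta expansions are [d ^ 3] times a constant times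
    the sum of [exp (- pi t r / 4)] over the lattice, which survives integration over [t >= 1]
    against any power of [t]. No spherical integral is evaluated either: rotation invariance gives
    the dependence of the moments of a linear form on that form, and summing over an orthonormal
    basis gives the constants. The functional equation rests on Jacobi's inversion in dimension one,
    itself the limit of a finite identity: the coefficients of [(2 cos t) ^ (2 n)] summed along a
    residue class modulo [N], with [n] of order [N ^ 2]. The constant in the limit is found from the
    self-dual case. In the height, the Gamma factor only has to be differentiable at 0, since its
    derivative shifts all heights by the same amount. *)

Definition psum T (D : set T) (f : T -> R) : R :=
  fine (\esum_(i in D) (f i)%:E)%E.

Definition summ T (D : set T) (f : T -> R) : Prop :=
  (\esum_(i in D) (`|f i|)%:E < +oo)%E.

(** Sums of positive and of negative parts are taken separately because [\esum] is a supremum over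
    finite subsets. As [fine] sends infinity to 0, the value is meaningful only under [summ]. *)
Definition rsum T (D : set T) (f : T -> R) : R :=
  psum D (fun i => Num.max (f i) 0) - psum D (fun i => Num.max (- f i) 0).

Lemma summP T (D : set T) (f : T -> R) : (forall i, D i -> 0 <= f i) ->
  summ D f -> (\esum_(i in D) (f i)%:E < +oo)%E.
Proof.
move=> f0 fs; rewrite (eq_esum (b := fun i => (`|f i|)%:E))//.
by move=> i Di; rewrite ger0_norm// f0.
Qed.

Lemma psumE T (D : set T) (f : T -> R) : (forall i, D i -> 0 <= f i) ->
  summ D f -> (psum D f)%:E = (\esum_(i in D) (f i)%:E)%E.
Proof.
move=> f0 fs; rewrite /psum fineK// ge0_fin_numE; first exact: summP.
by apply: esum_ge0 => i Di; rewrite lee_fin f0.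
Qed.

Lemma summ_le T (D : set T) (f g : T -> R) : (forall i, D i -> `|f i| <= g i) ->
  summ D g -> summ D f.
Proof.
move=> fg; apply: le_lt_trans; apply: le_esum => i Di.
by rewrite lee_fin (le_trans (fg _ Di))// ler_norm.
Qed.

Lemma summ_eq T (D : set T) (f g : T -> R) : (forall i, D i -> f i = g i) ->
  summ D f -> summ D g.
Proof. by move=> fg; rewrite /summ (eq_esum (b := fun i => (`|g i|)%:E))// => i Di; rewrite fg. Qed.

Lemma summ_norm T (D : set T) (f : T -> R) : summ D f -> summ D (fun i => `|f i|).
Proof. by move=> sf; rewrite /summ (eq_esum (b := fun i => (`|f i|)%:E))// => i _; rewrite normr_id. Qed.

Lemma summD T (D : set T) (f g : T -> R) : summ D f -> summ D g -> summ D (fun i => f i + g i).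
Proof.
move=> sf sg; apply: le_lt_trans (lte_add_pinfty sf sg).
rewrite -esumD => [|i _|i _]; rewrite ?lee_fin//.
by apply: le_esum => i Di; rewrite -EFinD lee_fin ler_normD.
Qed.

Lemma esumZ T (D : set T) (c : R) (f : T -> R) : 0 <= c ->
  (\esum_(i in D) (c * f i)%:E = c%:E * \esum_(i in D) (f i)%:E)%E.
Proof.
move=> c0; rewrite /esum -ereal_supZl//; last first.
  by apply/set0P; exists (\sum_(x \in set0) (f x)%:E)%E, set0 => //; exact: fsets_set0.
congr ereal_sup; apply/seteqP; split => x /=.
  move=> [A fA <-]; exists (\sum_(x \in A) (f x)%:E)%E; first by exists A.
  case: fA => fA _; rewrite !fsumEFin// -EFinM; congr EFin.
  by rewrite mulr_fsumr.
move=> [_ [A fA <-] <-]; exists A => //.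
case: fA => fA _; rewrite !fsumEFin// -EFinM; congr EFin.
by rewrite mulr_fsumr.
Qed.

Lemma summZ T (D : set T) c (f : T -> R) : summ D f -> summ D (fun i => c * f i).
Proof.
move=> sf; rewrite /summ (eq_esum (b := fun i => (`|c| * `|f i|)%:E)); last first.
  by move=> i _; rewrite normrM.
rewrite esumZ//; rewrite muleC; apply: lte_mul_pinfty => //.
- by apply: esum_ge0 => i _; rewrite lee_fin.
- rewrite ge0_fin_numE//; by apply: esum_ge0 => i _; rewrite lee_fin.
- exact: ltry.
Qed.

Lemma summN T (D : set T) (f : T -> R) : summ D f -> summ D (fun i => - f i).
Proof. by move=> sf; rewrite /summ (eq_esum (b := fun i => (`|f i|)%:E))// => i _; rewrite normrN. Qed.

Lemma summB T (D : set T) (f g : T -> R) : summ D f -> summ D g -> summ D (fun i => f i - g i).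
Proof. by move=> sf sg; apply: summD => //; exact: summN. Qed.

Lemma summ0 T (D : set T) : summ D (fun _ => 0 : R).
Proof. by rewrite /summ esum1// => i _; rewrite normr0. Qed.

Lemma summ_sum T (D : set T) (I : Type) (r : seq I) (P : pred I) (f : I -> T -> R) :
  (forall k, P k -> summ D (f k)) -> summ D (fun i => \sum_(k <- r | P k) f k i).
Proof.
move=> sf; elim: r => [|k r IH].
  by apply: summ_eq (summ0 D) => i _; rewrite big_nil.
case: (boolP (P k)) => Pk.
  by apply: summ_eq (summD (sf _ Pk) IH) => i _; rewrite big_cons Pk.
by apply: summ_eq IH => i _; rewrite big_cons (negPf Pk).
Qed.

Lemma summ_subset T (D E : set T) f : D `<=` E -> summ E f -> summ D f.
Proof.
move=> DE; apply: le_lt_trans; apply: le_ereal_sup => _ [A [fA AD] <-].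
by exists A => //; split=> // x /AD/DE.
Qed.

Lemma psumD T (D : set T) (f g : T -> R) : (forall i, D i -> 0 <= f i) -> (forall i, D i -> 0 <= g i) ->
  summ D f -> summ D g -> psum D (fun i => f i + g i) = psum D f + psum D g.
Proof.
move=> f0 g0 sf sg; apply: EFin_inj; rewrite EFinD !psumE//; last exact: summD.
  by rewrite -esumD//; apply: eq_esum.
by move=> i Di; rewrite addr_ge0// (f0, g0).
Qed.

Lemma psum_ge0 T (D : set T) (f : T -> R) : (forall i, D i -> 0 <= f i) -> 0 <= psum D f.
Proof. by move=> f0; apply: fine_ge0; apply: esum_ge0 => i Di; rewrite lee_fin f0. Qed.

Lemma eq_psum T (D : set T) (f g : T -> R) : (forall i, D i -> f i = g i) -> psum D f = psum D g.
Proof. by move=> fg; congr fine; apply: eq_esum => i Di; rewrite fg. Qed.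

Lemma psumZ T (D : set T) c (f : T -> R) : 0 <= c -> (forall i, D i -> 0 <= f i) -> summ D f ->
  psum D (fun i => c * f i) = c * psum D f.
Proof.
move=> c0 f0 sf; apply: EFin_inj; rewrite EFinM !psumE//; first exact: esumZ.
- by move=> i Di; rewrite mulr_ge0// f0.
- exact: summZ.
Qed.

(** Pointwise [max (f - g) 0 + g = max (g - f) 0 + f], and [psum] is additive. Any decomposition
    into nonnegative summable parts therefore gives the same value, which is the source of
    linearity. *)
Lemma rsum_sub T (D : set T) (f g : T -> R) : (forall i, D i -> 0 <= f i) -> (forall i, D i -> 0 <= g i) ->
  summ D f -> summ D g -> rsum D (fun i => f i - g i) = psum D f - psum D g.
Proof.
move=> f0 g0 sf sg; rewrite /rsum; apply/eqP; rewrite subr_eq addrAC eq_sym subr_eq; apply/eqP.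
have s1 : summ D (fun i => Num.max (f i - g i) 0).
  apply: summ_le sf => i Di; rewrite ger0_norm ?le_max ?lexx ?orbT//.
  by rewrite ge_max lerBlDr lerDl g0//= f0.
have s2 : summ D (fun i => Num.max (- (f i - g i)) 0).
  apply: summ_le sg => i Di; rewrite ger0_norm ?le_max ?lexx ?orbT//.
  by rewrite ge_max opprB lerBlDr lerDl f0//= g0.
rewrite -!psumD// => [|i _|i _]; rewrite ?le_max ?lexx ?orbT//.
apply: eq_psum => i Di; rewrite opprB.
have [fg|fg] := leP (f i) (g i).
  by rewrite max_l ?subr_ge0// max_r ?subr_le0// add0r addrC subrK.
by rewrite max_r ?subr_le0 1?ltW// max_l ?subr_ge0 1?ltW// addr0 subrK.
Qed.

Lemma rsum_psum T (D : set T) (f : T -> R) : (forall i, D i -> 0 <= f i) -> summ D f -> rsum D f = psum D f.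
Proof.
move=> f0 sf; rewrite /rsum [X in _ - X](_ : _ = 0) ?subr0.
  by apply: eq_psum => i Di; rewrite max_l// f0.
by rewrite /psum esum1// => i Di; rewrite max_r// oppr_le0 f0.
Qed.

Lemma maxB0 (x : R) : x = Num.max x 0 - Num.max (- x) 0.
Proof.
have [x0|x0] := leP 0 x; first by rewrite max_r ?oppr_le0// subr0.
by rewrite max_l ?oppr_ge0 1?ltW// sub0r opprK.
Qed.

Lemma eq_rsum T (D : set T) (f g : T -> R) : (forall i, D i -> f i = g i) -> rsum D f = rsum D g.
Proof. by move=> fg; congr (_ - _); apply: eq_psum => i Di; rewrite fg. Qed.

Let mx (f : R) : 0 <= Num.max f 0. Proof. by rewrite le_max lexx orbT. Qed.

Lemma summ_max T (D : set T) (f : T -> R) : summ D f -> summ D (fun i => Num.max (f i) 0).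
Proof.
move=> /summ_norm; apply: summ_le => i Di.
by rewrite (ger0_norm (mx _)) ge_max ler_norm/=.
Qed.

Lemma rsumD T (D : set T) (f g : T -> R) : summ D f -> summ D g ->
  rsum D (fun i => f i + g i) = rsum D f + rsum D g.
Proof.
move=> sf sg.
have sp := (summ_max sf, summ_max sg, summ_max (summN sf), summ_max (summN sg)).
transitivity (rsum D (fun i => (Num.max (f i) 0 + Num.max (g i) 0) - (Num.max (- f i) 0 + Num.max (- g i) 0))).
  by apply: eq_rsum => i Di; rewrite {1}(maxB0 (f i)) {1}(maxB0 (g i)); ring.
rewrite rsum_sub.
- rewrite (psumD _ _ sp.1.1.1 sp.1.1.2) ?(psumD _ _ sp.1.2 sp.2)// /rsum; ring.
- by move=> i _; rewrite addr_ge0.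
- by move=> i _; rewrite addr_ge0.
- exact: summD sp.1.1.1 sp.1.1.2.
- exact: summD sp.1.2 sp.2.
Qed.

Lemma rsumN T (D : set T) (f : T -> R) : summ D f -> rsum D (fun i => - f i) = - rsum D f.
Proof.
move=> sf; rewrite /rsum opprB; congr (_ - _).
by apply: eq_psum => i _; rewrite opprK.
Qed.

Lemma rsumB T (D : set T) (f g : T -> R) : summ D f -> summ D g ->
  rsum D (fun i => f i - g i) = rsum D f - rsum D g.
Proof. by move=> sf sg; rewrite rsumD ?rsumN//; exact: summN. Qed.

Lemma rsumZ T (D : set T) c (f : T -> R) : summ D f -> rsum D (fun i => c * f i) = c * rsum D f.
Proof.
move=> sf; wlog c0 : c f sf / 0 <= c => [hw|].
  have [c0|c0] := leP 0 c; first exact: hw.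
  rewrite -[RHS]mulrNN -rsumN// -hw ?oppr_ge0 1?ltW//; last exact: summN.
  by apply: eq_rsum => i _; rewrite mulrNN.
rewrite /rsum mulrBr -!psumZ//; [|exact: summ_max (summN sf)|exact: summ_max].
congr (_ - _); apply: eq_psum => i _; first by rewrite maxr_pMr// mulr0.
by rewrite maxr_pMr// mulr0 mulrN.
Qed.

Lemma rsum0 T (D : set T) : rsum D (fun _ => 0) = 0.
Proof. by rewrite /rsum oppr0 subrr. Qed.

Lemma rsum_eq0 T (D : set T) (f : T -> R) : (forall i, D i -> f i = 0) -> rsum D f = 0.
Proof. by move=> f0; rewrite (eq_rsum f0) rsum0. Qed.

Lemma rsum_sum T (D : set T) (I : Type) (r : seq I) (P : pred I) (f : I -> T -> R) :
  (forall k, P k -> summ D (f k)) ->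
  rsum D (fun i => \sum_(k <- r | P k) f k i) = \sum_(k <- r | P k) rsum D (f k).
Proof.
move=> sf; elim: r => [|k r IH].
  by rewrite big_nil -[RHS](rsum0 D); apply: eq_rsum => i _; rewrite big_nil.
rewrite big_cons; case: ifPn => Pk.
  rewrite -IH -rsumD; [|exact: sf|exact: summ_sum].
  by apply: eq_rsum => i _; rewrite big_cons Pk.
by rewrite -IH; apply: eq_rsum => i _; rewrite big_cons (negPf Pk).
Qed.

Lemma rsum_ge0 T (D : set T) (f : T -> R) : (forall i, D i -> 0 <= f i) -> summ D f -> 0 <= rsum D f.
Proof. by move=> f0 sf; rewrite rsum_psum//; exact: psum_ge0. Qed.

Lemma le_rsum T (D : set T) (f g : T -> R) : (forall i, D i -> f i <= g i) ->
  summ D f -> summ D g -> rsum D f <= rsum D g.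
Proof.
move=> fg sf sg; rewrite -subr_ge0 -rsumB//; apply: rsum_ge0; last exact: summB.
by move=> i Di; rewrite subr_ge0 fg.
Qed.

Lemma ler_norm_rsum T (D : set T) (f : T -> R) : summ D f -> `|rsum D f| <= rsum D (fun i => `|f i|).
Proof.
move=> sf; rewrite ler_norml -rsumN; last exact: summ_norm.
have sn := summ_norm sf; apply/andP; split.
  by apply: (le_rsum _ (summN sn) sf) => i _; rewrite lerNl -normrN ler_norm.
by apply: (le_rsum _ sf sn) => i _; rewrite ler_norm.
Qed.

Lemma rsum_norm_le T (D : set T) (f g : T -> R) : (forall i, D i -> `|f i| <= g i) -> summ D g ->
  `|rsum D f| <= rsum D g.
Proof.
move=> fg sg; have sf := summ_le fg sg; apply: (le_trans (ler_norm_rsum sf)).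
by apply: le_rsum => //; exact: summ_norm.
Qed.

Lemma summ_reindex (T T' : choiceType) (P : set T) (Q : set T') (e : T -> T') (f : T' -> R) :
  set_bij P Q e -> summ P (f \o e) <-> summ Q f.
Proof. by move=> be; rewrite /summ (reindex_esum P Q e). Qed.

Lemma rsum_reindex (T T' : choiceType) (P : set T) (Q : set T') (e : T -> T') (f : T' -> R) :
  set_bij P Q e -> rsum Q f = rsum P (f \o e).
Proof. by move=> be; rewrite /rsum /psum !(reindex_esum P Q e). Qed.

Lemma psum_mkcond T (D : set T) (f : T -> R) : psum D f = psum setT (fun i => if i \in D then f i else 0).
Proof. by rewrite /psum esum_mkcond; congr fine; apply: eq_esum => i _; case: ifP. Qed.

Lemma rsum_mkcond T (D : set T) (f : T -> R) : rsum D f = rsum setT (fun i => if i \in D then f i else 0).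
Proof.
rewrite /rsum !(psum_mkcond D); congr (_ - _); apply: eq_psum => i _; case: ifP => //.
  by rewrite maxxx.
by rewrite oppr0 maxxx.
Qed.

Lemma summ_mkcond T (D : set T) (f : T -> R) : summ D f <-> summ setT (fun i => if i \in D then f i else 0).
Proof.
rewrite /summ esum_mkcond (eq_esum (b := fun i => (`|if i \in D then f i else 0|)%:E))//.
by move=> i _; case: ifP; rewrite ?normr0.
Qed.

Lemma rsum_fset T (F : set T) (f : T -> R) : finite_set F -> rsum F f = \sum_(i \in F) f i.
Proof.
move=> fF; rewrite /rsum /psum.
rewrite -[in LHS](set_mem_set F) !esum_fset ?set_mem_set// => [|i _|i _]; rewrite ?lee_fin//.
rewrite !fsumEFin//= !fsbig_finite//= -sumrB.
by apply: eq_bigr => i _; rewrite -maxB0.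
Qed.

Lemma summ_fset T (F : set T) (f : T -> R) : finite_set F -> summ F f.
Proof.
move=> fF; rewrite /summ -[F in esum F]set_mem_set esum_fset ?set_mem_set//.
by rewrite fsumEFin// ltry.
Qed.

Lemma rsumID T (E D : set T) (f : T -> R) : summ D f ->
  rsum D f = rsum (D `&` E) f + rsum (D `&` ~` E) f.
Proof.
move=> sf; rewrite (rsum_mkcond D) (rsum_mkcond (D `&` E)) (rsum_mkcond (D `&` ~` E)).
rewrite -rsumD.
- apply: eq_rsum => i _; rewrite !in_setI in_setC.
  by case: (i \in D); case: (i \in E); rewrite /= ?addr0 ?add0r.
- by apply: (summ_mkcond _ _).1; apply: (summ_subset _ sf) => x [].
- by apply: (summ_mkcond _ _).1; apply: (summ_subset _ sf) => x [].
Qed.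

Lemma summ_tail T (D : set T) (g : T -> R) (e : R) : 0 < e -> (forall i, D i -> 0 <= g i) ->
  summ D g -> exists F : set T, [/\ finite_set F, F `<=` D & rsum (D `&` ~` F) g < e].
Proof.
move=> e0 g0 sg.
have lt : (((psum D g - e)%:E) < \esum_(i in D) (g i)%:E)%E.
  by rewrite -psumE// lte_fin ltrBlDr ltrDl.
have /ereal_sup_gt[_ [F [fF FD] <-]] := lt.
rewrite fsumEFin// lte_fin => h; exists F; split => //.
have := rsumID F sg; rewrite (setIidr FD) (rsum_fset _ fF) (rsum_psum g0 sg) => h2.
by move: h; rewrite h2; lra.
Qed.

Lemma cvg_sum_seq (T : eqType) (I : Type) (G : set_system I) {FG : Filter G} (r : seq T)
    (u : T -> I -> R) (f : T -> R) :
  (forall i, i \in r -> u i n @[n --> G] --> f i) ->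
  \sum_(i <- r) u i n @[n --> G] --> \sum_(i <- r) f i.
Proof.
elim: r => [|i r IH] uf.
  by rewrite big_nil; under eq_fun do rewrite big_nil; exact: cvg_cst.
rewrite big_cons; under eq_fun do rewrite big_cons.
apply: cvgD; first by apply: uf; rewrite mem_head.
by apply: IH => j jr; apply: uf; rewrite in_cons jr orbT.
Qed.

(** Dominated convergence for sums: outside a suitable finite set everything is bounded by a small
    tail of [g]. *)
Lemma tannery T (D : set T) (u : nat -> T -> R) (f g : T -> R) :
  summ D g -> (forall n i, D i -> `|u n i| <= g i) ->
  (forall i, D i -> (u n i @[n --> \oo] --> f i)) ->
  rsum D (u n) @[n --> \oo] --> rsum D f.
Proof.
move=> sg ug uf.
have g0 i : D i -> 0 <= g i by move=> Di; rewrite (le_trans _ (ug 0%N _ Di)).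
have fg i : D i -> `|f i| <= g i.
  move=> Di; apply: (cvgr_to_le (cvg_norm (uf _ Di))).
  by apply: nearW => n; exact: ug.
have sf := summ_le fg sg.
have su n : summ D (u n) by apply: summ_le sg => i; exact: ug.
apply/cvgrPdist_lt => e e0.
(* Three errors of size [e / 4] will be added: the tail of [f], the tail of [u n] and the difference
   over [F]. *)
have [F [fF FD tF]] := summ_tail (e := e / 4) (divr_gt0 e0 (ltr0n _ 4)) g0 sg.
have sgF : summ (D `&` ~` F) g by apply: (summ_subset _ sg) => x [].
have bnd h : (forall i, D i -> `|h i| <= g i) -> `|rsum (D `&` ~` F) h| < e / 4.
  by move=> hg; apply: le_lt_trans tF; apply: rsum_norm_le => // i [/hg].
have cF : rsum F (u n) @[n --> \oo] --> rsum F f.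
  rewrite rsum_fset// fsbig_finite//=.
  under eq_fun do rewrite rsum_fset// fsbig_finite//=.
  apply: (cvg_sum_seq (u := fun i n => u n i)) => i.
  by rewrite in_fset_set// inE => /FD; exact: uf.
move/cvgrPdist_lt : cF => /(_ (e / 4) (divr_gt0 e0 (ltr0n _ 4))) cF.
near=> n.
have h1 : `|rsum F f - rsum F (u n)| < e / 4 by near: n.
rewrite (rsumID F sf) (rsumID F (su n)) (setIidr FD).
have h2 := bnd f fg; have h3 := bnd (u n) (ug n).
move: h1 h2 h3; rewrite !ltr_norml => /andP[a1 a2] /andP[a3 a4] /andP[a5 a6].
by apply/andP; split; lra.
Unshelve. all: by end_near. Qed.

Section Fubini.
Variables T1 T2 : choiceType.
Implicit Type f : T1 * T2 -> R.

Lemma esum_pair f (D1 : set T1) (D2 : set T2) : (forall p, 0 <= f p) ->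
  (\esum_(i in D1) \esum_(j in D2) (f (i, j))%:E = \esum_(p in D1 `*` D2) (f p)%:E)%E.
Proof.
move=> f0; rewrite (@esum_esum R T1 T2 D1 (fun=> D2) (fun i j => (f (i, j))%:E)); last first.
  by move=> i j _ _; rewrite lee_fin.
by apply: eq_esum => -[].
Qed.

Lemma summ_section f (D1 : set T1) (D2 : set T2) : summ (D1 `*` D2) f ->
  forall i, D1 i -> summ D2 (fun j => f (i, j)).
Proof.
move=> sf i Di; apply: le_lt_trans sf.
rewrite -(esum_pair (f := fun p => `|f p|))// (esumID [set i])/=; last first.
  by move=> k _; apply: esum_ge0.
rewrite setIidr; last by move=> _ ->.
rewrite esum_set1; last by apply: esum_ge0.
by rewrite leeDl//; apply: esum_ge0 => k _; apply: esum_ge0.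
Qed.

Lemma psum_fubini f (D1 : set T1) (D2 : set T2) : (forall p, 0 <= f p) ->
  summ (D1 `*` D2) f ->
  summ D1 (fun i => psum D2 (fun j => f (i, j))) /\
  psum (D1 `*` D2) f = psum D1 (fun i => psum D2 (fun j => f (i, j))).
Proof.
move=> f0 sf.
have e : (\esum_(i in D1) (psum D2 (fun j => f (i, j)))%:E = \esum_(p in D1 `*` D2) (f p)%:E)%E.
  rewrite -esum_pair//; apply: eq_esum => i Di.
  by rewrite psumE//; exact: summ_section sf _ Di.
split; last by rewrite /psum e.
rewrite /summ (eq_esum (b := fun i => (psum D2 (fun j => f (i, j)))%:E)).
  by rewrite e; apply: summP.
by move=> i _; rewrite ger0_norm//; apply: psum_ge0.
Qed.

Lemma rsum_fubini f (D1 : set T1) (D2 : set T2) : summ (D1 `*` D2) f ->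
  summ D1 (fun i => rsum D2 (fun j => f (i, j))) /\
  rsum (D1 `*` D2) f = rsum D1 (fun i => rsum D2 (fun j => f (i, j))).
Proof.
move=> sf.
have [s1 e1] := psum_fubini (f := fun p => Num.max (f p) 0) (fun p => mx _) (summ_max sf).
have [s2 e2] := psum_fubini (f := fun p => Num.max (- f p) 0) (fun p => mx _) (summ_max (summN sf)).
split; first exact: summB.
by rewrite /rsum e1 e2 -rsum_sub// => i _; exact: psum_ge0.
Qed.

Lemma summ_pair (u : T1 -> R) (v : T2 -> R) (D1 : set T1) (D2 : set T2) :
  summ D1 u -> summ D2 v -> summ (D1 `*` D2) (fun p => u p.1 * v p.2).
Proof.
move=> su sv; rewrite /summ -(esum_pair (f := fun p => `|u p.1 * v p.2|))//=.
rewrite (eq_esum (b := fun i => (rsum D2 (fun j => `|v j|) * `|u i|)%:E)); last first.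
  move=> i _; rewrite (eq_esum (b := fun j => (`|u i| * `|v j|)%:E)); last first.
    by move=> j _; rewrite normrM.
  by rewrite esumZ// mulrC EFinM rsum_psum ?psumE//; exact: summ_norm.
rewrite esumZ; last by apply: rsum_ge0 => //; exact: summ_norm.
rewrite -psumE//; last exact: summ_norm.
by rewrite -EFinM ltry.
Qed.

Lemma summ_pair_of f (D1 : set T1) (D2 : set T2) :
  (forall i, D1 i -> summ D2 (fun j => f (i, j))) ->
  summ D1 (fun i => rsum D2 (fun j => `|f (i, j)|)) -> summ (D1 `*` D2) f.
Proof.
move=> s2 s1; rewrite /summ -(esum_pair (f := fun p => `|f p|))//=.
apply: le_lt_trans s1; apply: le_esum => i Di.
rewrite rsum_psum//; last exact/summ_norm/s2.
by rewrite ger0_norm ?psum_ge0// psumE//; exact/summ_norm/s2.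
Qed.
End Fubini.

End AbsoluteSums.

(** * Jacobi's theta inversion *)

Section TrigBounds.
Variable R : realType.
Implicit Types x y u v : R.

Lemma derive_ge0_le (f df : R -> R) x : 0 <= x ->
  (forall y, is_derive y 1 f (df y)) -> (forall y, 0 <= y <= x -> 0 <= df y) ->
  f 0 <= f x.
Proof.
move=> x0 fd df0.
have cf : {within `[0, x], continuous f}.
  apply: continuous_subspaceT => y.
  by apply: differentiable_continuous; apply/derivable1_diffP; have [] := fd y.
have [c c0 e] := MVT_segment x0 (fun y _ => fd y) cf.
by rewrite -subr_ge0 e mulr_ge0 ?df0 ?subr_ge0// -in_itv.
Qed.

Lemma sin_le x : 0 <= x -> sin x <= x.
Proof.
move=> x0; rewrite -subr_ge0.
have := @derive_ge0_le (fun y => y - sin y) (fun y => 1 - cos y) x x0.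
rewrite sin0 subr0; apply=> y.
by rewrite subr_ge0 cos_le1.
Qed.

Lemma sin_sqr_le x : sin x ^+ 2 <= x ^+ 2.
Proof.
wlog x0 : x / 0 <= x => [hw|].
  have [x0|x0] := leP 0 x; first exact: hw.
  by have := hw (- x); rewrite sinN !sqrrN oppr_ge0; apply; exact: ltW.
have [x1|x1] := leP x 2.
  by rewrite ler_sqr ?nnegrE ?sin_le// sin_ge0_pi// x0 (le_trans x1)// pi_ge2.
by rewrite (le_trans (y := 1)) ?sin2cos2 ?lerBlDr ?lerDl ?sqr_ge0// expr_ge1//; lra.
Qed.

Lemma cos_ge u : 1 - u ^+ 2 / 2 <= cos u.
Proof.
have -> : u = (u / 2) *+ 2 by rewrite -mulr_natr; field.
rewrite cos_mulr2n cos2sin2 -mulr_natr.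
by have := sin_sqr_le (u / 2); lra.
Qed.

Lemma xcos_le_sin x : 0 <= x <= pi -> x * cos x <= sin x.
Proof.
move=> /andP[x0 xpi]; rewrite -subr_ge0.
have := @derive_ge0_le (fun y => sin y - y * cos y) (fun y => y * sin y) x x0.
rewrite sin0 mul0r subr0; apply=> y.
  apply: is_derive_eq.
  by rewrite /GRing.scale/=; ring.
by move=> /andP[y0 yx]; rewrite mulr_ge0// sin_ge0_pi// y0 (le_trans yx).
Qed.

(** The function [cos y * exp (y ^ 2 / 2)] has derivative [(y cos y - sin y) exp (y ^ 2 / 2)], which
    is nonpositive by [xcos_le_sin], so it decreases from its value 1 at 0. *)
Lemma cos_le_exp u : `|u| <= pi / 2 -> cos u <= expR (- (u ^+ 2 / 2)).
Proof.
wlog u0 : u / 0 <= u => [hw|].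
  have [u0|u0] := leP 0 u; first exact: hw.
  by rewrite -(normrN u) => h; rewrite -(opprK u) cosN sqrrN hw// oppr_ge0 ltW.
rewrite ger0_norm// => upi.
rewrite expRN -div1r ler_pdivlMr ?expR_gt0//.
have := @derive_ge0_le (fun y => - (cos y * expR (y ^+ 2 / 2)))
  (fun y => expR (y ^+ 2 / 2) * (sin y - y * cos y)) u u0.
rewrite lerN2 expr0n mul0r expR0 cos0 mul1r; apply=> y.
  apply: is_derive_eq.
  by rewrite /GRing.scale/=; field.
move=> /andP[y0 yu]; rewrite mulr_ge0 ?expR_ge0// subr_ge0 xcos_le_sin// y0/=.
by rewrite (le_trans yu)// (le_trans upi)// ler_pdivrMr// ler_peMr ?pi_ge0// ler1n.
Qed.

Lemma exp_le_oneB v : v < 1 -> expR (- (v / (1 - v))) <= 1 - v.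
Proof.
move=> v1; have h : 0 < 1 - v by lra.
rewrite expRN -[leRHS]invrK lef_pV2 ?posrE ?invr_gt0 ?expR_gt0//.
apply: (le_trans _ (expR_ge1Dx _)); rewrite le_eqVlt; apply/orP; left; apply/eqP.
by field; rewrite gt_eqF.
Qed.

Lemma cosD2pi_int x (k : int) : cos (x + 2 * pi * k%:~R) = cos x.
Proof.
have h (n : nat) (z : R) : cos (z + 2 * pi * n%:R) = cos z.
  have -> : z + 2 * pi * n%:R = z + (pi *+ 2) *+ n.
    by rewrite -[(pi *+ 2) *+ n]mulr_natr -[pi *+ 2]mulr_natr; ring.
  exact: (periodicn (@cosD2pi R)).
case: k => n; first exact: h.
by rewrite NegzE -(h n.+1) mulrNz mulrN subrK.
Qed.

End TrigBounds.

(** * Summability over the integers *)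

Section IntSums.
Variable R : realType.

Lemma rsum_int_shift (f : int -> R) (m : int) : rsum [set: int] f = rsum [set: int] (fun k => f (k + m)).
Proof.
apply: (rsum_reindex (e := fun k => k + m)); split => //.
- by move=> a b _ _ /addIr.
- by move=> b _; exists (b - m) => //; rewrite subrK.
Qed.

Lemma summ_int_shift (f : int -> R) (m : int) : summ [set: int] (fun k => f (k + m)) <-> summ [set: int] f.
Proof.
apply: (summ_reindex (e := fun k => k + m)); split => //.
- by move=> a b _ _ /addIr.
- by move=> b _; exists (b - m) => //; rewrite subrK.
Qed.

Lemma rsum_int_opp (f : int -> R) : rsum [set: int] f = rsum [set: int] (fun k => f (- k)).
Proof.
apply: (rsum_reindex (e := fun k => - k)); split => //.
Qed.

Lemma nat_pseries_le (q : R) : 0 < q -> exists M : R, forall n,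
  \sum_(0 <= k < n) (k.+1%:R `^ (1 + q))^-1 <= M.
Proof.
move=> q0; exists (1 + q^-1) => n.
(* Subtracting [m ^ (- q) / q], the integral of [x ^ (- 1 - q)] beyond [m], strengthens the bound so
   that it passes through the induction. *)
suff h m : \sum_(0 <= k < m.+1) (k.+1%:R `^ (1 + q))^-1 <= 1 + q^-1 - q^-1 * (m.+1%:R `^ (- q)).
  case: n => [|m]; first by rewrite big_nil addr_ge0// invr_ge0 ltW.
  by apply: (le_trans (h m)); rewrite lerBlDr lerDl mulr_ge0 ?powR_ge0// invr_ge0 ltW.
elim: m => [|m IH].
  by rewrite big_nat1 -[0.+1%:R]/(1:R) !powR1 invr1 mulr1 addrK.
rewrite big_nat_recr//=; apply: (le_trans (lerD IH (lexx _))).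
rewrite -powRN opprD powRD ?pnatr_eq0 ?implybT// powR_inv1//.
set k : R := m.+2%:R; set k1 : R := m.+1%:R.
have k0 : 0 < k by rewrite ltr0n.
have k10 : 0 < k1 by rewrite ltr0n.
have kk : k = k1 + 1 by rewrite /k /k1 -natr1.
have : k `^ (- q) * (1 + q / k) <= k1 `^ (- q).
  have -> : k1 `^ (- q) = k `^ (- q) * (k / k1) `^ q.
    rewrite powRM ?invr_ge0 ?ltW// mulrA (powRN k q) mulVf ?mul1r ?gt_eqF ?powR_gt0//.
    by rewrite -powR_inv1 ?ltW// -powRrM mulN1r.
  rewrite ler_pM2l ?powR_gt0// /powR gt_eqF ?divr_gt0//.
  apply: (le_trans _ (expR_ge1Dx _)); rewrite lerD2l ler_pM2l//.
  rewrite -[leLHS]opprK -[k / k1]invrK lnV ?posrE ?invr_gt0 ?divr_gt0// lerN2 invf_div.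
  have -> : k1 / k = 1 + (- k^-1) by rewrite kk; field; rewrite gt_eqF// addr_gt0.
  by apply: le_ln1Dx; rewrite ltrN2 invf_lt1// kk ltrDr.
set A := k1 `^ _; set B := k `^ _ => h.
have : q^-1 * (B * (1 + q / k)) <= q^-1 * A by rewrite ler_pM2l ?invr_gt0.
have -> : q^-1 * (B * (1 + q / k)) = q^-1 * B + k^-1 * B by field; rewrite !gt_eqF.
move: (q^-1 * B) (k^-1 * B) (q^-1 * A) q^-1 => b1 b2 b3 b4; lra.
Qed.

Lemma esum_nat_le (f : nat -> R) (M : R) : (forall n, 0 <= f n) ->
  (forall n, \sum_(0 <= k < n) f k <= M) -> (\esum_(i in [set: nat]) (f i)%:E <= M%:E)%E.
Proof.
move=> f0 fM; rewrite -nneseries_esumT; last by move=> n; rewrite lee_fin.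
apply: lime_le; first by apply: is_cvg_nneseries => n _ _; rewrite lee_fin.
by apply: nearW => n; rewrite sumEFin lee_fin.
Qed.

Lemma summ_int_nat (f : int -> R) (M : R) :
  (forall k, 0 <= f k) -> (forall k, f (- k) = f k) ->
  (forall n, \sum_(0 <= k < n) f (k.+1)%:Z <= M) -> summ [set: int] f.
Proof.
move=> f0 fN fM; rewrite /summ (eq_esum (b := fun i => (f i)%:E)); last first.
  by move=> i _; rewrite ger0_norm.
have eM : (\esum_(i in [set: nat]) (f (i.+1)%:Z)%:E <= M%:E)%E by exact: esum_nat_le.
have f0' (x : int) : [set: int] x -> (0 <= (f x)%:E)%E by move=> _; rewrite lee_fin.
rewrite (esumID [set 0%Z])// setTI esum_set1 ?lee_fin//.
rewrite (esumID [set x : int | 0 < x]); last by move=> i _; rewrite lee_fin.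
have eP : (\esum_(i in (setT `&` ~` [set (0:int)]) `&` [set x | (0 < x)%R]) (f i)%:E <= M%:E)%E.
  rewrite (reindex_esum setT _ (fun n : nat => n.+1%:Z))//; split => //.
  - by move=> a b _ _ [].
  - move=> [n|n] [[_ h0] h]; last by [].
    by case: n h0 h => [|n] h0 h; [exfalso; apply: h0|exists n].
have eN : (\esum_(i in (setT `&` ~` [set (0:int)]) `&` ~` [set x | (0 < x)%R]) (f i)%:E <= M%:E)%E.
  rewrite (reindex_esum setT _ (fun n : nat => - (n.+1%:Z)))//.
    by under eq_esum do rewrite fN.
  split => //.
  - by move=> a b _ _ /oppr_inj[].
  - move=> [n|n] [[_ h0] /= h]; last by exists n => //; rewrite NegzE.
    by case: n h0 h => [|n] h0 h; [exfalso; apply: h0|exfalso; apply: h].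
apply: (@le_lt_trans _ _ ((f 0)%:E + (M%:E + M%:E))%E); last by rewrite -!EFinD ltry.
by rewrite leeD// leeD.
Qed.

Lemma summ_int_inv (p : R) : 1 / 2 < p -> summ [set: int] (fun k => (1 + k%:~R ^+ 2) `^ (- p)).
Proof.
move=> p12; have q0 : 0 < 2 * p - 1 by lra.
have [M hM] := nat_pseries_le q0.
apply: (@summ_int_nat _ M).
- by move=> k; rewrite powR_ge0.
- by move=> k; rewrite mulrNz sqrrN.
- move=> n; apply: le_trans (hM n); apply: ler_sum => k _.
  have -> : 1 + (2 * p - 1) = 2%:R * p by ring.
  rewrite powRrM powR_mulrn ?ler0n// powRN lef_pV2 ?posrE ?powR_gt0 ?exprn_gt0 ?ltr0n//.
  apply: ge0_ler_powR; rewrite ?nnegrE ?addr_ge0 ?sqr_ge0//; first lra.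
  by rewrite lerDr.
Qed.

Lemma summ_int_gauss (c : R) : 0 < c -> summ [set: int] (fun k => expR (- (c * k%:~R ^+ 2))).
Proof.
move=> c0.
have h := @summ_int_inv 1 ltac:(lra).
apply: summ_le (summZ (1 + c^-1) h) => k _.
rewrite ger0_norm ?expR_ge0// powRN powRr1 ?addr_ge0 ?sqr_ge0//.
rewrite expRN -[leLHS]div1r ler_pdivrMr ?expR_gt0// mulrAC ler_pdivlMr; last first.
  by rewrite ltr_wpDr ?sqr_ge0.
rewrite mul1r; set y := k%:~R ^+ 2; have y0 : 0 <= y by rewrite sqr_ge0.
apply: (le_trans _ (ler_wpM2l _ (expR_ge1Dx _))); last by rewrite addr_ge0// invr_ge0 ltW.
have -> : (1 + c^-1) * (1 + c * y) = 1 + c^-1 + c * y + y by field; rewrite gt_eqF.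
have : 0 <= c * y by rewrite mulr_ge0// ltW.
have : 0 <= c^-1 by rewrite invr_ge0 ltW.
lra.
Qed.

End IntSums.

(** * A finite Poisson formula for binomial coefficients *)

Section BinomialMultisection.
Variable R : realType.
Implicit Types (x y c t phi psi : R) (n M N : nat).

Lemma rsum_single (T : choiceType) (f : T -> R) (k : T) :
  (forall i, i != k -> f i = 0) -> rsum setT f = f k.
Proof.
move=> f0; rewrite (_ : rsum setT f = rsum [set k] f).
  by rewrite rsum_fset// fsbig_set1.
rewrite [RHS]rsum_mkcond; apply: eq_rsum => i _; case: ifPn => //.
by rewrite notin_setE /= => /eqP; exact: f0.
Qed.

(** The Fourier coefficient of [(2 cos t) ^ (2 n)] at frequency [2 l]. Indexing by [n + |l|] makes
    it even in [l] and makes it vanish for [|l| > n], so that sums may run over all integers. *)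
Definition bw n (l : int) : R := 'C(n.*2, n + `|l|%N)%:R.

Lemma bw_ge0 n l : 0 <= bw n l. Proof. exact: ler0n. Qed.

Lemma bwN n l : bw n (- l) = bw n l. Proof. by rewrite /bw abszN. Qed.

Lemma bw0_gt0 n : 0 < bw n 0.
Proof. by rewrite ltr0n bin_gt0 addn0 -addnn leq_addr. Qed.

Lemma bwS n l : bw n.+1 l = bw n (l - 1) + 2 * bw n l + bw n (l + 1).
Proof.
wlog l0 : l / 0 <= l => [hw|].
  have [l0|l0] := leP 0 l; first exact: hw.
  rewrite -bwN hw ?oppr_ge0 1?ltW// bwN -(bwN n (- l - 1)) -(bwN n (- l + 1)).
  by rewrite !opprD !opprK; ring.
case: l l0 => // -[_|k _].
  rewrite sub0r add0r bwN /bw /= !addn0 doubleS addn1 binS.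
  have -> : 'C(n.*2.+1, n) = 'C(n.*2.+1, n.+1).
    by rewrite -[RHS]bin_sub; [congr 'C(_, _); lia|lia].
  by rewrite binS !natrD; ring.
have -> : (k.+1%:Z - 1) = k by lia.
have -> : (k.+1%:Z + 1) = k.+2 by lia.
have -> : bw n.+1 k.+1 = 'C(n.*2.+2, (n + k).+2)%:R by congr ('C(_, _)%:R); lia.
have -> : bw n k = 'C(n.*2, n + k)%:R by [].
have -> : bw n k.+1 = 'C(n.*2, (n + k).+1)%:R by rewrite /bw addnS.
have -> : bw n k.+2 = 'C(n.*2, (n + k).+2)%:R by rewrite /bw !addnS.
by rewrite !binS !natrD; ring.
Qed.

Lemma summ_bw n : summ [set: int] (bw n).
Proof.
elim: n => [|n IH].
  apply: summ_le (summ_int_gauss (c := 1 : R) ltr01) => l _.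
  rewrite /bw; case: (`|l|%N =P 0%N) => [/eqP|].
    by rewrite absz_eq0 => /eqP ->; rewrite normr1 expr0n mulr0 oppr0 expR0.
  by case: `|l|%N => // k _; rewrite bin0n normr0 expR_ge0.
apply: (@summ_eq _ _ _ (fun l => bw n (l - 1) + 2 * bw n l + bw n (l + 1))).
  by move=> l _; rewrite bwS.
apply: summD; first apply: summD.
- exact/(summ_int_shift _ (-1)).
- exact: summZ.
- exact/summ_int_shift.
Qed.

Lemma summ_bw_cos n (g : int -> R) : (forall l, `|g l| <= 1) ->
  summ [set: int] (fun l => bw n l * g l).
Proof.
move=> g1; apply: summ_le (summ_bw n) => l _.
by rewrite normrM ger0_norm ?bw_ge0// ler_piMr// bw_ge0.
Qed.

(** The free phase [phi] replaces complex exponentials: multiplication by [(2 cos t) ^ 2] turns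
    [cos phi] into [cos (phi + 2 t) + 2 cos phi + cos (phi - 2 t)], the same recursion as [bwS]. *)
Lemma cos_pow_expand n t phi :
  (2 * cos t) ^+ n.*2 * cos phi = rsum [set: int] (fun l => bw n l * cos (2 * l%:~R * t + phi)).
Proof.
elim: n phi => [|n IH] phi.
  rewrite expr0 mul1r (@rsum_single _ _ 0) ?mulr0 ?mul0r ?add0r.
    by rewrite /bw bin0 mul1r.
  move=> l l0; rewrite /bw; case: (`|l|%N =P 0%N) => [/eqP|].
    by rewrite absz_eq0 (negPf l0).
  by case: `|l|%N => // k _; rewrite bin0n mul0r.
have -> : (2 * cos t) ^+ n.+1.*2 * cos phi = (2 * cos t) ^+ n.*2 * cos (phi + t *+ 2) +
  2 * ((2 * cos t) ^+ n.*2 * cos phi) + (2 * cos t) ^+ n.*2 * cos (phi - t *+ 2).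
  rewrite doubleS !exprS; set A := _ ^+ _.
  by rewrite cosD cosB cos_mulr2n sin_mulr2n; ring.
rewrite !IH -rsumZ; last by apply: summ_bw_cos => l; exact: cos_max.
set f := fun l : int => bw n (l - 1) * cos (2 * l%:~R * t + phi).
set g := fun l : int => bw n (l + 1) * cos (2 * l%:~R * t + phi).
have -> : rsum [set: int] (fun l => bw n l * cos (2 * l%:~R * t + (phi + t *+ 2))) = rsum setT f.
  rewrite [RHS](rsum_int_shift _ 1); apply: eq_rsum => l _; rewrite /f addrK.
  by rewrite rmorphD/=; congr (_ * cos _); ring.
have -> : rsum [set: int] (fun l => bw n l * cos (2 * l%:~R * t + (phi - t *+ 2))) = rsum setT g.
  rewrite [RHS](rsum_int_shift _ (-1)); apply: eq_rsum => l _; rewrite /g subrK.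
  by rewrite rmorphD rmorphN/=; congr (_ * cos _); ring.
have sf : summ setT f.
  apply/(summ_int_shift _ 1); apply: (@summ_eq _ _ _ (fun l : int => bw n l * cos (2 * (l + 1)%:~R * t + phi))).
    by move=> l _; rewrite /f addrK.
  by apply: summ_bw_cos => l; exact: cos_max.
have sg : summ setT g.
  apply/(summ_int_shift _ (-1)); apply: (@summ_eq _ _ _ (fun l : int => bw n l * cos (2 * (l - 1)%:~R * t + phi))).
    by move=> l _; rewrite /g subrK.
  by apply: summ_bw_cos => l; exact: cos_max.
have s2 : summ [set: int] (fun l => 2 * (bw n l * cos (2 * l%:~R * t + phi))).
  by apply: summZ; apply: summ_bw_cos => l; exact: cos_max.
rewrite -!rsumD//; last exact: summD.
by apply: eq_rsum => l _; rewrite /f /g bwS; ring.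
Qed.

(** Each term times [2 sin (t / 2)] is a difference of two consecutive sines, so the sum
    telescopes. *)
Lemma sum_cos_arith N t psi :
  2 * sin (t / 2) * (\sum_(i < N) cos (i%:R * t + psi)) =
  sin (N%:R * t + (psi - t / 2)) - sin (psi - t / 2).
Proof.
elim: N => [|N IH]; first by rewrite big_ord0 mulr0 mul0r add0r subrr.
rewrite big_ord_recr/= mulrDr IH -[N.+1%:R]natr1.
set u := N%:R * t + psi.
have -> : N%:R * t + (psi - t / 2) = u - t / 2 by rewrite /u; ring.
have -> : (N%:R + 1) * t + (psi - t / 2) = u + t / 2 by rewrite /u; field.
by rewrite (sinB u (t / 2)) (sinD u (t / 2)); ring.
Qed.

(** A zero would give [cos (2 pi d / N) = 1]. This value depends only on the remainder [r] of [d],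
    and [sin (pi r / N) > 0] because [0 < r < N]. *)
Lemma sin_pi_div_neq0 N (d : int) : (0 < N)%N -> ~~ (N%:Z %| d)%Z -> sin (pi * d%:~R / N%:R) != 0 :> R.
Proof.
move=> N0 nd; have NR : 0 < N%:R :> R by rewrite ltr0n.
apply/negP => /eqP s0.
have c1 : cos (2 * (pi * d%:~R / N%:R)) = 1 :> R.
  by rewrite mulr_natl cos_mulr2n cos2sin2 s0 expr0n subr0 -mulr_natr; ring.
set r := (d %% N)%Z.
have r0 : 0 < r.
  rewrite lt_neqAle eq_sym modz_ge0 ?andbT; last by rewrite eqz_nat -lt0n.
  by apply: contra nd => /eqP h; apply/dvdz_mod0P.
have rN : r < N by apply: ltz_pmod; rewrite ltz_nat.
have c2 : cos ((pi * r%:~R / N%:R) *+ 2) = 1 :> R.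
  rewrite -[RHS]c1 -(cosD2pi_int _ (d %/ N)%Z) -mulr_natr; congr cos.
  have ed : d%:~R = (d %/ N)%Z%:~R * N%:R + r%:~R :> R by rewrite {1}(divz_eq d N) rmorphD/= rmorphM.
  rewrite ed; field.
  by rewrite gt_eqF.
have : 0 < sin (pi * r%:~R / N%:R) :> R.
  apply: sin_gt0_pi; rewrite divr_gt0 ?mulr_gt0 ?pi_gt0 ?ltr0z//=.
  by rewrite ltr_pdivrMr// ltr_pM2l ?pi_gt0// -[N%:R]/(N%:Z%:~R) ltr_int.
move: c2; rewrite cos_mulr2n cos2sin2 -mulr_natr => h.
have /eqP : sin (pi * r%:~R / N%:R) ^+ 2 = 0 :> R by lra.
by rewrite sqrf_eq0 => /eqP ->; rewrite ltxx.
Qed.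

(** Orthogonality of the characters modulo [N]. The odd modulus [N = 2 M + 1] lets the residues be
    [- M, ..., M], which later keeps all angles within [[- pi / 2, pi / 2]]. *)
Lemma sum_cos_roots M (d : int) psi : let N := M.*2.+1 in
  \sum_(i < N) cos (2 * pi * (i%:R - M%:R) * d%:~R / N%:R + psi) =
  if (N%:Z %| d)%Z then N%:R * cos psi else 0.
Proof.
move=> N; have N0 : N%:R != 0 :> R by rewrite pnatr_eq0.
case: ifPn => [/dvdzP[q ->]|nd].
  rewrite (eq_bigr (fun=> cos psi)) => [|i _].
    by rewrite sumr_const card_ord [RHS]mulr_natl.
  have -> : 2 * pi * (i%:R - M%:R) * (q * N)%:~R / N%:R + psi =
     psi + 2 * pi * ((i%:Z - M%:Z) * q)%:~R :> R.
    by rewrite !rmorphM rmorphB/=; field.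
  exact: cosD2pi_int.
set t := 2 * pi * d%:~R / N%:R : R; set psi' := psi - M%:R * t.
have s0 : sin (t / 2) != 0.
  rewrite (_ : t / 2 = pi * d%:~R / N%:R); last by rewrite /t; field.
  exact: sin_pi_div_neq0.
have := sum_cos_arith N t psi'.
have -> : N%:R * t + (psi' - t / 2) = (psi' - t / 2) + 2 * pi * d%:~R.
  by rewrite /t; field.
(* The sines are written as shifted cosines so that the periodicity lemma [cosD2pi_int] applies. *)
rewrite -(cosBpihalf (_ + 2 * pi * _)) addrAC cosD2pi_int cosBpihalf subrr.
move=> /eqP; rewrite mulf_eq0 mulf_eq0 pnatr_eq0/= (negPf s0)/= => /eqP h.
rewrite -[RHS]h; apply: eq_bigr => i _; congr cos; rewrite /psi' /t; by field.
Qed.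

(** Expanding the powers on the right by [cos_pow_expand] and summing over [i] first leaves only the
    indices congruent to [r] modulo [N]. In the limit the left side becomes a Gaussian sum and the
    right side its dual. *)
Lemma binomial_multisection n M (r : int) x c : let N := M.*2.+1 in
  N%:R * rsum [set: int] (fun k => bw n (r + k * N%:Z) *
     cos (2 * pi * x * (r + k * N%:Z)%:~R / N%:R + c)) =
  \sum_(i < N) (2 * cos (pi * ((i%:R - M%:R) + x) / N%:R)) ^+ n.*2 *
     cos (c - 2 * pi * (i%:R - M%:R) * r%:~R / N%:R).
Proof.
move=> N; have N0 : N%:R != 0 :> R by rewrite pnatr_eq0.
under [RHS]eq_bigr do rewrite cos_pow_expand.
rewrite -rsum_sum; last by move=> i _; apply: summ_bw_cos => l; exact: cos_max.
pose F l := bw n l * cos (2 * pi * x * l%:~R / N%:R + c).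
have be : set_bij [set: int] [set l | (N%:Z %| l - r)%Z] (fun k => r + k * N%:Z).
  split.
  - by move=> k _ /=; rewrite addrAC subrr add0r dvdz_mull.
  - by move=> a b _ _ /addrI /mulIf; apply.
  - by move=> l /dvdzP[q h]; exists q => //; rewrite -h addrC subrK.
have sF : summ [set: int] F by apply: summ_bw_cos => l; exact: cos_max.
have sFe : summ [set: int] (F \o (fun k => r + k * N%:Z)).
  by apply/(summ_reindex F be); apply: summ_subset sF.
rewrite -(rsumZ _ sFe) -[LHS](rsum_reindex (fun l => N%:R * F l) be).
rewrite rsum_mkcond; apply: eq_rsum => l _.
rewrite -mulr_sumr.
have -> : \sum_(i < N) cos (2 * l%:~R * (pi * (i%:R - M%:R + x) / N%:R) +
    (c - 2 * pi * (i%:R - M%:R) * r%:~R / N%:R)) =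
    \sum_(i < N) cos (2 * pi * (i%:R - M%:R) * (l - r)%:~R / N%:R + (2 * pi * x * l%:~R / N%:R + c)).
  by apply: eq_bigr => i _; congr cos; rewrite rmorphB/=; field.
rewrite sum_cos_roots -/N; case: ifPn; case: ifPn => //.
- by move=> _ _; rewrite /F; ring.
- by move=> /negP nd; rewrite inE.
- by move=> dl; rewrite notin_setE.
- by move=> _ _; rewrite mulr0.
Qed.

Lemma sum_centered M (h : int -> R) : \sum_(i < M.*2.+1) h (i%:Z - M%:Z) =
  rsum [set: int] (fun j => if (`|j| <= M)%N then h j else 0).
Proof.
have be : set_bij `I_(M.*2.+1) [set j : int | (`|j| <= M)%N] (fun i : nat => i%:Z - M%:Z).
  split.
  - by move=> i /=; lia.
  - by move=> a b _ _ /addIr[].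
  - by move=> j /= jM; exists `|(j + M%:Z)%R|%N; lia.
rewrite (@fsbig_ord _ _ _ _ (fun i : nat => h (i%:Z - M%:Z))) -rsum_fset// -(rsum_reindex h be).
rewrite rsum_mkcond; apply: eq_rsum => j _.
by rewrite (_ : (j \in _) = (`|j| <= M)%N)//; apply/idP/idP; rewrite inE.
Qed.

End BinomialMultisection.

(** * Gaussian bounds for binomial coefficients *)

Section BinomialRatio.
Variable R : realType.
Implicit Types (n l : nat).
Local Notation bw := (@bw R).

Lemma bw_step n l : (l <= n)%N -> bw n l.+1 = bw n l * ((n%:R - l%:R) / (n%:R + l%:R + 1)).
Proof.
move=> ln; have d0 : n%:R + l%:R + 1 != 0 :> R by rewrite -natrD natr1 pnatr_eq0.
apply: (mulfI d0); rewrite mulrCA [X in _ = _ * X]mulrC divfK// mulrC [RHS]mulrC.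
rewrite /bw /= -natrD natr1 -natrB// -!natrM; congr (_%:R).
rewrite addnS [LHS]mulnC mul_bin_left; congr (_ * _)%N; lia.
Qed.

Lemma bw_big n l : (n < l)%N -> bw n l = 0.
Proof. by move=> nl; rewrite /bw bin_small//=; lia. Qed.

(** The ratio in [bw_step] is [1 - x] with [x = (2 l + 1) / (n + l + 1)], hence at most [exp (- x)];
    the odd numbers [2 l + 1] add up to a square. *)
Lemma bw_le n l : (l <= n)%N -> bw n l <= bw n 0 * expR (- (l%:R ^+ 2 / (n%:R + l%:R))).
Proof.
elim: l => [|l IH] ln; first by rewrite expr0n mul0r oppr0 expR0 mulr1.
have n0 : 0 < n%:R :> R by rewrite ltr0n; lia.
have l0 : 0 <= l%:R :> R by [].
have ln' : l%:R <= n%:R :> R by rewrite ler_nat; lia.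
rewrite bw_step; last lia.
have q0 : 0 <= (n%:R - l%:R) / (n%:R + l%:R + 1) :> R by rewrite divr_ge0 ?subr_ge0// !addr_ge0.
have q1 : (n%:R - l%:R) / (n%:R + l%:R + 1) <= expR (- ((2 * l%:R + 1) / (n%:R + l%:R + 1))) :> R.
  apply: le_trans (expR_ge1Dx _); rewrite le_eqVlt; apply/orP; left; apply/eqP.
  by field; rewrite gt_eqF// !addr_gt0// ?ltr_wpDr.
apply: (le_trans (ler_pM (bw_ge0 _ _ _) q0 (IH (ltnW ln)) q1)).
rewrite -mulrA -expRD ler_pM2l ?bw0_gt0// ler_expR -opprD lerN2 -natr1.
apply: (@le_trans _ _ (l%:R ^+ 2 / (n%:R + l%:R + 1) + (2 * l%:R + 1) / (n%:R + l%:R + 1))).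
  rewrite -mulrDl addrA le_eqVlt; apply/orP; left; apply/eqP; congr (_ / _); ring.
rewrite lerD2r ler_wpM2l ?sqr_ge0// lef_pV2 ?posrE ?lerDl//.
by lra.
Qed.

(** Here the inverse ratio is written as [1 + x] with [x = (2 l + 1) / (n - l)], hence at most
    [exp x]. *)
Lemma bw_ge n l : (l <= n)%N -> bw n 0 * expR (- (l%:R ^+ 2 / (n%:R - l%:R + 1))) <= bw n l.
Proof.
elim: l => [|l IH] ln; first by rewrite expr0n mul0r oppr0 expR0 mulr1.
have n0 : 0 < n%:R :> R by rewrite ltr0n; lia.
have l0 : 0 <= l%:R :> R by [].
have ln' : 0 < n%:R - l%:R :> R by rewrite subr_gt0 ltr_nat; lia.
rewrite bw_step; last lia.
have q0 : 0 <= (n%:R - l%:R) / (n%:R + l%:R + 1) :> R by rewrite divr_ge0 ?ltW// !addr_ge0.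
have q1 : expR (- ((2 * l%:R + 1) / (n%:R - l%:R))) <= (n%:R - l%:R) / (n%:R + l%:R + 1) :> R.
  rewrite expRN -[leRHS]invf_div lef_pV2 ?posrE ?expR_gt0//; last first.
    by rewrite divr_gt0// !addr_gt0// ltr_wpDr.
  apply: le_trans (expR_ge1Dx _); rewrite le_eqVlt; apply/orP; left; apply/eqP.
  by field; rewrite gt_eqF.
apply: le_trans (ler_pM _ (expR_ge0 _) (IH (ltnW ln)) q1); last first.
  by rewrite mulr_ge0 ?bw_ge0 ?expR_ge0.
rewrite -[leRHS]mulrA -expRD ler_pM2l ?bw0_gt0// ler_expR -opprD lerN2 -natr1.
apply: (@le_trans _ _ (l%:R ^+ 2 / (n%:R - l%:R) + (2 * l%:R + 1) / (n%:R - l%:R))).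
  rewrite lerD2r ler_wpM2l ?sqr_ge0// lef_pV2 ?posrE ?lerDl//.
  by rewrite ltr_wpDr.
rewrite -mulrDl le_eqVlt; apply/orP; left; apply/eqP; congr (_ / _); ring.
Qed.

(** Cruder than [bw_le], since [n + l] is replaced by [2 b], but valid for all [l] at once; it
    supplies the dominating series in [gauss_side_cvg]. *)
Lemma bw_gauss_le n (l : int) (b : R) : n%:R <= b -> bw n l <= bw n 0 * expR (- (l%:~R ^+ 2 / (2 * b))).
Proof.
move=> nb; wlog : l / 0 <= l => [hw|].
  have [l0|l0] := leP 0 l; first exact: hw.
  by rewrite -bwN -[X in X ^+ 2]opprK sqrrN -mulrNz hw// oppr_ge0 ltW.
case: l => // l _; have [ln|nl] := leqP l n; last first.
  by rewrite bw_big// mulr_ge0 ?bw_ge0 ?expR_ge0.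
apply: (le_trans (bw_le ln)); rewrite ler_pM2l ?bw0_gt0// ler_expR lerN2.
case: l ln => [|l] ln; first by rewrite expr0n !mul0r.
have l0 : 0 < l.+1%:R :> R by rewrite ltr0n.
have ln' : l.+1%:R <= n%:R :> R by rewrite ler_nat.
rewrite ler_wpM2l ?sqr_ge0// lef_pV2 ?posrE; first lra.
- lra.
- lra.
Qed.

(** The square of the Wallis ratio, whose limit is [1 / pi]. Only the existence of the limit is
    shown in this section; its value comes out in the proof of [jacobi]. *)
Definition central_sq n : R := n%:R * (bw n 0 / 4 ^+ n) ^+ 2.

Lemma bw0S n : bw n.+1 0 = bw n 0 * (4 * (2 * n%:R + 1) / (2 * n%:R + 2)).
Proof.
rewrite bwS sub0r add0r bwN (@bw_step n 0)// subr0 addr0.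
have h : 0 <= n%:R :> R := ler0n _ _.
field; repeat (apply/andP; split); apply: lt0r_neq0; lra.
Qed.

Lemma central_sq_cvg : exists2 lam : R, 0 <= lam & central_sq n @[n --> \oo] --> lam.
Proof.
have nd : nondecreasing_seq central_sq.
  apply/nondecreasing_seqP => n; rewrite /central_sq bw0S [4 ^+ n.+1]exprS.
  set w := bw n 0 / 4 ^+ n.
  have p0 : 4 ^+ n != 0 :> R by rewrite expf_neq0// pnatr_eq0.
  have nn : 2 * n%:R + 2 != 0 :> R by rewrite gt_eqF// ltr_wpDl// mulr_ge0.
  have -> : bw n 0 * (4 * (2 * n%:R + 1) / (2 * n%:R + 2)) / (4 * 4 ^+ n) = w * ((2 * n%:R + 1) / (2 * n%:R + 2)).
    by rewrite /w; field; rewrite nn p0.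
  set q := _ / (2 * n%:R + 2).
  have -> : n.+1%:R * (w * q) ^+ 2 = (n.+1%:R * q ^+ 2) * w ^+ 2 by ring.
  rewrite ler_wpM2r ?sqr_ge0// /q -natr1 expr_div_n mulrA.
  have x0 : 0 <= n%:R :> R by [].
  rewrite ler_pdivlMr; last by rewrite exprn_gt0// ltr_wpDl// mulr_ge0.
  move: x0; set x := n%:R => x0; nra.
have ub n : central_sq n <= 1.
  (* With the factor [2 n + 1] in place of [n] the sequence decreases, starting from 1. *)
  apply: (@le_trans _ _ ((2 * n%:R + 1) * (bw n 0 / 4 ^+ n) ^+ 2)).
    by rewrite ler_wpM2r ?sqr_ge0//; have : 0 <= n%:R :> R by []; lra.
  elim: n => [|n IH]; first by rewrite mulr0 add0r mul1r /bw bin0 expr0 divr1 expr1n.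
  apply: le_trans IH; rewrite bw0S [4 ^+ n.+1]exprS.
  set w := bw n 0 / 4 ^+ n.
  have p0 : 4 ^+ n != 0 :> R by rewrite expf_neq0// pnatr_eq0.
  have nn : 2 * n%:R + 2 != 0 :> R by rewrite gt_eqF// ltr_wpDl// mulr_ge0.
  have -> : bw n 0 * (4 * (2 * n%:R + 1) / (2 * n%:R + 2)) / (4 * 4 ^+ n) = w * ((2 * n%:R + 1) / (2 * n%:R + 2)).
    by rewrite /w; field; rewrite nn p0.
  set q := _ / (2 * n%:R + 2).
  have -> : (2 * n.+1%:R + 1) * (w * q) ^+ 2 = ((2 * n.+1%:R + 1) * q ^+ 2) * w ^+ 2 by ring.
  rewrite ler_wpM2r ?sqr_ge0// /q -natr1 expr_div_n mulrA.
  have x0 : 0 <= n%:R :> R by [].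
  rewrite ler_pdivrMr; last by rewrite exprn_gt0// ltr_wpDl// mulr_ge0.
  move: x0; set x := n%:R => x0; nra.
have c : cvgn central_sq by apply: nondecreasing_is_cvgn => //; exists 1 => _ [n _ <-].
exists (limn central_sq) => //.
by apply: limr_ge => //; apply: nearW => n; rewrite mulr_ge0// sqr_ge0.
Qed.

End BinomialRatio.

(** * Passage to the limit in the finite Poisson formula *)

Section Jacobi.
Variable R : realType.
Implicit Types (a b x y c v l : R).
Local Notation bw := (@bw R).

Let N (M : nat) : nat := M.*2.+1.

Let N0 M : (0 : R) < (N M)%:R. Proof. by rewrite ltr0n. Qed.

Let invN_cvg : ((N M)%:R^-1 : R) @[M --> \oo] --> 0.
Proof.
apply: (squeeze_cvgr (f := fun=> 0) (h := @harmonic R)); [|exact: cvg_cst|exact: cvg_harmonic].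
apply: nearW => M; rewrite invr_ge0 ler0n/= lef_pV2 ?posrE ?ltr0n// ler_nat /N.
by rewrite ltnS -addnn leq_addr.
Qed.

Lemma cvg_expR_comp (T : Type) (F : set_system T) {FF : Filter F} (f : T -> R) (l : R) :
  f t @[t --> F] --> l -> expR (f t) @[t --> F] --> expR l.
Proof. by move=> fl; apply: continuous_cvg => //; exact: continuous_expR. Qed.

Lemma cvg_cos_comp (T : Type) (F : set_system T) {FF : Filter F} (f : T -> R) (l : R) :
  f t @[t --> F] --> l -> cos (f t) @[t --> F] --> cos l.
Proof. by move=> fl; apply: continuous_cvg => //; exact: continuous_cos. Qed.

Lemma cvg_sqr_comp (T : Type) (F : set_system T) {FF : Filter F} (f : T -> R) (l : R) :
  f t @[t --> F] --> l -> f t ^+ 2 @[t --> F] --> l ^+ 2.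
Proof. by move=> h; rewrite expr2; under eq_fun do rewrite expr2; exact: cvgM. Qed.

(** Scaling of the limit: the residue [fl] satisfies [fl / N -> y] and the power [nn] satisfies
    [nn / N ^ 2 -> b]. The successor in [nn] makes the ratio [bb] approach [b] from above, so it
    stays positive. *)
Let fl y M : int := Num.floor ((N M)%:R * y : R).
Let rr y M : R := (fl y M)%:~R / (N M)%:R.
Let nn b M : nat := (Num.truncn (b * (N M)%:R ^+ 2)).+1.
Let bb b M : R := (nn b M)%:R / (N M)%:R ^+ 2.

Let invN_le1 M : ((N M)%:R^-1 : R) <= 1.
Proof. by rewrite invf_le1// ler1n. Qed.

Let rr_itv y M : y - (N M)%:R^-1 <= rr y M <= y.
Proof.
have h1 := real_floor_le (num_real ((N M)%:R * y)).
have h2 := real_floorD1_gt (num_real ((N M)%:R * y)).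
rewrite /rr ler_pdivrMr// ler_pdivlMr// mulrBl mulVf ?gt_eqF// [y * _]mulrC h1 andbT.
by rewrite lerBlDr -[1]/(1%:~R) -intrD ltW.
Qed.

Let rr_cvg y : rr y M @[M --> \oo] --> y.
Proof.
apply: (squeeze_cvgr (f := fun M => y - (N M)%:R^-1) (h := fun=> y)).
- by apply: nearW => M; exact: rr_itv.
- by rewrite -[X in _ --> X]subr0; apply: cvgB => //; exact: cvg_cst.
- exact: cvg_cst.
Qed.

Let rr_le y M : (rr y M) ^+ 2 <= (`|y| + 1) ^+ 2.
Proof.
have /andP[h1 h2] := rr_itv y M; have h3 := invN_le1 M.
rewrite -[leLHS]real_normK ?num_real// ler_sqr ?nnegrE ?addr_ge0//.
rewrite ler_norml; have := ler_norm y; have := ler_norm (- y); rewrite normrN => h4 h5.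
by apply/andP; split; lra.
Qed.

Let bb_itv b M : 0 < b -> b <= bb b M <= b + (N M)%:R^-1.
Proof.
move=> b0; have h0 : 0 <= b * (N M)%:R ^+ 2 :> R by rewrite mulr_ge0 ?sqr_ge0 ?ltW.
have /andP[h1 h2] := truncn_itv h0.
have h3 := invN_le1 M.
rewrite /bb ler_pdivlMr ?exprn_gt0// ler_pdivrMr ?exprn_gt0// /nn.
rewrite (ltW h2) mulrDl -[X in _ <= _ + X]/(_^-1 * (_ * _)) mulrA mulVf ?gt_eqF// mul1r.
have : 1 <= (N M)%:R :> R by rewrite ler1n.
by rewrite -natr1; lra.
Qed.

Let bb_cvg b : 0 < b -> bb b M @[M --> \oo] --> b.
Proof.
move=> b0.
apply: (squeeze_cvgr (f := fun=> b) (h := fun M => b + (N M)%:R^-1)).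
- by apply: nearW => M; exact: bb_itv.
- exact: cvg_cst.
- by rewrite -[X in _ --> X]addr0; apply: cvgD => //; exact: cvg_cst.
Qed.

Let NE M : (N M)%:R != 0 :> R. Proof. by rewrite gt_eqF. Qed.

(** A local limit theorem of de Moivre and Laplace: with [l = q N] and [n = bb N ^ 2], the two
    exponents in [bw_le] and [bw_ge] have the same limit. *)
Lemma bw_ratio_cvg b y (k : int) : 0 < b ->
  bw (nn b M) (fl y M + k * (N M)%:Z) / bw (nn b M) 0 @[M --> \oo] -->
  expR (- ((y + k%:~R) ^+ 2 / b)).
Proof.
move=> b0.
pose q M : R := `|rr y M + k%:~R|; pose e M : R := (N M)%:R^-1.
have qc : q M @[M --> \oo] --> `|y + k%:~R|.
  by apply: cvg_norm; apply: cvgD; [exact: rr_cvg|exact: cvg_cst].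
have qe : q M * e M @[M --> \oo] --> 0.
  by rewrite -[X in _ --> X](mulr0 (`|y + k%:~R|)); apply: cvgM.
have bn0 : b != 0 by rewrite gt_eqF.
pose L M : nat := `|(fl y M + k * (N M)%:Z)%R|%N.
have LE M : (L M)%:R = q M * (N M)%:R.
  rewrite /L natr_absz intr_norm rmorphD rmorphM/=.
  have -> : (fl y M)%:~R + k%:~R * (N M)%:R = (rr y M + k%:~R) * (N M)%:R :> R.
    by rewrite mulrDl /rr divfK.
  by rewrite normrM (ger0_norm (ltW (N0 M))).
have nE M : (nn b M)%:R = bb b M * (N M)%:R ^+ 2 by rewrite /bb divfK// expf_neq0.
pose fl' M := expR (- (q M ^+ 2 / (bb b M - q M * e M + e M ^+ 2))).
pose fu M := expR (- (q M ^+ 2 / (bb b M + q M * e M))).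
apply: (squeeze_cvgr (f := fl') (h := fu)).
- have lt : \forall M \near \oo, q M * e M < b by apply: cvgr_lt qe _ b0.
  near=> M.
  have qb : q M * e M < b by near: M.
  have /andP[bb1 _] := bb_itv M b0.
  have Ln : (L M <= nn b M)%N.
    rewrite -(ler_nat R) LE nE; have -> : q M * (N M)%:R = (q M * e M) * (N M)%:R ^+ 2.
      by rewrite /e; field.
    by rewrite ler_pM2r ?exprn_gt0// ltW// (lt_le_trans qb).
  have ed : bw (nn b M) (fl y M + k * N M) = bw (nn b M) (L M) by [].
  rewrite ed ler_pdivlMr ?bw0_gt0// ler_pdivrMr ?bw0_gt0// ![_ * bw _ 0]mulrC.
  have ln := bw_le R Ln; have ln2 := bw_ge R Ln.
  have q0 : 0 <= q M by rewrite normr_ge0.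
  have e0 : 0 < e M by rewrite invr_gt0.
  have qe0 : 0 <= q M * e M by rewrite mulr_ge0// ltW.
  have e20 : 0 < e M ^+ 2 by rewrite exprn_gt0.
  apply/andP; split; [move: ln2|move: ln]; rewrite LE nE.
    rewrite (_ : (q M * (N M)%:R) ^+ 2 / _ = q M ^+ 2 / (bb b M - q M * e M + e M ^+ 2))//.
    have d1 : bb b M * (N M)%:R ^+ 2 - q M * (N M)%:R + 1 = (bb b M - q M * e M + e M ^+ 2) * (N M)%:R ^+ 2.
      by rewrite /e; field.
    by rewrite d1 exprMn -mulf_div divff ?expf_neq0// mulr1.
  rewrite (_ : (q M * (N M)%:R) ^+ 2 / _ = q M ^+ 2 / (bb b M + q M * e M))//.
  have d1 : bb b M * (N M)%:R ^+ 2 + q M * (N M)%:R = (bb b M + q M * e M) * (N M)%:R ^+ 2.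
    by rewrite /e; field.
  by rewrite d1 exprMn -mulf_div divff ?expf_neq0// mulr1.
- rewrite -[(y + k%:~R) ^+ 2]real_normK ?num_real//.
  apply: cvg_expR_comp; apply: cvgN; apply: cvgM; first exact: (cvg_sqr_comp qc).
  apply: cvgV => //; rewrite -[X in _ --> X](addr0 b) -[X in _ --> X + _](subr0 b).
  apply: cvgD; first by apply: cvgB => //; exact: bb_cvg.
  by rewrite -[X in _ --> X](expr0n R 2); exact: (cvg_sqr_comp invN_cvg).
- rewrite -[(y + k%:~R) ^+ 2]real_normK ?num_real//.
  apply: cvg_expR_comp; apply: cvgN; apply: cvgM; first exact: (cvg_sqr_comp qc).
  apply: cvgV => //; rewrite -[X in _ --> X](addr0 b).
  by apply: cvgD => //; exact: bb_cvg.
Unshelve. all: by end_near. Qed.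

Let sqr_half (u v : R) : v ^+ 2 / 2 - u ^+ 2 <= (u + v) ^+ 2.
Proof. have := sqr_ge0 (2 * u + v); rewrite !expr2; lra. Qed.

Lemma gauss_side_cvg b x y c : 0 < b ->
  rsum [set: int] (fun k => bw (nn b M) (fl y M + k * (N M)%:Z) / bw (nn b M) 0 *
     cos (2 * pi * x * (rr y M + k%:~R) + c)) @[M --> \oo] -->
  rsum [set: int] (fun k => expR (- ((y + k%:~R) ^+ 2 / b)) * cos (2 * pi * x * (y + k%:~R) + c)).
Proof.
move=> b0; have b1 : 0 < b + 1 by lra.
pose Y := (`|y| + 1) ^+ 2.
(* The shift [rr] is bounded and [(u + v) ^ 2 >= v ^ 2 / 2 - u ^ 2], so a constant factor absorbs it
   at the price of half of the Gaussian exponent. *)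
pose C := expR (Y / (2 * (b + 1))).
have sg : summ [set: int] (fun k => C * expR (- ((4 * (b + 1))^-1 * k%:~R ^+ 2))).
  by apply: summZ; apply: summ_int_gauss; rewrite invr_gt0; lra.
apply: (tannery sg).
- move=> M k _; rewrite normrM ger0_norm ?divr_ge0 ?bw_ge0//.
  apply: (@le_trans _ _ (bw (nn b M) (fl y M + k * (N M)%:Z) / bw (nn b M) 0)).
    by rewrite ler_piMr ?cos_max// divr_ge0 ?bw_ge0.
  rewrite ler_pdivrMr ?bw0_gt0// [leRHS]mulrC.
  have nb : (nn b M)%:R <= (b + 1) * (N M)%:R ^+ 2.
    have /andP[_ h] := bb_itv M b0.
    rewrite -ler_pdivrMr ?exprn_gt0//; apply: (le_trans h).
    by rewrite lerD2l.
  apply: (le_trans (bw_gauss_le _ nb)); rewrite ler_pM2l ?bw0_gt0// -expRD ler_expR.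
  have -> : (fl y M + k * N M)%:~R ^+ 2 / (2 * ((b + 1) * (N M)%:R ^+ 2)) = (rr y M + k%:~R) ^+ 2 / (2 * (b + 1)).
    rewrite rmorphD rmorphM/= /rr; field.
    by rewrite NE /= gt_eqF.
  have -> : Y / (2 * (b + 1)) - (4 * (b + 1))^-1 * k%:~R ^+ 2 = - ((k%:~R ^+ 2 / 2 - Y) / (2 * (b + 1))).
    by field; rewrite gt_eqF.
  rewrite lerN2 ler_pM2r ?invr_gt0 ?mulr_gt0//.
  by apply: le_trans (sqr_half _ _); have := rr_le y M; rewrite /Y; lra.
- move=> k _; apply: cvgM; first exact: bw_ratio_cvg.
  apply: cvg_cos_comp; apply: cvgD; last exact: cvg_cst.
  apply: cvgM; first exact: cvg_cst.
  by apply: cvgD; [exact: rr_cvg|exact: cvg_cst].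
Qed.

(** With [u = p / N], the bounds [1 - u ^ 2 / 2 <= cos u <= exp (- u ^ 2 / 2)] raised to the power
    [2 nn] squeeze the sequence, since [nn u ^ 2 = bb p ^ 2]. *)
Lemma cos_pow_cvg b x (j : int) : 0 < b ->
  cos (pi * (j%:~R + x) / (N M)%:R) ^+ (nn b M).*2 @[M --> \oo] --> expR (- (b * (pi * (j%:~R + x)) ^+ 2)).
Proof.
move=> b0; set p := pi * (j%:~R + x).
pose e M : R := (N M)%:R^-1.
have pe : (p * e M) ^+ 2 / 2 @[M --> \oo] --> 0.
  rewrite -[X in _ --> X](mul0r 2^-1); apply: cvgM; last exact: cvg_cst.
  rewrite -[X in _ --> X](expr0n R 2); apply: cvg_sqr_comp.
  by rewrite -[X in _ --> X](mulr0 p); apply: cvgM => //; exact: cvg_cst.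
have pe1 : `|p * e M| @[M --> \oo] --> 0.
  rewrite -[X in _ --> X](normr0 R); apply: cvg_norm.
  by rewrite -[X in _ --> X](mulr0 p); apply: cvgM => //; exact: cvg_cst.
have key M u : (nn b M)%:R * (p * e M) ^+ 2 / u = bb b M * p ^+ 2 / u.
  by congr (_ / _); rewrite /bb /e; field; exact: NE.
apply: (squeeze_cvgr (f := fun M => expR (- (bb b M * p ^+ 2 / (1 - (p * e M) ^+ 2 / 2))))
  (h := fun M => expR (- (bb b M * p ^+ 2)))).
- near=> M.
  have u1 : (p * e M) ^+ 2 / 2 < 1 by near: M; apply: cvgr_lt pe _ _.
  have u2 : `|p * e M| <= pi / 2.
    by near: M; apply: cvgr_le pe1 _ _; rewrite divr_gt0 ?pi_gt0.
  have h1 := cos_ge (p * e M); have h2 := cos_le_exp u2; have h3 := exp_le_oneB u1.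
  have c0 := le_trans (expR_ge0 _) (le_trans h3 h1).
  rewrite -/(e M); apply/andP; split.
    apply: le_trans (lerXn2r _ _ _ (le_trans h3 h1)); rewrite ?nnegrE ?expR_ge0//.
    rewrite -expRM_natl ler_expR mulrN lerN2 -key -muln2 natrM le_eqVlt; apply/orP; left; apply/eqP.
    by field; apply: lt0r_neq0; lra.
  apply: (le_trans (lerXn2r _ _ _ h2)); rewrite ?nnegrE ?expR_ge0//.
  rewrite -expRM_natl ler_expR mulrN lerN2 -[bb b M * _]divr1 -key divr1 -muln2 natrM.
  by rewrite le_eqVlt; apply/orP; left; apply/eqP; field.
- apply: cvg_expR_comp; apply: cvgN; rewrite -[X in _ --> X]divr1.
  apply: cvgM; first by apply: cvgM; [exact: bb_cvg|exact: cvg_cst].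
  apply: cvgV => //; rewrite -[X in _ --> X](subr0 1).
  by apply: cvgB => //; exact: cvg_cst.
- by apply: cvg_expR_comp; apply: cvgN; apply: cvgM; [exact: bb_cvg|exact: cvg_cst].
Unshelve. all: by end_near. Qed.

Lemma cos_side_cvg b x y c : 0 < b -> `|x| <= 1 / 2 ->
  rsum [set: int] (fun j => if (`|j| <= M)%N then
     cos (pi * (j%:~R + x) / (N M)%:R) ^+ (nn b M).*2 * cos (c - 2 * pi * j%:~R * rr y M) else 0)
   @[M --> \oo] -->
  rsum [set: int] (fun j => expR (- (b * (pi * (j%:~R + x)) ^+ 2)) * cos (c - 2 * pi * j%:~R * y)).
Proof.
move=> b0 x12.
have p0 := pi_gt0 R.
have c20 : 0 < b * pi ^+ 2 / 2 by rewrite divr_gt0// mulr_gt0// exprn_gt0.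
pose C := expR (b * pi ^+ 2 * x ^+ 2).
have sg : summ [set: int] (fun k => C * expR (- ((b * pi ^+ 2 / 2) * k%:~R ^+ 2))).
  by apply: summZ; apply: summ_int_gauss.
apply: (tannery sg).
- move=> M j _; case: ifPn => jM; last by rewrite normr0 mulr_ge0 ?expR_ge0.
  rewrite normrM.
  apply: (@le_trans _ _ (`|cos (pi * (j%:~R + x) / (N M)%:R) ^+ (nn b M).*2|)).
    by rewrite ler_piMr ?cos_max.
  (* From [|j| <= M] and [|x| <= 1 / 2] follows [|j + x| <= N / 2], exactly the range in which
     [cos_le_exp] holds. *)
  have u2 : `|pi * (j%:~R + x) / (N M)%:R| <= pi / 2.
    rewrite !normrM normfV (ger0_norm (ltW p0)) (ger0_norm (ltW (N0 M))).
    rewrite ler_pdivrMr// -!mulrA ler_pM2l//.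
    apply: (le_trans (ler_normD _ _)); rewrite -intr_norm -natr_absz.
    have : (`|j|%N)%:R <= M%:R :> R by rewrite ler_nat.
    rewrite /N -[_.*2.+1]addn1 -muln2 natrD natrM; lra.
  have h2 := cos_le_exp u2.
  have c0 : 0 <= cos (pi * (j%:~R + x) / (N M)%:R).
    by apply: cos_ge0_pihalf; rewrite -ler_norml.
  rewrite ger0_norm ?exprn_ge0//.
  apply: (le_trans (lerXn2r _ _ _ h2)); rewrite ?nnegrE ?expR_ge0//.
  rewrite -expRM_natl -expRD ler_expR -muln2 natrM.
  have -> : (nn b M)%:R * 2 * - ((pi * (j%:~R + x) / (N M)%:R) ^+ 2 / 2) = - (bb b M * (pi ^+ 2 * (x + j%:~R) ^+ 2)).
    by rewrite /bb; field.
  have /andP[h _] := bb_itv M b0.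
  have h4 := sqr_half x j%:~R.
  have p20 : 0 < pi ^+ 2 :> R by rewrite exprn_gt0.
  have : b * (pi ^+ 2 * (x + j%:~R) ^+ 2) <= bb b M * (pi ^+ 2 * (x + j%:~R) ^+ 2).
    by rewrite ler_wpM2r// mulr_ge0// ?sqr_ge0// ltW.
  have : b * (pi ^+ 2 * (j%:~R ^+ 2 / 2 - x ^+ 2)) <= b * (pi ^+ 2 * (x + j%:~R) ^+ 2).
    by rewrite ler_pM2l// ler_pM2l.
  have -> : b * pi ^+ 2 * x ^+ 2 - b * pi ^+ 2 / 2 * j%:~R ^+ 2 = - (b * (pi ^+ 2 * (j%:~R ^+ 2 / 2 - x ^+ 2))) by field.
  lra.
- move=> j _.
  have h : cos (pi * (j%:~R + x) / (N M)%:R) ^+ (nn b M).*2 * cos (c - 2 * pi * j%:~R * rr y M) @[M --> \oo] -->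
     expR (- (b * (pi * (j%:~R + x)) ^+ 2)) * cos (c - 2 * pi * j%:~R * y).
    apply: cvgM; first exact: cos_pow_cvg.
    apply: cvg_cos_comp; apply: cvgB; first exact: cvg_cst.
    by apply: cvgM; [exact: cvg_cst|exact: rr_cvg].
  apply: cvg_trans h; apply: near_eq_cvg; near=> M; rewrite ifT//.
  by near: M; exists `|j|%N.
Unshelve. all: by end_near. Qed.

Lemma nn_cvg b : 0 < b -> nn b M @[M --> \oo] --> \oo.
Proof.
move=> b0; apply/cvgnyPge => A; near=> M.
rewrite -(ler_nat R); have h0 : 0 <= b * (N M)%:R ^+ 2 :> R by rewrite mulr_ge0 ?sqr_ge0 ?ltW.
have /andP[h1 h2] := truncn_itv h0.
apply: le_trans (ltW h2).
have : A%:R * (N M)%:R^-1 < b.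
  near: M; apply: (@cvgr_lt _ _ _ _ (fun M => A%:R * (N M)%:R^-1) 0) => //.
  by rewrite -[X in _ --> X](mulr0 A%:R); apply: cvgM => //; exact: cvg_cst.
rewrite ltr_pdivrMr// => h3; apply: (le_trans (ltW h3)).
rewrite ler_pM2l// expr2 ler_peMr ?ler1n//.
Unshelve. all: by end_near. Qed.

(** The limit of [binomial_multisection] divided by [4 ^ nn]. The prefactor [N * bw nn 0 / 4 ^ nn]
    is the square root of [central_sq nn / bb], whence the constant [sqrt (lam / b)]. *)
Lemma jacobi_const : exists2 lam : R, 0 <= lam & forall b x y c, 0 < b -> `|x| <= 1 / 2 ->
  Num.sqrt (lam / b) * rsum [set: int] (fun k => expR (- ((y + k%:~R) ^+ 2 / b)) * cos (2 * pi * x * (y + k%:~R) + c)) =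
  rsum [set: int] (fun j => expR (- (b * (pi * (j%:~R + x)) ^+ 2)) * cos (c - 2 * pi * j%:~R * y)).
Proof.
have [lam lam0 cl] := central_sq_cvg R.
exists lam => // b x y c b0 x12.
pose A M : R := (N M)%:R * bw (nn b M) 0 / 4 ^+ nn b M.
have Ac : A M @[M --> \oo] --> Num.sqrt (lam / b).
  have -> : A = (fun M => Num.sqrt (central_sq R (nn b M) / bb b M)).
    apply/funext => M; rewrite /central_sq /bb.
    have n0 : (nn b M)%:R != 0 :> R by rewrite pnatr_eq0.
    have p0 : 4 ^+ nn b M != 0 :> R by rewrite expf_neq0// pnatr_eq0.
    have -> : (nn b M)%:R * (bw (nn b M) 0 / 4 ^+ nn b M) ^+ 2 / ((nn b M)%:R / (N M)%:R ^+ 2) = A M ^+ 2.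
      by rewrite /A; field; rewrite p0 NE n0.
    by rewrite sqrtr_sqr ger0_norm// /A divr_ge0 ?exprn_ge0// mulr_ge0 ?bw_ge0.
  apply: continuous_cvg; first exact: sqrt_continuous.
  apply: cvgM; first exact: (cvg_comp _ _ (nn_cvg b0) cl).
  by apply: cvgV; [rewrite gt_eqF|exact: bb_cvg].
pose S1 M := rsum [set: int] (fun k => bw (nn b M) (fl y M + k * (N M)%:Z) / bw (nn b M) 0 *
     cos (2 * pi * x * (rr y M + k%:~R) + c)).
have L1 : A M * S1 M @[M --> \oo] --> Num.sqrt (lam / b) *
  rsum [set: int] (fun k => expR (- ((y + k%:~R) ^+ 2 / b)) * cos (2 * pi * x * (y + k%:~R) + c)).
  by apply: cvgM => //; exact: gauss_side_cvg.
have L2 := @cos_side_cvg b x y c b0 x12.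
rewrite -(cvg_lim _ L1)// -(cvg_lim _ L2)//; congr (lim (_ @ \oo)); apply/funext => M.
rewrite /S1.
have := binomial_multisection (nn b M) M (fl y M) x c.
rewrite -/(N M) /= => E.
have p0 : 4 ^+ nn b M != 0 :> R by rewrite expf_neq0// pnatr_eq0.
have b0' : bw (nn b M) 0 != 0 by rewrite gt_eqF// bw0_gt0.
apply: (mulfI p0).
have h1 : 4 ^+ nn b M * rsum [set: int] (fun j => if (`|j| <= M)%N then
     cos (pi * (j%:~R + x) / (N M)%:R) ^+ (nn b M).*2 * cos (c - 2 * pi * j%:~R * rr y M) else 0) =
   \sum_(i < N M) (2 * cos (pi * (i%:R - M%:R + x) / (N M)%:R)) ^+ (nn b M).*2 *
      cos (c - 2 * pi * (i%:R - M%:R) * (fl y M)%:~R / (N M)%:R).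
  rewrite -(sum_centered M (fun j : int => cos (pi * (j%:~R + x) / (N M)%:R) ^+ (nn b M).*2 * cos (c - 2 * pi * j%:~R * rr y M))).
  rewrite mulr_sumr; apply: eq_bigr => i _; rewrite exprMn -[(nn b M).*2]muln2 [2 ^+ _]exprM mulrA.
  have -> : (2 ^+ nn b M) ^+ 2 = 4 ^+ nn b M :> R by rewrite -exprM mulnC exprM -natrX.
  by rewrite rmorphB/= /rr !mulrA.
rewrite h1 -E /A mulrA (mulrC (4 ^+ _)) divfK// -[_ * bw _ 0 * _]mulrA; congr (_ * _).
rewrite -rsumZ.
  apply: eq_rsum => k _; rewrite mulrA mulrCA mulfV// mulr1; congr (_ * cos (_ + _)).
  by rewrite rmorphD rmorphM/= /rr; field.
have sg : summ [set: int] (fun k : int => bw (nn b M) (fl y M + k * N M)).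
  have be : set_inj [set: int] (fun k : int => fl y M + k * N M).
    by move=> k1 k2 _ _ /addrI /mulIf; apply.
  apply/(summ_reindex (bw (nn b M)) (inj_bij be)).
  exact: summ_subset (summ_bw R _).
apply: summ_le (summZ (bw (nn b M) 0)^-1 sg) => k _.
rewrite normrM ger0_norm ?divr_ge0 ?bw_ge0// mulrC [leRHS]mulrC.
by rewrite ler_piMl ?cos_max// divr_ge0 ?bw_ge0.
Qed.

Lemma jacobi a v l c : 0 < a ->
  rsum [set: int] (fun k => expR (- (pi * a * (k%:~R + v) ^+ 2)) * cos (2 * pi * l * (k%:~R + v) + c)) =
  (Num.sqrt a)^-1 * rsum [set: int] (fun m => expR (- (pi / a * (m%:~R - l) ^+ 2)) * cos (2 * pi * m%:~R * v + c)).
Proof.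
move=> a0; have [lam lam0 J] := jacobi_const.
have p0 := pi_gt0 R; have pn0 : pi != 0 :> R by rewrite gt_eqF.
(* For [b = 1 / pi] and [x = y = c = 0] the two sums are the same positive number, so the constant
   in front of it is 1. *)
have lamE : lam * pi = 1.
  have h0 : `|0 : R| <= 1 / 2 by rewrite normr0; lra.
  have := J pi^-1 0 0 0; rewrite invr_gt0 => /(_ p0 h0).
  set S := rsum _ _; set S' := rsum _ _.
  have -> : S' = S.
    apply: eq_rsum => k _; rewrite !(mulr0, mul0r, addr0, add0r, subr0, oppr0); congr (expR _ * _).
    by rewrite invrK exprMn [pi ^+ 2]expr2 mulrA [pi^-1 * _]mulrA mulVf// mul1r mulrC.
  have S0 : 0 < S.
    have sS : summ [set: int] (fun k => expR (- ((0 + k%:~R) ^+ 2 / pi^-1)) * cos (2 * pi * 0 * (0 + k%:~R) + 0) : R).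
      apply: summ_eq (summ_int_gauss (c := pi : R) p0) => k _.
      by rewrite mulr0 mul0r addr0 cos0 mulr1 add0r invrK mulrC.
    rewrite /S (rsumID [set 0%Z] sS) setTI rsum_fset// fsbig_set1.
    rewrite ltr_pwDl//.
      by rewrite mulr0 mul0r addr0 cos0 mulr1 expR_gt0.
    apply: rsum_ge0; last by apply: summ_subset sS.
    by move=> k _; rewrite mulr0 mul0r addr0 cos0 mulr1 expR_ge0.
  rewrite invrK => /(canRL (mulfK _)); rewrite gt_eqF// divff ?gt_eqF// => /(_ isT) h.
  have h2 : 0 <= lam * pi by rewrite mulr_ge0// pi_ge0.
  by rewrite -(sqr_sqrtr h2) h expr1n.
have J' x y d : `|x| <= 1 / 2 ->
  Num.sqrt a * rsum [set: int] (fun k => expR (- (pi * a * (k%:~R + y) ^+ 2)) * cos (2 * pi * x * (k%:~R + y) + d)) =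
  rsum [set: int] (fun m => expR (- (pi / a * (m%:~R - x) ^+ 2)) * cos (2 * pi * m%:~R * y + d)).
  move=> x12; have := J (pi * a)^-1 x y d; rewrite invr_gt0 mulr_gt0// => /(_ isT x12).
  rewrite invrK mulrA lamE mul1r => E.
  rewrite [RHS]rsum_int_opp -[RHS](_ : rsum [set: int] (fun j : int => expR (- ((pi * a)^-1 * (pi * (j%:~R + x)) ^+ 2)) * cos (d - 2 * pi * j%:~R * y)) = _).
    rewrite -E; congr (_ * _); apply: eq_rsum => k _.
    by rewrite [y + _]addrC [pi * a * _]mulrC.
  apply: eq_rsum => k _; rewrite mulrNz; congr (expR _ * cos _); last by ring.
  by move: (pi : R) pn0 => p pn0'; field; rewrite pn0' gt_eqF.
have sn0 : Num.sqrt a != 0 by rewrite gt_eqF// sqrtr_gt0.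
apply: (mulfI sn0); rewrite mulrA mulfV// mul1r.
(* The bound [|x| <= 1 / 2] is removed by subtracting from [l] a nearest integer [m]: the angles on
   the left change by the constant [2 pi m v] and multiples of [2 pi], and the index on the right is
   translated. *)
pose m := Num.floor (l + 1 / 2); pose x := l - m%:~R.
have x12 : `|x| <= 1 / 2.
  have h1 := real_floor_le (num_real (l + 1 / 2)).
  have h2 := real_floorD1_gt (num_real (l + 1 / 2)).
  move: h2; rewrite intrD -/m /x ler_norml => h2.
  by apply/andP; split; move: h1; rewrite -/m; lra.
have := J' x v (c + 2 * pi * m%:~R * v) x12.
rewrite (_ : rsum _ _ = rsum [set: int] (fun k => expR (- (pi * a * (k%:~R + v) ^+ 2)) * cos (2 * pi * l * (k%:~R + v) + c))); last first.
  apply: eq_rsum => k _; congr (_ * _).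
  rewrite -(cosD2pi_int _ (m * k)) /x rmorphM/=; congr cos; ring.
move=> ->; rewrite [RHS](rsum_int_shift _ m); apply: eq_rsum => k _.
by rewrite rmorphD/= /x; congr (expR _ * cos _); ring.
Qed.

End Jacobi.

(** * Poisson summation for Gaussians on lattices *)

Section PoissonPair.
Variable R : realType.

Definition ir n (z : 'rV[int]_n) : 'rV[R]_n := map_mx (fun a : int => a%:~R) z.
Definition dot n (u v : 'rV[R]_n) : R := (u *m v^T) 0 0.
Definition qf n (G : 'M[R]_n) (w : 'rV[R]_n) : R := (w *m G *m w^T) 0 0.

Lemma dotC n (u v : 'rV[R]_n) : dot u v = dot v u.
Proof. by rewrite /dot; have -> : v *m u^T = (u *m v^T)^T; [rewrite trmx_mul trmxK|rewrite [RHS]mxE]. Qed.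

Lemma dotDl n (u v w : 'rV[R]_n) : dot (u + v) w = dot u w + dot v w.
Proof. by rewrite /dot mulmxDl mxE. Qed.

Lemma dotDr n (u v w : 'rV[R]_n) : dot w (u + v) = dot w u + dot w v.
Proof. by rewrite dotC dotDl !(dotC w). Qed.

Lemma dotZl n a (u v : 'rV[R]_n) : dot (a *: u) v = a * dot u v.
Proof. by rewrite /dot -scalemxAl mxE. Qed.

Lemma dotNl n (u v : 'rV[R]_n) : dot (- u) v = - dot u v.
Proof. by rewrite -scaleN1r dotZl mulN1r. Qed.

Lemma dot_row_mx n (a b : 'rV[R]_1) (u v : 'rV[R]_n) :
  dot (row_mx a u) (row_mx b v) = a 0 0 * b 0 0 + dot u v.
Proof. by rewrite /dot tr_row_mx mul_row_col mxE; congr (_ + _); rewrite mxE big_ord1 mxE. Qed.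

(** Poisson summation for the Gaussians of a form [q] and its inverse form [q']. The translation
    [v], the frequency [l] and the phase [c] are all free because completing a square in one
    variable changes all three for the remaining variables. *)
Record poisson_pair n (q q' : 'rV[R]_n -> R) (d : R) : Prop := PoissonPair {
  pp_gt0 : 0 < d;
  pp_summ : forall v, summ [set: 'rV[int]_n] (fun z => expR (- (pi * q (ir z + v))));
  pp_summ' : forall l, summ [set: 'rV[int]_n] (fun m => expR (- (pi * q' (ir m - l))));
  pp_eq : forall v l c,
    rsum [set: 'rV[int]_n] (fun z => expR (- (pi * q (ir z + v))) * cos (2 * pi * dot l (ir z + v) + c)) =
    d * rsum [set: 'rV[int]_n] (fun m => expR (- (pi * q' (ir m - l))) * cos (2 * pi * dot (ir m) v + c)) }.

Lemma summ_cos (T : choiceType) (f g : T -> R) : summ [set: T] f -> (forall i, 0 <= f i) ->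
  summ [set: T] (fun i => f i * cos (g i)).
Proof.
move=> sf f0; apply: summ_le sf => i _.
by rewrite normrM (ger0_norm (f0 i)) ler_piMr// cos_max.
Qed.

Lemma rsum_cos_le (T : choiceType) (f g : T -> R) : summ [set: T] f -> (forall i, 0 <= f i) ->
  rsum [set: T] (fun i => f i * cos (g i)) <= rsum [set: T] f.
Proof.
move=> sf f0; apply: le_rsum => //; last exact: summ_cos.
by move=> i _; rewrite ler_piMr// cos_le1.
Qed.

Lemma poisson_pair0 (q q' : 'rV[R]_0 -> R) : q 0 = 0 -> q' 0 = 0 -> poisson_pair q q' 1.
Proof.
move=> q0 q0'.
have f0 : finite_set [set: 'rV[int]_0].
  by rewrite (_ : setT = [set 0])//; apply/seteqP; split => // x _; rewrite /= thinmx0.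
split => //.
- by move=> v; exact: summ_fset.
- by move=> l; exact: summ_fset.
- move=> v l c; rewrite mul1r; apply: eq_rsum => z _.
  have z0 (u : 'rV[R]_0) : u = 0 := thinmx0 u.
  have d0 (u w : 'rV[R]_0) : dot u w = 0 by rewrite (z0 u) -(scale0r 0) dotZl mul0r.
  by rewrite (z0 (ir z + v)) (z0 (ir z - l)) q0 q0' !d0.
Qed.

Lemma summ_gauss_shift (a x : R) : 0 < a -> summ [set: int] (fun k => expR (- (pi * a * (k%:~R + x) ^+ 2))).
Proof.
move=> a0; have pa : 0 < pi * a by rewrite mulr_gt0// pi_gt0.
have pa2 : 0 < pi * a / 2 by rewrite divr_gt0.
apply: summ_le (summZ (expR (pi * a * x ^+ 2)) (summ_int_gauss pa2)) => k _.
rewrite ger0_norm ?expR_ge0// -expRD ler_expR.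
have : 0 <= pi * a * (k%:~R + 2 * x) ^+ 2 by rewrite mulr_ge0 ?sqr_ge0 ?ltW.
move: (pi * a) (k%:~R : R) => A y; rewrite !expr2; lra.
Qed.

(** On the dual side the shift [x] occurs only in cosines. This uniform bound allows summation over
    the other coordinates, on which the shift will depend. *)
Lemma gauss_shift_le (a x : R) : 0 < a ->
  rsum [set: int] (fun k => expR (- (pi * a * (k%:~R + x) ^+ 2))) <=
  (Num.sqrt a)^-1 * rsum [set: int] (fun m => expR (- (pi / a * (m%:~R + 0) ^+ 2))).
Proof.
move=> a0; have := jacobi x 0 0 a0.
rewrite (_ : rsum _ _ = rsum [set: int] (fun k => expR (- (pi * a * (k%:~R + x) ^+ 2)))) => [->|].
  have ai : 0 < a^-1 by rewrite invr_gt0.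
  rewrite ler_wpM2l ?invr_ge0 ?sqrtr_ge0//.
  have := rsum_cos_le (fun m : int => 2 * pi * m%:~R * x + 0) (summ_gauss_shift 0 ai) (fun i => expR_ge0 _).
  apply: le_trans; rewrite le_eqVlt; apply/orP; left; apply/eqP.
  by apply: eq_rsum => k _; rewrite !(subr0, addr0).
by apply: eq_rsum => k _; rewrite mulr0 mul0r addr0 cos0 mulr1.
Qed.

Definition pair_row n (p : 'rV[int]_n * int) : 'rV[int]_(1 + n) := row_mx (p.2%:M : 'rV[int]_1) (p.1).

Lemma pair_row_bij n : set_bij [set: 'rV[int]_n * int] [set: 'rV[int]_(1 + n)] (@pair_row n).
Proof.
split => //.
- move=> [z k] [z' k'] _ _ /= /(@eq_row_mx _ 1 1 n) [/= h ->].
  by move/matrixP/(_ 0 0): h; rewrite !mxE/= !mulr1n => ->.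
- move=> w _; exists (rsubmx (w : 'rV_(1 + n)), (lsubmx (w : 'rV_(1 + n))) 0 0) => //.
  rewrite /pair_row /= -[RHS](@hsubmxK _ 1 1 n); congr (row_mx _ _).
  by apply/matrixP => i j; rewrite !ord1 !mxE/= mulr1n.
Qed.

Lemma ir_pair_row n (z : 'rV[int]_n) (k : int) : ir (pair_row (z, k)) = row_mx ((k%:~R)%:M : 'rV[R]_1) (ir z) :> 'rV[R]_(1 + n).
Proof.
rewrite /ir /pair_row /= (@map_row_mx _ _ _ 1 1 n); congr row_mx.
by apply/matrixP => i j; rewrite !ord1 !mxE/= !mulr1n.
Qed.

(** A form in one more variable, with the square completed in the first coordinate. *)
Definition ext_form n (a : R) (g : 'rV[R]_n) (q : 'rV[R]_n -> R) (w : 'rV[R]_(1 + n)) : R :=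
  a * ((lsubmx w) 0 0 + dot g (rsubmx w)) ^+ 2 + q (rsubmx w).

(** The inverse of [ext_form a g] applied to a form whose inverse is the argument [q]. *)
Definition ext_dual n (a : R) (g : 'rV[R]_n) (q : 'rV[R]_n -> R) (m : 'rV[R]_(1 + n)) : R :=
  ((lsubmx m) 0 0) ^+ 2 / a + q (rsubmx m - (lsubmx m) 0 0 *: g).

(** Jacobi's inversion in the first coordinate, for fixed remaining ones, turns the shift by [dot g]
    into a frequency; after an exchange of sums the hypothesis applies to the remaining coordinates
    with that frequency. *)
Lemma poisson_pair_ext n (a : R) (g : 'rV[R]_n) q q' d : 0 < a ->
  poisson_pair q q' d -> poisson_pair (ext_form a g q : 'rV_(1 + n) -> R) (ext_dual a g q') (d / Num.sqrt a).
Proof.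
move=> a0 [d0 sq sq' E].
have ai : 0 < a^-1 by rewrite invr_gt0.
have sa : 0 < Num.sqrt a by rewrite sqrtr_gt0.
have lsE (z : 'rV[int]_n) k (v : 'rV[R]_(1 + n)) : (lsubmx (ir (pair_row (z, k)) + v : 'rV_(1 + n))) 0 0 = k%:~R + (lsubmx v) 0 0.
  by rewrite ir_pair_row -{1}(hsubmxK v) add_row_mx row_mxKl !mxE/= mulr1n.
have rsE (z : 'rV[int]_n) k (v : 'rV[R]_(1 + n)) : rsubmx (ir (pair_row (z, k)) + v : 'rV_(1 + n)) = ir z + rsubmx v.
  by rewrite ir_pair_row -{1}(hsubmxK v) add_row_mx row_mxKr.
have qE (z : 'rV[int]_n) k (v : 'rV[R]_(1 + n)) : expR (- (pi * ext_form a g q (ir (pair_row (z, k)) + v))) =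
   expR (- (pi * q (ir z + rsubmx v))) * expR (- (pi * a * (k%:~R + ((lsubmx v) 0 0 + dot g (ir z + rsubmx v))) ^+ 2)).
  by rewrite /ext_form lsE rsE -expRD; congr expR; ring.
have qE' (z : 'rV[int]_n) k (l : 'rV[R]_(1 + n)) : expR (- (pi * ext_dual a g q' (ir (pair_row (z, k)) - l))) =
   expR (- (pi * a^-1 * (k%:~R - (lsubmx l) 0 0) ^+ 2)) *
   expR (- (pi * q' (ir z - (rsubmx l + (k%:~R - (lsubmx l) 0 0) *: g)))).
  rewrite /ext_dual lsE rsE.
  have -> : (lsubmx (- l)) 0 0 = - (lsubmx l) 0 0 by rewrite !mxE.
  have -> : rsubmx (- l) = - rsubmx l by apply/matrixP => i j; rewrite !mxE.
  by rewrite -expRD opprD addrA; congr expR; ring.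
have bij := pair_row_bij n.
have swap_bij : set_bij [set: int * 'rV[int]_n] [set: 'rV[int]_n * int] (fun p => (p.2, p.1)).
  by split => //; [move=> [? ?] [? ?] _ _ [-> ->]|move=> [x y] _; exists (y, x)].
(* The hypothesis at [v = 0] bounds the dual sum uniformly in its shift [l]. *)
pose C0 := rsum [set: 'rV[int]_n] (fun z => expR (- (pi * q (ir z + 0)))).
have C0P l : rsum [set: 'rV[int]_n] (fun m => expR (- (pi * q' (ir m - l)))) <= d^-1 * C0.
  have := E 0 l 0.
  have -> : rsum [set: 'rV[int]_n] (fun m => expR (- (pi * q' (ir m - l))) * cos (2 * pi * dot (ir m) 0 + 0)) =
     rsum [set: 'rV[int]_n] (fun m => expR (- (pi * q' (ir m - l)))).
    by apply: eq_rsum => m _; rewrite dotC -(scale0r 0) dotZl mul0r mulr0 addr0 cos0 mulr1.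
  move=> E0; rewrite -ler_pdivrMl ?invr_gt0// invrK -E0.
  exact: (rsum_cos_le _ (sq 0)).
have s1 v : summ [set: 'rV[int]_(1 + n)] (fun z => expR (- (pi * ext_form a g q (ir z + v)))).
  apply/(summ_reindex _ bij); rewrite -setXTT; apply: summ_pair_of => [z _|].
    apply: (@summ_eq _ _ _ (fun k => expR (- (pi * q (ir z + rsubmx (v : 'rV_(1 + n))))) * expR (- (pi * a * (k%:~R + ((lsubmx (v : 'rV_(1 + n))) 0 0 + dot g (ir z + rsubmx (v : 'rV_(1 + n))))) ^+ 2)))).
      by move=> k _; rewrite /= qE.
    by apply: summZ; exact: summ_gauss_shift.
  apply: summ_le (summZ ((Num.sqrt a)^-1 * rsum [set: int] (fun m => expR (- (pi / a * (m%:~R + 0) ^+ 2)))) (sq (rsubmx (v : 'rV_(1 + n))))) => z _.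
  rewrite ger0_norm; last first.
    apply: rsum_ge0 => //; apply: summ_norm.
    apply: (@summ_eq _ _ _ (fun k => expR (- (pi * q (ir z + rsubmx (v : 'rV_(1 + n))))) * expR (- (pi * a * (k%:~R + ((lsubmx (v : 'rV_(1 + n))) 0 0 + dot g (ir z + rsubmx (v : 'rV_(1 + n))))) ^+ 2)))).
      by move=> k _; rewrite /= qE.
    by apply: summZ; exact: summ_gauss_shift.
  rewrite (@eq_rsum _ _ _ _ (fun k => expR (- (pi * q (ir z + rsubmx (v : 'rV_(1 + n))))) * expR (- (pi * a * (k%:~R + ((lsubmx (v : 'rV_(1 + n))) 0 0 + dot g (ir z + rsubmx (v : 'rV_(1 + n))))) ^+ 2)))); last first.
    by move=> k _; rewrite /= qE ger0_norm// mulr_ge0 ?expR_ge0.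
  rewrite rsumZ; last exact: summ_gauss_shift.
  by rewrite mulrC ler_wpM2r ?expR_ge0// gauss_shift_le.
have s2 l : summ [set: 'rV[int]_(1 + n)] (fun m => expR (- (pi * ext_dual a g q' (ir m - l)))).
  (* The first coordinate is now the outer variable, since the shift of [q'] depends on it. *)
  apply/(summ_reindex _ bij); apply/(summ_reindex _ swap_bij); rewrite -setXTT; apply: summ_pair_of => [k _|].
    apply: (@summ_eq _ _ _ (fun z => expR (- (pi * a^-1 * (k%:~R - (lsubmx (l : 'rV_(1 + n))) 0 0) ^+ 2)) *
   expR (- (pi * q' (ir z - (rsubmx (l : 'rV_(1 + n)) + (k%:~R - (lsubmx (l : 'rV_(1 + n))) 0 0) *: g)))))).
      by move=> z _; rewrite /= qE'.
    by apply: summZ.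
  have sg := summ_gauss_shift (- (lsubmx (l : 'rV_(1 + n))) 0 0) ai.
  apply: summ_le (summZ (d^-1 * C0) sg) => k _.
  have sk : summ [set: 'rV[int]_n] (fun z => expR (- (pi * a^-1 * (k%:~R - (lsubmx (l : 'rV_(1 + n))) 0 0) ^+ 2)) *
   expR (- (pi * q' (ir z - (rsubmx (l : 'rV_(1 + n)) + (k%:~R - (lsubmx (l : 'rV_(1 + n))) 0 0) *: g))))).
    by apply: summZ.
  rewrite (@eq_rsum _ _ _ _ (fun z => expR (- (pi * a^-1 * (k%:~R - (lsubmx (l : 'rV_(1 + n))) 0 0) ^+ 2)) *
   expR (- (pi * q' (ir z - (rsubmx (l : 'rV_(1 + n)) + (k%:~R - (lsubmx (l : 'rV_(1 + n))) 0 0) *: g)))))); last first.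
    by move=> z _; rewrite /= qE' ger0_norm// mulr_ge0 ?expR_ge0.
  rewrite ger0_norm; last by apply: rsum_ge0 => // z _; rewrite mulr_ge0 ?expR_ge0.
  by rewrite rsumZ// mulrC ler_wpM2r ?expR_ge0.
split; [by rewrite divr_gt0|exact: s1|exact: s2|].
move=> v l c; pose v1 := (lsubmx (v : 'rV_(1 + n))) 0 0; pose v' := rsubmx (v : 'rV_(1 + n)).
pose l1 := (lsubmx (l : 'rV_(1 + n))) 0 0; pose l' := rsubmx (l : 'rV_(1 + n)).
have dE (z : 'rV[int]_n) k : dot l (ir (pair_row (z, k)) + v) = l1 * (k%:~R + (v1 + dot g (ir z + v'))) + dot (l' - l1 *: g) (ir z + v').
  rewrite -(@hsubmxK _ 1 1 n (ir (pair_row (z, k)) + v)) -(@hsubmxK _ 1 1 n l) dot_row_mx lsE rsE.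
  by rewrite -/v1 -/v' -/l1 -/l' dotDl dotNl dotZl; ring.
rewrite (rsum_reindex _ bij) -setXTT.
have sL : summ [set: 'rV[int]_(1 + n)] (fun z => expR (- (pi * ext_form a g q (ir z + v))) * cos (2 * pi * dot l (ir z + v) + c)).
  by apply: summ_cos => // z; exact: expR_ge0.
have sL' : summ ([set: 'rV[int]_n] `*` [set: int]) ((fun z => expR (- (pi * ext_form a g q (ir z + v))) * cos (2 * pi * dot l (ir z + v) + c)) \o @pair_row n).
  by rewrite setXTT; apply/(summ_reindex _ bij).
have [_ ->] := rsum_fubini sL'.
(* The mixed term: first coordinate already dualized, the others not yet. *)
pose F (p : 'rV[int]_n * int) := expR (- (pi * q (ir p.1 + v'))) * expR (- (pi / a * (p.2%:~R - l1) ^+ 2)) *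
   cos (2 * pi * dot (l' + (p.2%:~R - l1) *: g) (ir p.1 + v') + (2 * pi * p.2%:~R * v1 + c)).
have sF : summ [set: 'rV[int]_n * int] F.
  apply: summ_cos => [|p]; last by rewrite mulr_ge0 ?expR_ge0.
  by rewrite -setXTT; apply: (summ_pair (sq v') (summ_gauss_shift (- l1) ai)).
transitivity ((Num.sqrt a)^-1 * rsum [set: 'rV[int]_n] (fun z => rsum [set: int] (fun k => F (z, k)))).
  rewrite -rsumZ; last by have [] := rsum_fubini (f := F) (D1 := setT) (D2 := setT); rewrite setXTT.
  apply: eq_rsum => z _; set X := v1 + dot g (ir z + v').
  rewrite (@eq_rsum _ _ _ _ (fun k => expR (- (pi * q (ir z + v'))) * (expR (- (pi * a * (k%:~R + X) ^+ 2)) *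
     cos (2 * pi * l1 * (k%:~R + X) + (2 * pi * dot (l' - l1 *: g) (ir z + v') + c))))); last first.
    by move=> k _; rewrite /= qE dE -mulrA; congr (_ * (_ * cos _)); rewrite -/X; ring.
  rewrite rsumZ; last by apply: summ_cos => [|k]; [exact: summ_gauss_shift|exact: expR_ge0].
  rewrite jacobi// mulrCA; congr (_ * _); rewrite -rsumZ; last first.
    by apply: summ_cos => [|k]; [exact: (summ_gauss_shift (- l1) ai)|exact: expR_ge0].
  apply: eq_rsum => k _; rewrite /F /= mulrA; congr (_ * cos _).
  by rewrite /X !dotDl dotNl !dotZl; ring.
have [_ h1] := rsum_fubini (f := F) (D1 := setT) (D2 := setT) ltac:(by rewrite setXTT).
rewrite -h1 setXTT (rsum_reindex _ swap_bij) -setXTT.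
have sF2 : summ ([set: int] `*` [set: 'rV[int]_n]) (F \o (fun p => (p.2, p.1))).
  by rewrite setXTT; apply/(summ_reindex _ swap_bij).
have [_ ->] := rsum_fubini sF2.
rewrite (rsum_reindex _ bij) (rsum_reindex _ swap_bij) -setXTT.
pose H := (fun m => expR (- (pi * ext_dual a g q' (ir m - l))) * cos (2 * pi * dot (ir m) v + c)).
have sH : summ [set: 'rV[int]_(1 + n)] H by apply: summ_cos => // m; exact: expR_ge0.
have sH' : summ ([set: int] `*` [set: 'rV[int]_n]) ((H \o @pair_row n) \o (fun p => (p.2, p.1))).
  by rewrite setXTT; apply/(summ_reindex _ swap_bij)/(summ_reindex _ bij).
have [sH1 ->] := rsum_fubini sH'.
rewrite [d / _]mulrC -mulrA; congr (_ * _).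
rewrite -rsumZ//; apply: eq_rsum => k _.
pose K := expR (- (pi / a * (k%:~R - l1) ^+ 2)).
rewrite (@eq_rsum _ _ _ _ (fun z => K * (expR (- (pi * q (ir z + v'))) *
   cos (2 * pi * dot (l' + (k%:~R - l1) *: g) (ir z + v') + (2 * pi * k%:~R * v1 + c))))); last first.
  by move=> z _; rewrite /F /= /K; ring.
rewrite rsumZ; last by apply: summ_cos => // z; exact: expR_ge0.
rewrite E mulrCA; congr (_ * _).
rewrite -rsumZ; last by apply: summ_cos => // z; exact: expR_ge0.
apply: eq_rsum => z _; rewrite /H /= qE' mulrA; congr (_ * _ * cos _).
rewrite ir_pair_row -(hsubmxK (v : 'rV_(1 + n))) dot_row_mx -/v' mxE/= mulr1n -/v1.
ring.
Qed.

Lemma eq_poisson_pair n (q1 q2 q1' q2' : 'rV[R]_n -> R) (d1 d2 : R) :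
  q1 =1 q2 -> q1' =1 q2' -> d1 = d2 -> poisson_pair q1 q1' d1 -> poisson_pair q2 q2' d2.
Proof. by move=> /funext-> /funext-> ->. Qed.

Lemma block_qf n (a : R) (g : 'rV[R]_n) (S : 'M[R]_n) (w : 'rV[R]_(1 + n)) :
  qf (block_mx a%:M (a *: g) (a *: g)^T (S + a *: (g^T *m g))) w = ext_form a g (qf S) w.
Proof.
rewrite /qf /ext_form -{1 2}(hsubmxK w) tr_row_mx mul_row_block mul_row_col.
set x := lsubmx w; set y := rsubmx w.
have xE : x = (x 0 0)%:M by rewrite -mx11_scalar.
rewrite xE; set c := x 0 0.
have -> : (c%:M : 'rV[R]_1) *m (a *: g) = (c * a) *: g by rewrite mul_scalar_mx scalerA.
have -> : (c%:M : 'rV[R]_1) *m (a%:M : 'M[R]_1) = (c * a)%:M by rewrite -scalar_mxM.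
have gy : y *m g^T = (dot g y)%:M by rewrite [LHS]mx11_scalar -/(dot y g) dotC.
have gy' : g *m y^T = (dot g y)%:M by rewrite [LHS]mx11_scalar.
rewrite linearZ/= -scalemxAr gy mulmxDr -scalemxAr mulmxA gy !mulmxDl.
rewrite -!scalemxAl gy' -[(dot g y)%:M *m g *m y^T]mulmxA gy'.
by rewrite !tr_scalar_mx -!scalar_mxM !mxE/= !mulr1n; ring.
Qed.

(** Induction on the dimension through the Schur complement [S]: the factorization [G = L D L^T]
    with [L] unipotent gives the form, its inverse and its determinant at once. *)
Lemma posdef_poisson n (G : 'M[R]_n) : G^T = G -> (forall w, w != 0 -> 0 < qf G w) ->
  [/\ 0 < \det G, G \in unitmx & poisson_pair (qf G) (qf (invmx G)) (Num.sqrt (\det G))^-1].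
Proof.
elim: n G => [|n IH] G Gs Gp.
  rewrite det_mx00 sqrtr1 invr1; split => //; first by rewrite unitmxE det_mx00 unitr1.
  by apply: poisson_pair0; rewrite /qf mul0mx mul0mx mxE.
move: G Gs Gp; rewrite -[n.+1]/(1 + n)%N => G Gs Gp.
pose G1 : 'M[R]_(1 + n) := G.
pose a := ulsubmx G1 0 0; pose g := a^-1 *: ursubmx G1.
have a0 : 0 < a.
  pose e : 'rV[R]_(1 + n) := row_mx 1%:M 0.
  have := Gp e; rewrite /qf -[G]/G1 -(submxK G1) mul_row_block tr_row_mx trmx0 mul_row_col mulmx0 addr0.
  rewrite !mul1mx mul0mx addr0 trmx1 mulmx1; apply.
  apply/eqP => /matrixP/(_ 0 (lshift _ 0)); rewrite (@row_mxEl _ 1 1 n) !mxE/= mulr1n.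
  by move/eqP; rewrite oner_eq0.
pose S := drsubmx G1 - a *: (g^T *m g).
have an0 : a != 0 by rewrite gt_eqF.
have GE : G = block_mx a%:M (a *: g) (a *: g)^T (S + a *: (g^T *m g)).
  rewrite -[LHS]/G1 -[LHS](submxK G1); congr block_mx.
  - exact: mx11_scalar.
  - by rewrite /g scalerA mulfV// scale1r.
  - by rewrite /g scalerA mulfV// scale1r trmx_ursub [G1^T](_ : _ = G1).
  - by rewrite subrK.
have Ss : S^T = S.
  rewrite /S linearB linearZ/= trmx_mul trmxK; congr (_ - _).
  by rewrite trmx_drsub [G1^T](_ : _ = G1).
clearbody S; clearbody g.
have qG w : qf G w = ext_form a g (qf S) w by rewrite GE block_qf.
(* This first coordinate makes the completed square vanish, so that [G] takes the value of [S] at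
   [w]. *)
have Sp w : w != 0 -> 0 < qf S w.
  move=> w0; have := Gp (row_mx (- (dot g w))%:M w : 'rV_(1 + n)).
  rewrite qG /ext_form row_mxKl row_mxKr mxE/= mulr1n addNr expr0n mulr0 add0r; apply.
  apply: contra w0 => /eqP h; apply/eqP/rowP => j.
  move/matrixP/(_ 0 (rshift 1 j)): h; rewrite (@row_mxEr _ 1 1 n) => ->.
  by rewrite !mxE.
have [dS uS PS] := IH S Ss Sp.
pose L : 'M[R]_(1 + n) := block_mx 1%:M 0 g^T 1%:M.
pose D : 'M[R]_(1 + n) := block_mx a%:M 0 0 S.
have GD : G = L *m D *m L^T.
  rewrite GE /L /D tr_block_mx !mulmx_block trmxK trmx0 !trmx1.
  rewrite !(mul1mx, mulmx1, mul0mx, mulmx0, addr0, add0r) linearZ/=.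
  congr block_mx.
  - by rewrite mul_scalar_mx.
  - by rewrite mul_mx_scalar.
  - by rewrite mul_mx_scalar -scalemxAl addrC.
have dL : \det L = 1 by rewrite det_lblock !det1 mulr1.
have dG : \det G = a * \det S by rewrite GD !det_mulmx det_tr dL mul1r mulr1 det_lblock det_scalar1.
have dG0 : 0 < \det G by rewrite dG mulr_gt0.
have uG : G \in unitmx by rewrite unitmxE unitfE gt_eqF.
split => //.
apply: (eq_poisson_pair _ _ _ (poisson_pair_ext g a0 PS)).
- by move=> w; rewrite qG.
- move=> m; rewrite /ext_dual.
  pose Li : 'M[R]_(1 + n) := block_mx 1%:M 0 (- g^T) 1%:M.
  pose Di : 'M[R]_(1 + n) := block_mx (a^-1)%:M 0 0 (invmx S).
  have LLi : Li *m L = 1%:M.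
    rewrite /L /Li mulmx_block !(mul1mx, mulmx1, mul0mx, mulmx0, addr0, add0r) addNr.
    by rewrite -scalar_mx_block.
  have DDi : D *m Di = 1%:M.
    rewrite /D /Di mulmx_block !(mul0mx, mulmx0, addr0, add0r) -scalar_mxM mulfV// mulmxV//.
    by rewrite -scalar_mx_block.
  have LiL : L *m Li = 1%:M by exact: mulmx1C.
  have -> : invmx G = Li^T *m Di *m Li.
    have h : G *m (Li^T *m Di *m Li) = 1%:M.
      rewrite GD !mulmxA -[_ *m L^T *m Li^T]mulmxA -trmx_mul LLi trmx1 mulmx1.
      by rewrite -[L *m D *m Di]mulmxA DDi mulmx1 LiL.
    by rewrite -[LHS]mulmx1 -h mulKmx.
  have qL : qf (Li^T *m Di *m Li) m = qf Di (m *m Li^T).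
    by rewrite /qf trmx_mul trmxK !mulmxA.
  rewrite qL.
  have -> : m *m Li^T = row_mx (lsubmx m) (rsubmx m - (lsubmx m) 0 0 *: g).
    rewrite -{1}(hsubmxK m) /Li tr_block_mx mul_row_block !trmx1 !trmx0 linearN/= trmxK !(mulmx1, mulmx0, addr0).
    by congr row_mx; rewrite mulmxN addrC {1}(mx11_scalar (lsubmx m)) mul_scalar_mx.
  rewrite /qf mul_row_block tr_row_mx mul_row_col !mulmx0 addr0 add0r [RHS]mxE; congr (_ + _).
  by rewrite (mx11_scalar (lsubmx m)) tr_scalar_mx -!scalar_mxM !mxE/= !mulr1n; ring.
- by rewrite dG sqrtrM ?ltW// invfM mulrC.
Qed.

End PoissonPair.

(** * The functional equation of theta series *)

Section ThetaFunctional.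
Variable R : realType.
Implicit Types (n : nat) (t : R).

Lemma sqnorm_dot n (x : 'rV[R]_n) : sqnorm x = dot x x.
Proof. by rewrite /dot mxE; apply: eq_bigr => i _; rewrite mxE expr2. Qed.

Lemma sqnorm_ge0 n (x : 'rV[R]_n) : 0 <= sqnorm x.
Proof. by apply: sumr_ge0 => i _; exact: sqr_ge0. Qed.

Lemma sqnorm_eq0 n (x : 'rV[R]_n) : (sqnorm x == 0) = (x == 0).
Proof.
apply/eqP/eqP => [h|->]; last by rewrite /sqnorm big1// => i _; rewrite mxE expr0n.
apply/rowP => i; rewrite mxE; apply/eqP; rewrite -sqrf_eq0; apply/eqP.
have := @psumr_eq0P R 'I_n predT (fun i => x 0 i ^+ 2) (fun i _ => sqr_ge0 _) h i isT.
by [].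
Qed.

Lemma lvecE n (B : 'M[R]_n) z : lvec B z = ir R z *m B. Proof. by []. Qed.

Lemma theta_functional n (B : 'M[R]_n) t : B \in unitmx -> 0 < t ->
  [/\ summ [set: 'rV[int]_n] (fun z => expR (- (pi * t * sqnorm (lvec B z)))),
      summ [set: 'rV[int]_n] (fun z => expR (- (pi / t * sqnorm (lvec (dual B) z)))) &
  rsum [set: 'rV[int]_n] (fun z => expR (- (pi * t * sqnorm (lvec B z)))) =
  (Num.sqrt (t ^+ n * \det B ^+ 2))^-1 *
  rsum [set: 'rV[int]_n] (fun z => expR (- (pi / t * sqnorm (lvec (dual B) z))))].
Proof.
move=> uB t0; pose G := t *: (B *m B^T).
have qG w : qf G w = t * sqnorm (w *m B).
  by rewrite /qf /G -scalemxAr -scalemxAl mxE sqnorm_dot /dot trmx_mul !mulmxA.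
have Gs : G^T = G by rewrite /G linearZ/= trmx_mul trmxK.
have Gp w : w != 0 -> 0 < qf G w.
  move=> w0; rewrite qG mulr_gt0// lt_neqAle sqnorm_ge0 andbT eq_sym sqnorm_eq0.
  by apply: contra w0 => /eqP h; rewrite -(mulmxK uB w) h mul0mx.
have [dG uG [d0 s1 s2 E]] := posdef_poisson Gs Gp.
have Gi : invmx G = t^-1 *: ((invmx B)^T *m invmx B).
  have h : G *m (t^-1 *: ((invmx B)^T *m invmx B)) = 1%:M.
    rewrite /G -scalemxAl -scalemxAr scalerA mulfV ?gt_eqF// scale1r -mulmxA [B^T *m _]mulmxA.
    by rewrite -trmx_mul mulVmx// trmx1 mul1mx mulmxV.
  by rewrite -[LHS]mulmx1 -h mulKmx.
have qGi w : qf (invmx G) w = t^-1 * sqnorm (w *m dual B).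
  by rewrite Gi /qf -scalemxAr -scalemxAl mxE sqnorm_dot /dot /dual trmx_mul trmxK !mulmxA.
have e1 z : expR (- (pi * qf G (ir R z + 0))) = expR (- (pi * t * sqnorm (lvec B z))).
  by rewrite addr0 qG mulrA.
have e2 z : expR (- (pi * qf (invmx G) (ir R z - 0))) = expR (- (pi / t * sqnorm (lvec (dual B) z))).
  by rewrite subr0 qGi mulrA.
have dot0 u : dot u (0 : 'rV[R]_n) = 0 by rewrite /dot trmx0 mulmx0 mxE.
split.
- by apply: summ_eq (s1 0) => z _; rewrite e1.
- by apply: summ_eq (s2 0) => z _; rewrite e2.
have := E 0 0 0; rewrite /G detZ det_mulmx det_tr -expr2.
rewrite (@eq_rsum _ _ _ _ (fun z => expR (- (pi * t * sqnorm (lvec B z))))) => [->|z _].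
  congr (_ * _); apply: eq_rsum => z _.
  by rewrite e2 dot0 mulr0 addr0 cos0 mulr1.
by rewrite e1 dotC dot0 mulr0 addr0 cos0 mulr1.
Qed.

End ThetaFunctional.

(** * Frames near a given lattice *)

Section RealSpectral.
Import complex.
Variable R : realType.

(** A complex eigenvalue [a] with eigenvector [v] satisfies [a |v|^2 = v S v^* = a^* |v|^2] because
    [S] is real and symmetric, so [a] is real. *)
Lemma real_sym_eigenvalue n (S : 'M[R]_n.+1) : S^T = S -> exists a : R, eigenvalue S a.
Proof.
move=> Ss; pose C : numClosedFieldType := complex.complex R.
pose f : {rmorphism R -> C} := complex.real_complex R.
pose A : 'M[C]_n.+1 := map_mx f S.
have [a /eigenvalueP[v vA v0]] := @eigenvalue_closed C n.+1 A isT.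
have fc x : (f x)^* = f x by rewrite conj_Creal// complex.complex_real.
pose w := map_mx Num.conj v.
have wA : w *m A = a^* *: w.
  have -> : A = map_mx Num.conj A by apply/matrixP => i j; rewrite !mxE fc.
  by rewrite -map_mxM vA map_mxZ.
have AT : A^T = A by apply/matrixP => i j; rewrite !mxE -{1}Ss mxE.
have key : a *: (v *m w^T) = a^* *: (v *m w^T).
  by rewrite scalemxAl -vA -mulmxA -[A]AT -trmx_mul wA linearZ/= -scalemxAr.
have vw0 : (v *m w^T) 0 0 != 0.
  rewrite mxE; apply/eqP => h.
  case/eqP: v0; apply/rowP => i; rewrite mxE; apply/eqP; rewrite -mul_conjC_eq0; apply/eqP.
  have := @psumr_eq0P C 'I_n.+1 predT (fun i => v 0 i * (v 0 i)^*) (fun i _ => mul_conjC_ge0 _) _ i isT.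
  by apply; rewrite -[RHS]h; apply: eq_bigr => j _; rewrite !mxE.
have ar : a \is Num.real.
  apply/CrealP; move/matrixP/(_ 0 0): key; rewrite !mxE => /mulIf h; symmetry; apply: h.
  by move: vw0; rewrite mxE.
exists (complex.Re a).
have aE : a = f (complex.Re a) by rewrite /f /= complex.RRe_real.
rewrite eigenvalue_root_char -(fmorph_root f) -aE map_char_poly -eigenvalue_root_char.
by apply/eigenvalueP; exists v.
Qed.

Lemma dotBl n (u v w : 'rV[R]_n) : dot (u - v) w = dot u w - dot v w.
Proof. by rewrite dotDl dotNl. Qed.

Lemma dotBr n (u v w : 'rV[R]_n) : dot w (u - v) = dot w u - dot w v.
Proof. by rewrite dotC dotBl !(dotC w). Qed.

(** The reflection in the hyperplane orthogonal to [e - v] exchanges the unit vectors [e] and [v];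
    the identity serves when they coincide. *)
Lemma householder n (v : 'rV[R]_n.+1) : dot v v = 1 ->
  exists Q : 'M[R]_n.+1, [/\ Q^T = Q, Q *m Q = 1%:M & delta_mx 0 0 *m Q = v].
Proof.
move=> v1; pose e : 'rV[R]_n.+1 := delta_mx 0 0.
have e1 : dot e e = 1.
  by rewrite /dot /e trmx_delta mul_delta_mx mxE eqxx.
have [ve|ve] := eqVneq e v.
  by exists 1%:M; rewrite trmx1 mulmx1 mulmx1.
have [w wE] : exists w, w = e - v by exists (e - v).
pose N := dot w w.
have N0 : N != 0.
  by rewrite /N -sqnorm_dot sqnorm_eq0 wE subr_eq0.
have ww : w *m w^T = N%:M by rewrite [LHS]mx11_scalar.
exists (1%:M - (2 / N) *: (w^T *m w)); split.
- by rewrite linearB/= trmx1 linearZ/= trmx_mul trmxK.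
- rewrite mulmxBl mul1mx mulmxBr mulmx1 -scalemxAl -scalemxAr scalerA.
  rewrite mulmxA -[w^T *m w *m w^T]mulmxA ww mul_mx_scalar -scalemxAl scalerA.
  have -> : 2 / N * (2 / N) * N = 2 / N + 2 / N by field.
  by rewrite scalerDl opprB addrK subrK.
- rewrite mulmxBr mulmx1 -scalemxAr mulmxA -/e.
  have ew : e *m w^T = (N / 2)%:M.
    rewrite [LHS]mx11_scalar -/(dot e w); congr (_%:M).
    rewrite /N wE dotBl !dotBr (dotC v e) v1 e1.
    by field.
  rewrite ew mul_scalar_mx scalerA.
  have -> : 2 / N * (N / 2) = 1 by field.
  by rewrite scale1r wE opprB addrC subrK.
Qed.

(** A Householder reflection moves a unit eigenvector to the first basis vector; symmetry then
    splits off a block of size 1. *)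
Lemma real_spectral n (S : 'M[R]_n) : S^T = S ->
  exists (P : 'M[R]_n) (d : 'rV[R]_n), P *m P^T = 1%:M /\ P *m S *m P^T = diag_mx d.
Proof.
elim: n S => [|n IH] S Ss.
  by exists 1%:M, 0; split; apply/matrixP => -[].
have [a /eigenvalueP[v0 v0S v00]] := real_sym_eigenvalue Ss.
pose N := Num.sqrt (dot v0 v0).
have N20 : 0 < dot v0 v0 by rewrite -sqnorm_dot lt_neqAle sqnorm_ge0 eq_sym sqnorm_eq0 v00.
have N0 : N != 0 by rewrite gt_eqF// sqrtr_gt0.
pose v := N^-1 *: v0.
have v1 : dot v v = 1.
  rewrite /v dotZl dotC dotZl -[X in _ * (_ * X)]sqr_sqrtr ?ltW// -/N; field; exact: N0.
have vS : v *m S = a *: v by rewrite /v -scalemxAl v0S scalerA mulrC -scalerA.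
have [Q [Qs QQ Qv]] := householder v1.
have [T TE0] : exists T : 'M[R]_(1 + n), T = Q *m S *m Q by exists (Q *m S *m Q).
have Ts : T^T = T by rewrite TE0 !trmx_mul Qs Ss mulmxA.
have eT : (delta_mx 0 0 : 'rV[R]_(1 + n)) *m T = a *: (delta_mx 0 0 : 'rV[R]_(1 + n)).
  rewrite TE0 !mulmxA Qv vS -scalemxAl; congr (_ *: _).
  by rewrite -Qv -mulmxA QQ mulmx1.
have row0 j : T 0 j = a * (0 == j)%:R.
  by move/matrixP/(_ 0 j): eT; rewrite -rowE !mxE eqxx/= => ->; rewrite eq_sym.
have TE : T = block_mx a%:M 0 0 (drsubmx T).
  have ur : ursubmx T = 0.
    apply/matrixP => i j; rewrite !mxE [lshift n i](_ : _ = 0) ?row0 ?mulr0//.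
    by apply/ord_inj; rewrite /= ord1.
  rewrite -{1}(submxK T) ur -[dlsubmx T]trmxK trmx_dlsub Ts ur trmx0; congr block_mx.
  apply/matrixP => i j; rewrite !ord1 !mxE/= mulr1n [lshift n 0](_ : _ = 0) ?row0 ?mulr1//.
  exact/ord_inj.
have [P' [d' [PP' Pd]]] := IH (drsubmx T) ltac:(by rewrite trmx_drsub Ts).
pose P1 : 'M[R]_(1 + n) := block_mx 1%:M 0 0 P'.
have PP1 : P1 *m P1^T = 1%:M.
  rewrite /P1 tr_block_mx mulmx_block.
  by rewrite !trmx0 trmx1 !(mulmx0, mul0mx, addr0, add0r, mulmx1) PP' -scalar_mx_block.
have PT1 : P1 *m T *m P1^T = diag_mx (row_mx a%:M d').
  rewrite TE /P1 tr_block_mx !mulmx_block !trmx0 trmx1 !(mulmx0, mul0mx, addr0, add0r, mulmx1, mul1mx) Pd.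
  rewrite diag_mx_row; congr block_mx.
  by apply/matrixP => i j; rewrite !ord1 !mxE.
exists (P1 *m Q), (row_mx a%:M d'); split.
  by rewrite trmx_mul Qs mulmxA -[_ *m Q *m Q]mulmxA QQ mulmx1.
by rewrite -PT1 TE0 trmx_mul Qs !mulmxA.
Qed.

End RealSpectral.

(** * Diagonal deformations of a lattice basis *)

Section Frame.
Variable R : realType.

Definition exp_diag n (h : 'rV[R]_n) : 'M[R]_n := diag_mx (\row_i expR (h 0 i)).

Lemma exp_diagM n (h k : 'rV[R]_n) : exp_diag h *m exp_diag k = exp_diag (h + k).
Proof.
rewrite /exp_diag mulmx_diag; congr diag_mx.
by apply/rowP => i; rewrite !mxE expRD.
Qed.

Lemma exp_diag0 n : exp_diag (0 : 'rV[R]_n) = 1%:M.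
Proof. by rewrite -diag_const_mx; congr diag_mx; apply/rowP => i; rewrite !mxE expR0. Qed.

Lemma exp_diag_tr n (h : 'rV[R]_n) : (exp_diag h)^T = exp_diag h.
Proof. exact: tr_diag_mx. Qed.

Lemma gram_sqnorm n (B C : 'M[R]_n) z : B *m B^T = C *m C^T -> sqnorm (lvec B z) = sqnorm (lvec C z).
Proof.
move=> h; rewrite !sqnorm_dot /dot !lvecE !trmx_mul !mulmxA.
by rewrite -[ir R z *m B *m B^T]mulmxA h mulmxA.
Qed.

Lemma gram_dual n (B C : 'M[R]_n) : B \in unitmx -> C \in unitmx ->
  B *m B^T = C *m C^T -> dual B *m (dual B)^T = dual C *m (dual C)^T.
Proof.
move=> uB uC h; have uBT : B^T \in unitmx by rewrite unitmx_tr.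
have uCT : C^T \in unitmx by rewrite unitmx_tr.
have e (D : 'M[R]_n) : D \in unitmx -> dual D *m (dual D)^T = invmx (D *m D^T).
  move=> uD; have uDT : D^T \in unitmx by rewrite unitmx_tr.
  have k : D *m D^T *m (dual D *m (dual D)^T) = 1%:M.
    rewrite /dual trmxK !mulmxA -[D *m D^T *m _]mulmxA -trmx_mul mulVmx// trmx1 mulmx1.
    by rewrite mulmxV.
  have uDD : D *m D^T \in unitmx by rewrite unitmx_mul uD.
  by rewrite -[RHS]mulmx1 -k mulKmx.
by rewrite !e// h.
Qed.

Lemma invmx_mul n (A B : 'M[R]_n) : A \in unitmx -> B \in unitmx ->
  invmx (A *m B) = invmx B *m invmx A.
Proof.
move=> uA uB; have k : A *m B *m (invmx B *m invmx A) = 1%:M.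
  by rewrite mulmxA -[A *m B *m _]mulmxA mulmxV// mulmx1 mulmxV.
by rewrite -[LHS]mulmx1 -k mulKmx// unitmx_mul uA.
Qed.

Lemma orth_dual n (B P : 'M[R]_n) : B \in unitmx -> P *m P^T = 1%:M -> dual (B *m P) = dual B *m P.
Proof.
move=> uB PP; have PTP : P^T *m P = 1%:M by exact: mulmx1C.
have uP : P \in unitmx by have := mulmx1_unit PP; case.
have iP : invmx P = P^T by rewrite -[LHS]mulmx1 -PP mulKmx.
by rewrite /dual invmx_mul// trmx_mul iP trmxK.
Qed.

Lemma diag_dual n (B : 'M[R]_n) (h : 'rV[R]_n) : B \in unitmx ->
  dual (B *m exp_diag h) = dual B *m exp_diag (- h).
Proof.
move=> uB; have e : exp_diag h *m exp_diag (- h) = 1%:M by rewrite exp_diagM subrr exp_diag0.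
have uE : exp_diag h \in unitmx by have := mulmx1_unit e; case.
have iE : invmx (exp_diag h) = exp_diag (- h) by rewrite -[LHS]mulmx1 -e mulKmx.
have uBE : B *m exp_diag h \in unitmx by rewrite unitmx_mul uB.
by rewrite /dual invmx_mul// iE trmx_mul exp_diag_tr.
Qed.

Lemma lvec_diag n (B : 'M[R]_n) (h : 'rV[R]_n) z :
  sqnorm (lvec (B *m exp_diag h) z) = \sum_i expR (2 * h 0 i) * (lvec B z 0 i) ^+ 2.
Proof.
rewrite /sqnorm; apply: eq_bigr => i _.
rewrite !lvecE mulmxA -lvecE mul_mx_diag mxE [X in _ * X]mxE exprMn mulrC.
by rewrite -expRM_natl.
Qed.

Lemma det_exp_diag n (h : 'rV[R]_n) : \det (exp_diag h) = expR (\sum_i h 0 i).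
Proof. by rewrite det_diag expR_sum; apply: eq_bigr => i _; rewrite mxE. Qed.

Lemma orth_entry_le1 n (P : 'M[R]_n) i j : P *m P^T = 1%:M -> `|P i j| <= 1.
Proof.
move=> PP; rewrite -(@ler_pXn2r _ 2)// ?nnegrE// expr1n real_normK ?num_real//.
have : (P *m P^T) i i = 1 by rewrite PP mxE eqxx.
rewrite mxE (bigD1 j)//= mxE -expr2 => <-; rewrite lerDl sumr_ge0// => k _.
by rewrite mxE -expr2 sqr_ge0.
Qed.

Lemma isometric_gram n (B C : 'M[R]_n) : B \in unitmx -> C \in unitmx -> B *m B^T = C *m C^T -> isometric B C.
Proof.
move=> uB uC h; exists (invmx B *m C); split; last by rewrite mulKVmx.
have e : (invmx B *m C) *m (invmx B *m C)^T = 1%:M.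
  rewrite trmx_mul mulmxA -[invmx B *m C *m C^T]mulmxA -h mulmxA mulVmx// mul1mx.
  by rewrite -trmx_mul mulVmx// trmx1.
exact: mulmx1C.
Qed.

Lemma covol1_unit n (B : 'M[R]_n) : covol B = 1 -> B \in unitmx.
Proof. by move=> h; rewrite unitmxE unitfE -normr_eq0 -/(covol B) h oner_eq0. Qed.

Lemma ln_le_sub1 (x : R) : 0 < x -> ln x <= x - 1.
Proof. by move=> x0; rewrite -{1}(subrK 1 x) addrC; apply: le_ln1Dx; lra. Qed.

Lemma ln_norm_le (x : R) : 1 / 2 <= x -> `|ln x| <= `|x - 1| * 2.
Proof.
move=> x12; have x0 : 0 < x by lra.
have l1 := ln_le_sub1 x0.
have l2 : - ln x <= x^-1 - 1 by rewrite -lnV ?posrE// ln_le_sub1// invr_gt0.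
have l3 : x^-1 - 1 <= `|x - 1| * 2.
  have -> : x^-1 - 1 = (1 - x) / x by field; rewrite gt_eqF.
  rewrite ler_pdivrMr//; apply: (@le_trans _ _ `|x - 1|); first by rewrite distrC ler_norm.
  by rewrite -mulrA ler_peMr//; lra.
have l4 : x - 1 <= `|x - 1| by exact: ler_norm.
have l5 : 0 <= `|x - 1| by [].
by rewrite ler_norml; apply/andP; split; lra.
Qed.

(** The estimate behind the choice of [e] in [frame_near]: [N (K e)] bounds the entries of [M - 1],
    and each further matrix product costs a factor [N]. *)
Lemma frame_small_arith (N K e dl : R) : 1 <= N -> 0 < N -> 1 <= K -> 0 < e ->
  e * (4 * N ^+ 4 * K ^+ 2) = dl -> dl <= 1 / 2 ->
  N * (N * (2 * (N * (K * e)) + N * (N * (K * e)) ^+ 2)) < dl.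
Proof.
move=> N1 N0 K1 e0 <-; have K0 : 0 < K by exact: lt_le_trans ltr01 K1.
have N31 : 1 <= N ^+ 3 by rewrite exprn_ege1.
have k0 : 0 < K * e by rewrite mulr_gt0.
have p0 : 0 < N ^+ 4 * (K * e) by rewrite mulr_gt0// exprn_gt0.
rewrite (_ : e * _ = 4 * (N ^+ 4 * (K * e) * K)); last by ring.
move: (K * e) k0 p0 => k k0 p0 dl1.
have q1 : N ^+ 4 * k <= N ^+ 4 * k * K by apply: ler_peMr => //; exact: ltW.
have q2 : N ^+ 3 * k <= N ^+ 4 * k.
  by rewrite ler_pM2r// [N ^+ 4]exprS ler_peMl// ltW// exprn_gt0.
have q4 : N * k <= N ^+ 3 * k.
  by rewrite ler_pM2r// [N ^+ 3]exprS ler_peMr ?(ltW N0)// exprn_ege1.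
have q3 : N ^+ 4 * k * (N * k) <= N ^+ 4 * k by rewrite ler_piMr ?(ltW p0)//; lra.
have -> : N * (N * (2 * (N * k) + N * (N * k) ^+ 2)) = 2 * (N ^+ 3 * k) + N ^+ 4 * k * (N * k) by ring.
lra.
Qed.

(** For [M = B0^-1 B] near the identity, [G = M M^T] is symmetric and near the identity; [P]
    diagonalizes it and [h] consists of half the logarithms of its eigenvalues. *)
Lemma frame_near n (B0 : 'M[R]_n) (delta : R) : covol B0 = 1 -> 0 < delta ->
  exists2 e : R, 0 < e & forall B : 'M[R]_n, covol B = 1 -> (forall i j, `|B i j - B0 i j| < e) ->
    exists (P : 'M[R]_n) (h : 'rV[R]_n), [/\ P *m P^T = 1%:M, \sum_i h 0 i = 0,
      forall i, `|h 0 i| < delta &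
      B *m B^T = (B0 *m P^T *m exp_diag h) *m (B0 *m P^T *m exp_diag h)^T].
Proof.
move=> c0 d0; have u0 := covol1_unit c0.
pose K : R := 1 + \sum_i \sum_j `|invmx B0 i j|.
have K1 : 1 <= K by rewrite lerDl sumr_ge0// => i _; rewrite sumr_ge0.
have KP i j : `|invmx B0 i j| <= K.
  rewrite /K (bigD1 i)//= (bigD1 j)//= addrCA -addrA lerDl; rewrite addrA.
  by rewrite !addr_ge0// sumr_ge0// => k _; rewrite ?sumr_ge0.
have K0 : 0 < K := lt_le_trans ltr01 K1.
clearbody K.
pose dl := Num.min delta (1 / 2).
have dl0 : 0 < dl by rewrite lt_min d0 divr_gt0.
pose N : R := n%:R + 1.
have N0 : 0 < N by rewrite /N ltr_wpDl.
have N1 : 1 <= N by rewrite /N lerDr.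
have nN : n%:R <= N by rewrite /N lerDl.
pose e : R := dl / (4 * N ^+ 4 * K ^+ 2).
have den0 : 0 < 4 * N ^+ 4 * K ^+ 2 by rewrite !mulr_gt0 ?exprn_gt0//; lra.
have e0 : 0 < e by rewrite divr_gt0.
exists e => // B cB near.
have uB := covol1_unit cB.
pose M := invmx B0 *m B; pose G := M *m M^T; pose E := M - 1%:M.
have [P [d [PP Pd]]] := @real_spectral R n G ltac:(by rewrite /G trmx_mul trmxK).
have PTP : P^T *m P = 1%:M by exact: mulmx1C.
have uM : M \in unitmx by rewrite unitmx_mul unitmx_inv u0.
have sum_le m (f : 'I_m -> R) (c : R) : (forall i, `|f i| <= c) -> `|\sum_i f i| <= m%:R * c.
  move=> fc; apply: (le_trans (ler_norm_sum _ _ _)).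
  apply: (le_trans (ler_sum _ (fun i _ => fc i))).
  by rewrite sumr_const card_ord mulr_natl.
have EB : E = invmx B0 *m (B - B0) by rewrite mulmxBr mulVmx.
have En i j : `|E i j| <= N * (K * e).
  rewrite EB mxE; apply: (le_trans (sum_le _ _ (K * e) _)).
    by move=> k; rewrite normrM ler_pM// !mxE ltW.
  by rewrite ler_wpM2r// (ltW (mulr_gt0 K0 e0)).
have GE : G - 1%:M = E + E^T + E *m E^T.
  have key (X : 'M[R]_n) : (1%:M + X) *m (1%:M + X)^T - 1%:M = X + X^T + X *m X^T.
    rewrite linearD/= trmx1 mulmxDl !mulmxDr !mul1mx mulmx1.
    by move: (X *m X^T) => A; apply/matrixP => i j; rewrite !mxE; ring.
  by rewrite -key /G /E [1%:M + _]addrC subrK.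
have x0 : 0 <= N * (K * e) by exact: ltW (mulr_gt0 N0 (mulr_gt0 K0 e0)).
have GEn i j : `|(G - 1%:M) i j| <= 2 * (N * (K * e)) + N * (N * (K * e)) ^+ 2.
  rewrite GE mxE; apply: (le_trans (ler_normD _ _)); apply: lerD.
    rewrite mxE; apply: (le_trans (ler_normD _ _)); rewrite mulr_natl mulr2n lerD//.
    by rewrite mxE.
  rewrite mxE; apply: (le_trans (sum_le _ _ ((N * (K * e)) ^+ 2) _)).
    by move=> k; rewrite normrM expr2 ler_pM// mxE.
  by rewrite ler_wpM2r// sqr_ge0.
set y := 2 * _ + _ in GEn.
have y0 : 0 <= y by exact: addr_ge0 (mulr_ge0 (ler0n _ 2) x0) (mulr_ge0 (ltW N0) (sqr_ge0 _)).
have dn i : `|d 0 i - 1| <= N * (N * y).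
  have -> : d 0 i - 1 = (P *m (G - 1%:M) *m P^T) i i.
    by rewrite mulmxBr mulmx1 mulmxBl Pd PP !mxE eqxx mulr1n.
  rewrite mxE; apply: (le_trans (sum_le _ _ (N * y) _)); last first.
    by rewrite (ler_wpM2r (mulr_ge0 (ltW N0) y0)).
  move=> k; rewrite normrM -[leRHS]mulr1 ler_pM//; last by rewrite mxE orth_entry_le1.
  rewrite mxE; apply: (le_trans (sum_le _ _ y _)); last by rewrite ler_wpM2r.
  by move=> l; rewrite normrM -[leRHS]mul1r ler_pM// orth_entry_le1.
have small : N * (N * y) < dl.
  have eK : e * (4 * N ^+ 4 * K ^+ 2) = dl by rewrite /e divfK// gt_eqF.
  have dl1 : dl <= 1 / 2 by rewrite ge_min lexx orbT.
  exact: frame_small_arith N1 (lt_le_trans ltr01 N1) K1 e0 eK dl1.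
have dl12 : dl <= 1 / 2 by rewrite ge_min lexx orbT.
have dld : dl <= delta by rewrite ge_min lexx.
have dn2 i : `|d 0 i - 1| < dl by exact: le_lt_trans (dn i) small.
have dp i : 0 < d 0 i by have := dn2 i; rewrite ltr_norml => /andP[]; lra.
pose h : 'rV[R]_n := \row_i (ln (d 0 i) / 2).
have hE i : expR (2 * h 0 i) = d 0 i.
  by rewrite mxE mulrC divfK// lnK// posrE.
exists P, h; split => //.
(* Both covolumes are 1, so [det G = 1] and the eigenvalues [exp (2 h_i)] have product 1. *)
- have : expR (2 * \sum_i h 0 i) = expR 0.
    rewrite mulr_sumr expR_sum expR0 (eq_bigr (fun i => d 0 i)) => [|i _]; last exact: hE.
    have -> : \prod_i d 0 i = \det (diag_mx d) by rewrite det_diag.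
    have dPP : \det P * \det P^T = 1 by rewrite -det_mulmx PP det1.
    rewrite -Pd det_mulmx [\det (P *m G)]det_mulmx mulrAC dPP mul1r det_mulmx det_tr -expr2.
    rewrite det_mulmx det_inv exprMn exprVn -[\det B ^+ 2]real_normK ?num_real//.
    by rewrite -[\det B0 ^+ 2]real_normK ?num_real// -/(covol B) -/(covol B0) cB c0 expr1n invr1 mulr1.
  by move/expR_inj/eqP; rewrite mulf_eq0 pnatr_eq0/= => /eqP.
- move=> i; apply: lt_le_trans dld; apply: le_lt_trans (dn2 i).
  rewrite mxE normrM normfV [`|2|]ger0_norm// ler_pdivrMr//.
  apply: ln_norm_le; have := dn2 i; rewrite ltr_norml => /andP[]; lra.
- have DD : exp_diag h *m (exp_diag h)^T = diag_mx d.
    rewrite exp_diag_tr exp_diagM /exp_diag; congr diag_mx; apply/rowP => i.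
    by rewrite [LHS]mxE -hE; congr expR; rewrite !mxE; ring.
  have -> : B0 *m P^T *m exp_diag h *m (B0 *m P^T *m exp_diag h)^T =
      B0 *m P^T *m (exp_diag h *m (exp_diag h)^T) *m P *m B0^T.
    by rewrite !trmx_mul trmxK !mulmxA.
  rewrite DD -Pd !mulmxA -[B0 *m P^T *m P]mulmxA PTP mulmx1.
  rewrite -[_ *m P^T *m P]mulmxA PTP mulmx1 /G /M.
  by rewrite mulmxV// mul1mx -mulmxA -trmx_mul mulKVmx.
Qed.

Lemma frame0_isometric n (B0 B P : 'M[R]_n) : covol B0 = 1 -> covol B = 1 -> P *m P^T = 1%:M ->
  B *m B^T = (B0 *m P^T *m exp_diag 0) *m (B0 *m P^T *m exp_diag 0)^T -> isometric B B0.
Proof.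
move=> c0 cB PP h; apply: isometric_gram; try exact: covol1_unit.
have PTP : P^T *m P = 1%:M by exact: mulmx1C.
by rewrite h exp_diag0 mulmx1 trmx_mul trmxK mulmxA -[B0 *m P^T *m P]mulmxA PTP mulmx1.
Qed.

End Frame.

(** * Moments of spherical designs *)

Section IteratedIntegrals.
Variable R : realType.
Implicit Types (g : (nat -> R) -> \bar R) (x : nat -> R) (s : seq nat).
Local Notation mu := (@lebesgue_measure R).

Lemma integral_translation (f : measurableTypeR R -> \bar R) (c : R) :
  measurable_fun setT f -> (forall t, 0 <= f t)%E ->
  (\int[mu]_t f ((t : R) + c)%R = \int[mu]_t f t)%E.
Proof.
move=> mf f0; pose phi (t : measurableTypeR R) : measurableTypeR R := t + c.
have mphi : measurable_fun setT phi by exact: measurable_funD.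
pose mp : {mfun measurableTypeR R >-> measurableTypeR R} :=
  HB.pack phi (isMeasurableFun.Build _ _ _ _ _ mphi).
have E : forall A, measurable A -> mu A = pushforward mu mp A.
  apply: lebesgue_measure_unique => X [[a b]] _ <-.
  rewrite /= /pushforward/=.
  have -> : phi @^-1` `]a, b]%classic = `](a - c), (b - c)]%classic.
    by apply/seteqP; split => y /=; rewrite !in_itv/= /phi; lra.
  rewrite !lebesgue_measure_itv/= !lte_fin ltrD2r; case: ifP => // _.
  by rewrite -!EFinD; congr EFin; ring.
rewrite [RHS](eq_measure_integral (pushforward mu mp)); last by move=> A mA _; exact: E.
by rewrite (ge0_integral_pushforward mphi)//.
Qed.

(** Joint measurability expressed through all measurable families of arguments, so that no
    sigma-algebra on [nat -> R] has to be chosen. *)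
Definition ymeas g := forall d (T : measurableType d) (phi : T -> nat -> R),
  (forall i, measurable_fun setT (fun t => phi t i : measurableTypeR R)) ->
  measurable_fun setT (fun t => g (phi t)).

Definition upd x (i : nat) (t : R) : nat -> R := fun j => if j == i then t else x j.

Lemma upd_swap x (i j : nat) a b : i != j -> upd (upd x i a) j b = upd (upd x j b) i a.
Proof.
move=> ij; apply/funext => k; rewrite /upd; case: eqVneq => [->|//].
by rewrite eq_sym (negbTE ij).
Qed.

Definition int1 (i : nat) g x : \bar R := (\int[mu]_t g (upd x i t))%E.

Lemma ymeas_upd g i x : ymeas g ->
  measurable_fun setT (fun t : measurableTypeR R => g (upd x i t)).
Proof.
move=> mg; apply: (mg _ _ (fun t => upd x i t)) => j; rewrite /upd.
by case: (j == i); [exact: measurable_id|exact: measurable_cst].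
Qed.

Lemma ymeas_int1 g i : ymeas g -> (forall x, 0 <= g x)%E -> ymeas (int1 i g).
Proof.
move=> mg g0 d T phi mphi; rewrite /int1.
apply: (@measurable_fun_fubini_tonelli_F _ _ T (measurableTypeR R) R mu
   (fun p => g (upd (phi p.1) i p.2))) => //.
apply: (mg _ _ (fun p : T * measurableTypeR R => upd (phi p.1) i p.2)) => j; rewrite /upd.
case: (j == i); first exact: measurable_snd.
exact: (measurableT_comp (mphi j) measurable_fst).
Qed.

Lemma int1_ge0 g i : (forall x, 0 <= g x)%E -> forall x, (0 <= int1 i g x)%E.
Proof. by move=> g0 x; exact: integral_ge0. Qed.

Lemma int1_swap g (i j : nat) : i != j -> ymeas g -> (forall x, 0 <= g x)%E ->
  int1 i (int1 j g) = int1 j (int1 i g).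
Proof.
move=> ij mg g0; apply/funext => x; rewrite /int1.
have mF : measurable_fun setT (fun p : measurableTypeR R * measurableTypeR R =>
    g (upd (upd x i p.1) j p.2)); last first.
  rewrite [LHS](fubini_tonelli _ mF (fun=> g0 _)).
  by apply: eq_integral => a _; apply: eq_integral => b _; rewrite upd_swap.
apply: (mg _ _ (fun p : measurableTypeR R * measurableTypeR R => upd (upd x i p.1) j p.2)) => k.
rewrite /upd; case: (k == j); first exact: measurable_snd.
by case: (k == i); [exact: measurable_fst|exact: measurable_cst].
Qed.

Definition eint s g := foldr int1 g s.

Lemma ymeas_eint s g : ymeas g -> (forall x, 0 <= g x)%E -> ymeas (eint s g).
Proof.
move=> mg g0; have : ymeas (eint s g) /\ forall x, (0 <= eint s g x)%E; last by case.
by elim: s => //= i s [IH1 IH2]; split; [exact: ymeas_int1|exact: int1_ge0].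
Qed.

Lemma eint_ge0 s g : (forall x, 0 <= g x)%E -> forall x, (0 <= eint s g x)%E.
Proof. by move=> g0; elim: s => //= i s; exact: int1_ge0. Qed.

(** By Tonelli any variable can be moved to the innermost place, where a shear in its direction acts
    as a translation. *)
Lemma eint_innermost s i g : i \notin s -> ymeas g -> (forall x, 0 <= g x)%E ->
  eint (i :: s) g = eint (rcons s i) g.
Proof.
move=> + mg g0; elim: s => //= j s IH; rewrite inE negb_or => /andP[ij /IH <-].
by rewrite int1_swap//; [exact: ymeas_eint|exact: eint_ge0].
Qed.

Definition shear (i j : nat) (c : R) x : nat -> R := upd x i (x i + c * x j).

Lemma ymeas_shear g (i j : nat) c : ymeas g -> ymeas (g \o shear i j c).
Proof.
move=> mg d T phi mphi; apply: (mg _ _ (fun t => shear i j c (phi t))) => k.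
rewrite /shear /upd; case: (k == i) => //.
exact: measurable_funD (mphi i) (measurable_funM (measurable_cst c) (mphi j)).
Qed.

Lemma int1_shear g (i j : nat) c : i != j -> ymeas g -> (forall x, 0 <= g x)%E ->
  int1 i (g \o shear i j c) = int1 i g.
Proof.
move=> ij mg g0; apply/funext => x; rewrite /int1.
rewrite -[RHS](integral_translation (c * x j))//; last exact: ymeas_upd.
apply: eq_integral => t _ /=; congr g; apply/funext => k; rewrite /shear /upd eqxx.
by rewrite (eq_sym j) (negbTE ij); case: (k == i).
Qed.

Lemma eint_cat s1 s2 g : eint (s1 ++ s2) g = eint s1 (eint s2 g).
Proof. by rewrite /eint foldr_cat. Qed.

Lemma eint_shear s g (i j : nat) c : uniq s -> i \in s -> i != j -> ymeas g -> (forall x, 0 <= g x)%E ->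
  eint s (g \o shear i j c) = eint s g.
Proof.
move=> us /splitPr si ij mg g0; case: si us => s1 s2; rewrite cat_uniq => /and3P[_ _ /andP[is2 _]].
rewrite !eint_cat (eint_innermost is2 mg g0).
rewrite (eint_innermost is2 (ymeas_shear i j c mg) (fun x => g0 _)).
by rewrite -cats1 !eint_cat /= int1_shear.
Qed.

Definition givens (i j : nat) (c s : R) x : nat -> R :=
  upd (upd x i (c * x i - s * x j)) j (s * x i + c * x j).

(** A plane rotation of angle [theta] is a product of three shears, the outer ones with coefficient
    [- tan (theta / 2) = - s / (1 + c)]. The half turn is excluded, and the invariance of the
    integral under shears carries over to rotations. *)
Lemma givens_shears (i j : nat) (c s : R) x : i != j -> c ^+ 2 + s ^+ 2 = 1 -> 1 + c != 0 ->
  givens i j c s x = shear i j (- (s / (1 + c))) (shear j i s (shear i j (- (s / (1 + c))) x)).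
Proof.
move=> ij cs c1; apply/funext => k; rewrite /givens /shear /upd.
rewrite !eqxx (eq_sym j) (negbTE ij).
have e1 : s ^+ 2 = 1 - c ^+ 2 by rewrite -cs; ring.
have e2 : s * (s / (1 + c)) = 1 - c.
  by rewrite mulrA -expr2 e1; field.
case: (eqVneq k j) => [->|kj].
  rewrite (eq_sym j) (negbTE ij).
  have -> : x j + s * (x i + - (s / (1 + c)) * x j) = s * x i + (1 - s * (s / (1 + c))) * x j by ring.
  by rewrite e2; ring.
case: (k == i) => //.
have -> : x i + - (s / (1 + c)) * x j + - (s / (1 + c)) * (x j + s * (x i + - (s / (1 + c)) * x j)) =
  (1 - s * (s / (1 + c))) * x i - (s / (1 + c) * (2 - s * (s / (1 + c)))) * x j by ring.
rewrite e2; have -> : s / (1 + c) * (2 - (1 - c)) = s by field.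
by ring.
Qed.

Lemma eint_givens s g (i j : nat) c d : uniq s -> i \in s -> j \in s -> i != j ->
  c ^+ 2 + d ^+ 2 = 1 -> 1 + c != 0 -> ymeas g -> (forall x, 0 <= g x)%E ->
  eint s (g \o givens i j c d) = eint s g.
Proof.
move=> us si sj ij cd c1 mg g0.
have -> : g \o givens i j c d = g \o shear i j (- (d / (1 + c))) \o shear j i d \o shear i j (- (d / (1 + c))).
  by apply/funext => x /=; rewrite givens_shears.
have ji : j != i by rewrite eq_sym.
rewrite (eint_shear _ us si ij (ymeas_shear _ _ _ (ymeas_shear _ _ _ mg)) (fun x => g0 _)).
by rewrite (eint_shear _ us sj ji (ymeas_shear _ _ _ mg) (fun x => g0 _)) eint_shear.
Qed.

(** Support in a cube and a bound [M] make each inner integral at most [2 M], so the real iterated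
    integral, built with [fine] at each stage, agrees with the extended one. *)
Lemma iint_eint k (g : (nat -> R) -> R) (M : R) : ymeas (EFin \o g) ->
  (forall x, 0 <= g x <= M) -> (forall x i, (i < k)%N -> 1 < `|x i| -> g x = 0) ->
  (iint k g)%:E = eint (iota 0 k) (EFin \o g) (fun=> 0).
Proof.
elim: k g M => [//|k IH] g M mg gM gs.
pose h x := Rintegral mu setT (fun t => g (upd x k t)).
have g0 x : 0 <= g x by case/andP: (gM x).
have bnd x : (int1 k (EFin \o g) x <= (2 * M)%:E)%E.
  rewrite /int1 (@le_trans _ _ (\int[mu]_(t in `[(-1)%R, 1%R]%classic) M%:E)%E)//.
    rewrite [leRHS]integral_mkcond; apply: ge0_le_integral => //.
    - by move=> t _ /=; rewrite lee_fin.
    - exact: (ymeas_upd k x mg).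
    - by apply/(measurable_restrictT _ _).1 => //.
    - move=> t _ /=; rewrite patchE; case: ifPn => [_|]; first by rewrite lee_fin; case/andP: (gM (upd x k t)).
      rewrite notin_setE/= in_itv/= => /negP t1; rewrite (gs _ k)//.
      rewrite /upd eqxx; rewrite -ler_norml -ltNge in t1; exact: t1.
  rewrite integral_cst//= lebesgue_measure_itv/= lte_fin.
  rewrite ifT; last by lra.
  by rewrite -EFinD -EFinM lee_fin; lra.
have hE : EFin \o h = int1 k (EFin \o g).
  apply/funext => x; rewrite /h /Rintegral /=; apply: fineK.
  rewrite ge0_fin_numE; last exact: (int1_ge0 k (g := EFin \o g)).
  exact: le_lt_trans (bnd x) (ltry _).
have -> : iint k.+1 g = iint k h by [].
rewrite (IH h (2 * M)).
- by rewrite hE -[k.+1]addn1 iotaD eint_cat.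
- by rewrite hE; apply: ymeas_int1 => // x; rewrite /= lee_fin.
- move=> x; rewrite -!lee_fin -/((EFin \o h) x) hE bnd andbT.
  by apply: int1_ge0 => y; rewrite /= lee_fin.
- move=> x i ik xi; rewrite /h /Rintegral integral0_eq// => t _.
  by rewrite (gs _ i)// 1?ltnS 1?ltnW// /upd ltn_eqF.
Qed.

End IteratedIntegrals.

(** * Rotation invariance of the moments of linear forms *)

Section SphericalMoments.
Variables (R : realType) (n : nat).
Implicit Types (a x : nat -> R).
Local Notation mu := (@lebesgue_measure R).

Definition ndot a x : R := \sum_(i < n) a i * x i.

(** The integrand of [sphere_avg] for the power [2 p] of the linear form [a]. The inverse is written
    as a real power for the sake of measurability. *)
Definition moment a p x : R :=
  (if ndot x x <= 1 then 1 else 0) * (ndot a x ^+ 2 * (ndot x x) `^ (-1)) ^+ p.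

Lemma ndot_ge0 x : 0 <= ndot x x.
Proof. by apply: sumr_ge0 => i _; rewrite -expr2 sqr_ge0. Qed.

Lemma ndot_givens a (i j : nat) c d x : (i < n)%N -> (j < n)%N -> i != j ->
  ndot a (givens i j c d x) = ndot (givens i j c (- d) a) x.
Proof.
move=> ni nj ij; rewrite /ndot.
have ijo : (Ordinal nj) != (Ordinal ni) by rewrite -val_eqE/= eq_sym.
rewrite (bigD1 (Ordinal ni))//= (bigD1 (Ordinal nj))//=.
rewrite [RHS](bigD1 (Ordinal ni))//= [X in _ = _ + X](bigD1 (Ordinal nj))//=.
rewrite [X in _ + (_ + X)](eq_bigr (fun k : 'I_n => a k * x k)); last first.
  move=> k /andP[ki kj]; rewrite /givens /upd.
  by rewrite -[nat_of_ord k == j]/(k == Ordinal nj) (negbTE kj) -[nat_of_ord k == i]/(k == Ordinal ni) (negbTE ki).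
rewrite [X in _ = _ + (_ + X)](eq_bigr (fun k : 'I_n => a k * x k)); last first.
  move=> k /andP[ki kj]; rewrite /givens /upd.
  by rewrite -[nat_of_ord k == j]/(k == Ordinal nj) (negbTE kj) -[nat_of_ord k == i]/(k == Ordinal ni) (negbTE ki).
by rewrite /givens /upd !eqxx (negbTE ij); ring.
Qed.

Lemma givensK (i j : nat) (c d : R) x : i != j -> c ^+ 2 + d ^+ 2 = 1 ->
  givens i j c (- d) (givens i j c d x) = x.
Proof.
move=> ij cd; apply/funext => k; rewrite /givens /upd !eqxx (negbTE ij).
case: eqVneq => [->|kj].
  by rewrite -[RHS]mul1r -cd; ring.
case: eqVneq => [->|//].
by rewrite -[RHS]mul1r -cd; ring.
Qed.

Lemma moment_givens a p (i j : nat) c d x : (i < n)%N -> (j < n)%N -> i != j -> c ^+ 2 + d ^+ 2 = 1 ->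
  moment a p (givens i j c d x) = moment (givens i j c (- d) a) p x.
Proof.
by move=> ni nj ij cd; rewrite /moment !ndot_givens// givensK.
Qed.

Lemma measurable_ndot d (T : measurableType d) (phi psi : T -> nat -> R) :
  (forall i, measurable_fun setT (fun t => phi t i : measurableTypeR R)) ->
  (forall i, measurable_fun setT (fun t => psi t i : measurableTypeR R)) ->
  measurable_fun setT (fun t => ndot (phi t) (psi t) : measurableTypeR R).
Proof.
by move=> mphi mpsi; apply: measurable_sum => i; exact: measurable_funM (mphi i) (mpsi i).
Qed.

Lemma ymeas_moment a p : ymeas (EFin \o moment a p).
Proof.
move=> d T phi mphi; apply/measurable_EFinP.
have mS := measurable_ndot mphi mphi.
have mD : measurable_fun setT (fun t => ndot a (phi t) : measurableTypeR R).
  by apply: measurable_ndot.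
apply: (measurable_funM (f := fun t => if ndot (phi t) (phi t) <= 1 then 1 else 0)
   (g := fun t => (ndot a (phi t) ^+ 2 * (ndot (phi t) (phi t)) `^ (-1)) ^+ p)).
  by apply: measurable_fun_ifT => //; exact: measurable_fun_ler.
apply: measurable_funX; apply: measurable_funM; first exact: measurable_funX.
exact: (measurableT_comp (measurable_powR (-1)) mS).
Qed.

Lemma ndot_bound a x : ndot a x ^+ 2 <= (\sum_(i < n) `|a i|) ^+ 2 * ndot x x.
Proof.
have S0 := ndot_ge0 x.
rewrite -[X in _ * X](sqr_sqrtr S0) -exprMn -[leLHS]real_normK ?num_real//.
rewrite ler_pXn2r ?nnegrE//; last by rewrite mulr_ge0// ?sqrtr_ge0// sumr_ge0.
rewrite mulr_suml; apply: (le_trans (ler_norm_sum _ _ _)); apply: ler_sum => i _.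
rewrite normrM ler_wpM2l// -sqrtr_sqr ler_wsqrtr// /ndot (bigD1 i)//= -expr2 lerDl.
by apply: sumr_ge0 => j _; rewrite -expr2 sqr_ge0.
Qed.

Lemma moment_base_ge0 a x : 0 <= ndot a x ^+ 2 * (ndot x x) `^ (-1).
Proof. exact: mulr_ge0 (sqr_ge0 _) (powR_ge0 _ _). Qed.

Lemma moment_ge0 a p x : 0 <= moment a p x.
Proof.
apply: mulr_ge0; last exact: exprn_ge0 (moment_base_ge0 _ _).
by case: ifP.
Qed.

Lemma moment_le a p x : moment a p x <= (\sum_(i < n) `|a i|) ^+ 2 ^+ p.
Proof.
rewrite /moment -[leRHS]mul1r; apply: ler_pM.
- by case: ifP.
- exact: exprn_ge0 (moment_base_ge0 _ _).
- by case: ifP.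
- apply: lerXn2r; rewrite ?nnegrE ?moment_base_ge0 ?sqr_ge0//.
  rewrite powR_inv1 ?ndot_ge0//.
  have [->|S0] := eqVneq (ndot x x) 0; first by rewrite invr0 mulr0 sqr_ge0.
  by rewrite ler_pdivrMr ?ndot_bound// lt_neqAle eq_sym S0 ndot_ge0.
Qed.

Lemma moment_supp a p x i : (i < n)%N -> 1 < `|x i| -> moment a p x = 0.
Proof.
move=> ni xi; rewrite /moment ifF ?mul0r//; apply/negbTE; rewrite -ltNge.
rewrite /ndot (bigD1 (Ordinal ni))//= -expr2 -[x i ^+ 2]real_normK ?num_real//.
apply: (@lt_le_trans _ _ (`|x i| ^+ 2)); first by rewrite expr_gt1.
by rewrite lerDl; apply: sumr_ge0 => j _; rewrite -expr2 sqr_ge0.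
Qed.

Lemma eintZ s (c : R) (g : (nat -> R) -> \bar R) : 0 <= c -> ymeas g -> (forall x, 0 <= g x)%E ->
  eint s (fun x => c%:E * g x)%E = (fun x => c%:E * eint s g x)%E.
Proof.
move=> c0 mg g0; elim: s => //= i s ->; apply/funext => x.
rewrite /int1 ge0_integralZl//=; last by move=> t _; exact: eint_ge0.
exact: ymeas_upd _ _ (ymeas_eint s mg g0).
Qed.

Lemma eint_moment_givens a p (i j : nat) c d : (i < n)%N -> (j < n)%N -> i != j ->
  c ^+ 2 + d ^+ 2 = 1 -> 1 + c != 0 ->
  eint (iota 0 n) (EFin \o moment (givens i j c (- d) a) p) = eint (iota 0 n) (EFin \o moment a p).
Proof.
move=> ni nj ij cd c1.
rewrite -(eint_givens (iota_uniq 0 n) _ _ ij cd c1 (ymeas_moment a p)) ?mem_iota//; last first.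
  by move=> x /=; rewrite lee_fin moment_ge0.
by congr eint; apply/funext => x /=; rewrite moment_givens.
Qed.

Lemma eq_moment a b p : (forall i, (i < n)%N -> a i = b i) -> moment a p = moment b p.
Proof.
move=> ab; apply/funext => x; rewrite /moment.
by have -> : ndot a x = ndot b x by apply: eq_bigr => i _; rewrite ab.
Qed.

Definition e0 : nat -> R := fun i => (i == 0%N)%:R.

Lemma eint_moment_e0 k a p : (k < n)%N -> (forall i, (k < i < n)%N -> a i = 0) ->
  exists2 b, b ^+ 2 = ndot a a &
    eint (iota 0 n) (EFin \o moment a p) = eint (iota 0 n) (EFin \o moment (fun i => b * e0 i) p).
Proof.
elim: k a => [|k IH] a kn ak.
  exists (a 0%N).
    rewrite /ndot (bigD1 (Ordinal kn))//= -expr2 big1 ?addr0// => i i0.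
    by rewrite ak ?mul0r// ltn_ord andbT lt0n; move: i0; rewrite -val_eqE.
  congr eint; congr comp; apply: eq_moment => i ni; rewrite /e0.
  by case: i ni => [|i] ni; rewrite ?mulr1// mulr0 ak.
have [ak0|ak0] := eqVneq (a k.+1) 0.
  apply: IH; first exact: ltnW.
  move=> i /andP[]; rewrite leq_eqVlt => /orP[/eqP <-//|ki ni].
  by rewrite ak ?ki.
pose N := a k ^+ 2 + a k.+1 ^+ 2.
have N0 : 0 < N by rewrite ltr_wpDl ?sqr_ge0// lt_neqAle eq_sym sqrf_eq0 ak0 sqr_ge0.
pose r := Num.sqrt N.
have r0 : r != 0 by rewrite gt_eqF// sqrtr_gt0.
have r2 : r ^+ 2 = N by rewrite sqr_sqrtr// ltW.
pose c := a k / r; pose d := a k.+1 / r.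
have cd : c ^+ 2 + d ^+ 2 = 1.
  by rewrite /c /d !expr_div_n -mulrDl r2 divff// gt_eqF.
(* The excluded half turn does not occur: [c = -1] would force [d = 0], whereas [a k.+1] is nonzero
   here. *)
have c1 : 1 + c != 0.
  apply/eqP => h; have cm : c = -1 by move: h; lra.
  have /eqP : d ^+ 2 = 0 by move: cd; rewrite cm sqrrN expr1n; lra.
  rewrite sqrf_eq0; apply/negP.
  by rewrite mulf_eq0 invr_eq0 (negbTE ak0) (negbTE r0).
have kk : (k != k.+1)%N by rewrite ltn_eqF.
have kn' : (k < n)%N by exact: ltnW.
have [|b bE IHb] := IH (givens k k.+1 c (- d) a) kn'.
  move=> i /andP[]; rewrite leq_eqVlt => /orP[/eqP <- _|ki ni].
    by rewrite /givens /upd eqxx /c /d; field.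
  by rewrite /givens /upd gtn_eqF// gtn_eqF// 1?ltnW// ak ?ki.
exists b; last by rewrite -IHb eint_moment_givens.
rewrite bE ndot_givens// opprK.
by have := @givensK k k.+1 c (- d) a kk; rewrite opprK sqrrN => -> //.
Qed.

(** After rotation [a] is [b e0] with [b ^ 2 = |a| ^ 2], and the integrand is homogeneous of degree
    [2 p] in [a]. *)
Lemma iint_moment a p : (0 < n)%N -> iint n (moment a p) = ndot a a ^+ p * iint n (moment e0 p).
Proof.
move=> n0; apply: EFin_inj; rewrite EFinM.
have main b : (iint n (moment b p))%:E = eint (iota 0 n) (EFin \o moment b p) (fun=> 0).
  apply: (@iint_eint R n _ ((\sum_(i < n) `|b i|) ^+ 2 ^+ p)).
  - exact: ymeas_moment.
  - by move=> x; rewrite moment_ge0 moment_le.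
  - by move=> x i; exact: moment_supp.
rewrite !main; case: (@eint_moment_e0 n.-1 a p).
- by rewrite prednK.
- by move=> i /andP[]; case: (n) n0 => //= m _; rewrite ltnS => h1 h2; have := leq_ltn_trans h2 h1; rewrite ltnn.
move=> b bE ->.
have -> : EFin \o moment (fun i => b * e0 i) p = (fun x => (ndot a a ^+ p)%:E * (EFin \o moment e0 p) x)%E.
  apply/funext => x /=; rewrite -EFinM; congr EFin; rewrite /moment -bE mulrCA -exprMn; congr (_ * _ ^+ _).
  rewrite mulrA -exprMn; congr (_ ^+ 2 * _).
  by rewrite /ndot mulr_sumr; apply: eq_bigr => i _; rewrite mulrA.
rewrite eintZ//.
- by rewrite exprn_ge0// ndot_ge0.
- exact: ymeas_moment.
- by move=> x /=; rewrite lee_fin moment_ge0.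
Qed.

End SphericalMoments.

(** * Second and fourth moments of a 4-design *)

Section DesignMoments.
Import(canonicals,coercions) mpoly.
Variables (R : realType) (n : nat).
Local Notation mu := (@lebesgue_measure R).

Definition linform (a : 'rV[R]_n) : mpoly.mpoly n R :=
  \sum_(i < n) a 0 i *: mpoly.mpolyX R (mpoly.mnm1 i).

Lemma meval_linform (a x : 'rV[R]_n) k : mpoly.meval (x 0) (linform a ^+ k) = dot a x ^+ k.
Proof.
rewrite rmorphXn/= /linform raddf_sum/=; congr (_ ^+ k).
rewrite /dot mxE; apply: eq_bigr => i _.
by rewrite mpoly.mevalZ mpoly.mevalXU mxE.
Qed.

Lemma linform_homog (a : 'rV[R]_n) k :
  all (fun m => mpoly.mdeg m == k) (mpoly.msupp (linform a ^+ k)).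
Proof.
have h := @mpoly.dhomogMn n R mpoly.mdeg 1 (linform a) k.
move: h; rewrite mul1n mpoly.dhomogE; apply.
rewrite -mpoly.dhomogE /linform; elim/big_ind: _ => [|p q|i _].
- exact: mpoly.dhomog0.
- exact: mpoly.dhomogD.
- by apply: mpoly.dhomogZ; rewrite mpoly.dhomogX; apply/eqP; exact: mpoly.mdeg1.
Qed.

(** The mean of the power [2 p] of one coordinate over the sphere. For [p = 1, 2] its value is
    deduced in [design_moments] from the existence of the design itself. *)
Definition sphere_const p : R := iint n (moment n (@e0 R) p) / intRn (@ball_ind R n).

Lemma sphere_avg_linform (a : 'rV[R]_n) p : (0 < n)%N ->
  sphere_avg (fun x => dot a x ^+ p.*2) = dot a a ^+ p * sphere_const p.
Proof.
move=> n0; rewrite /sphere_avg /sphere_const mulrA; congr (_ / _).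
pose a' (i : nat) : R := if insub i is Some j then a 0 j else 0.
have a'E (i : 'I_n) : a' i = a 0 i by rewrite /a' valK.
have -> : dot a a = ndot n a' a'.
  by rewrite /dot mxE; apply: eq_bigr => i _; rewrite mxE a'E.
rewrite -iint_moment// /intRn; congr iint; apply/funext => x.
have sE : sqnorm (\row_(i < n) x i) = ndot n x x.
  by apply: eq_bigr => i _; rewrite mxE -expr2.
rewrite /ball_ind sE /moment; congr (_ * _).
rewrite dotC dotZl dotC -mul2n exprM; congr (_ ^+ p).
have -> : dot a (\row_i x i) = ndot n a' x.
  by rewrite /dot mxE; apply: eq_bigr => i _; rewrite !mxE a'E.
by rewrite exprMn exprVn sqr_sqrtr ?ndot_ge0// mulrC powR_inv1 ?ndot_ge0.
Qed.

Lemma dot_delta (i : 'I_n) (x : 'rV[R]_n) : dot (delta_mx 0 i) x = x 0 i.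
Proof. by rewrite /dot -rowE !mxE. Qed.

Lemma sum_delta_sqr (x : 'rV[R]_n) : \sum_(i < n) dot (delta_mx 0 i) x ^+ 2 = sqnorm x.
Proof. by apply: eq_bigr => i _; rewrite dot_delta. Qed.

Lemma design_moments (X : set 'rV[R]_n) : (0 < n)%N -> finite_set X -> X !=set0 ->
  (forall x, X x -> sqnorm x = 1) -> spherical_design 4 X ->
  (forall a, \sum_(x \in X) dot a x ^+ 2 = (\sum_(x \in X) (1 : R)) * (sqnorm a / n%:R)) /\
  (forall a b, \sum_(x \in X) dot a x ^+ 2 * dot b x ^+ 2 =
     (\sum_(x \in X) (1 : R)) * ((sqnorm a * sqnorm b + 2 * dot a b ^+ 2) / (n%:R * (n%:R + 2)))).
Proof.
move=> n0 fX [x0 Xx0] X1 des; set N := \sum_(x \in X) (1 : R).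
have N0 : N != 0.
  rewrite gt_eqF// /N (fsbigD1 x0)//=; apply: ltr_pwDl => //.
  by rewrite fsumr_ge0.
have mom p a : (p.*2 <= 4)%N -> \sum_(x \in X) dot a x ^+ p.*2 = N * (sqnorm a ^+ p * sphere_const p).
  move=> p4; have := des _ (linform a ^+ p.*2) p4 (linform_homog a p.*2).
  under eq_fsbigr do rewrite meval_linform.
  move=> ->; congr (_ * _); rewrite sqnorm_dot -sphere_avg_linform//.
  by congr sphere_avg; apply/funext => x; rewrite meval_linform.
have nn : n%:R != 0 :> R by rewrite pnatr_eq0 -lt0n.
have sd (i : 'I_n) : sqnorm (delta_mx 0 i : 'rV[R]_n) = 1.
  by rewrite sqnorm_dot dot_delta mxE !eqxx.
have sumE (f : 'rV[R]_n -> R) : \sum_(x \in X) f x = \sum_(x <- finmap.enum_fset (fset_set X)) f x.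
  exact: fsbig_finite.
have sX (f : 'rV[R]_n -> R) : (forall x, X x -> f x = 1) -> \sum_(x <- finmap.enum_fset (fset_set X)) f x = N.
  by move=> f1; rewrite /N -sumE; apply: eq_fsbigr => x; rewrite inE; exact: f1.
(* Sum over an orthonormal basis: the squares add up to [|x| ^ 2 = 1]. *)
have c1 : sphere_const 1 = n%:R^-1.
  have h : \sum_(i < n) \sum_(x \in X) dot (delta_mx 0 i) x ^+ 2 = N.
    under eq_bigr do rewrite sumE.
    by rewrite exchange_big/=; apply: sX => x Xx; rewrite sum_delta_sqr X1.
  move: h; under eq_bigr do rewrite (mom 1%N)// sd expr1 mul1r.
  rewrite sumr_const card_ord -[LHS]mulr_natr => h.
  by apply: (mulfI N0); apply: (mulIf nn); rewrite h mulfVK.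
have sq (a b : 'rV[R]_n) : \sum_(x \in X) dot a x ^+ 2 * dot b x ^+ 2 =
    N * sphere_const 2 * ((sqnorm a * sqnorm b + 2 * dot a b ^+ 2) / 3).
  have P4 := mom 2%N ^~ isT.
  (* Polarization: [12 u^2 v^2 = (u + v)^4 + (u - v)^4 - 2 u^4 - 2 v^4]. *)
  have e : \sum_(x \in X) dot a x ^+ 2 * dot b x ^+ 2 =
    1 / 12 * (\sum_(x \in X) dot (a + b) x ^+ 4 + \sum_(x \in X) dot (a - b) x ^+ 4
      - 2 * (\sum_(x \in X) dot a x ^+ 4) - 2 * (\sum_(x \in X) dot b x ^+ 4)).
    rewrite !sumE !mulr_sumr -big_split -!sumrB mulr_sumr/=; apply: eq_bigr => x _.
    by rewrite !dotDl dotNl; field.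
  rewrite e !P4 !sqnorm_dot !(dotDl, dotDr, dotNl) ![dot _ (- _)]dotC !dotNl.
  by rewrite (dotC b a); field.
(* The same trace argument over pairs of basis vectors; the sum of [1 + 2 delta_ij] is
   [n (n + 2)]. *)
have c2 : sphere_const 2 = 3 / (n%:R * (n%:R + 2)).
  have h : \sum_(i < n) \sum_(j < n) \sum_(x \in X) dot (delta_mx 0 i) x ^+ 2 * dot (delta_mx 0 j) x ^+ 2 = N.
    under eq_bigr => i _ do under eq_bigr => j _ do rewrite sumE.
    under eq_bigr => i _ do rewrite exchange_big/=.
    rewrite exchange_big/=; apply: sX => x Xx.
    under eq_bigr => i _ do rewrite -mulr_sumr sum_delta_sqr X1// mulr1.
    by rewrite sum_delta_sqr X1.
  have dd (i j : 'I_n) : dot (delta_mx 0 i) (delta_mx 0 j) = (i == j)%:R :> R.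
    by rewrite dot_delta mxE eqxx.
  have dc : \sum_(i < n) \sum_(j < n) (1 + 2 * (i == j)%:R ^+ 2) = n%:R * (n%:R + 2) :> R.
    transitivity (\sum_(i < n) (n%:R + 2 : R)); last by rewrite sumr_const card_ord mulr_natl.
    apply: eq_bigr => i _; rewrite big_split/= sumr_const card_ord -mulr_sumr; congr (_ + _).
    rewrite (bigD1 i)//= eqxx expr1n big1 ?addr0 ?mulr1// => j ji.
    by rewrite eq_sym (negbTE ji) expr0n.
  have h2 : N * sphere_const 2 * (n%:R * (n%:R + 2)) = N * 3.
    rewrite -dc -[in RHS]h [RHS]mulr_suml [LHS]mulr_sumr; apply: eq_bigr => i _.
    rewrite [RHS]mulr_suml [LHS]mulr_sumr; apply: eq_bigr => j _.
    by rewrite sq dd !sd mul1r; field.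
  have n2 : n%:R + 2 != 0 :> R by rewrite gt_eqF// ltr_wpDl.
  have nn2 : n%:R * (n%:R + 2) != 0 :> R by rewrite mulf_eq0 negb_or nn.
  by apply: (mulfI N0); rewrite [RHS]mulrA -[in RHS]h2 mulfK.
split=> [a|a b]; first by rewrite (mom 1%N)// c1 expr1.
rewrite sq c2; field.
by rewrite nn gt_eqF// ltr_wpDl.
Qed.

End DesignMoments.

(** * Lattice sums and their moments *)

Section LatticeBounds.
Variable R : realType.
Implicit Types n : nat.

Lemma coord_le_sqnorm n (x : 'rV[R]_n) i : x 0 i ^+ 2 <= sqnorm x.
Proof. by rewrite /sqnorm (bigD1 i)//= lerDl sumr_ge0// => j _; exact: sqr_ge0. Qed.

Lemma sqnorm_mulmx_le n (M : 'M[R]_n) : exists2 K : R, 0 < K &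
  forall x : 'rV[R]_n, sqnorm (x *m M) <= K * sqnorm x.
Proof.
exists (1 + \sum_j (\sum_k `|M k j|) ^+ 2).
  by rewrite ltr_pwDl// sumr_ge0// => j _; exact: sqr_ge0.
move=> x; have x0 := sqnorm_ge0 x.
rewrite mulrDl mul1r; apply: (@le_trans _ _ ((\sum_j (\sum_k `|M k j|) ^+ 2) * sqnorm x)); last by rewrite lerDr.
rewrite mulr_suml; apply: ler_sum => j _.
rewrite mxE -[leLHS]real_normK ?num_real// -[X in _ * X](sqr_sqrtr x0) -exprMn.
have s0 : 0 <= \sum_k `|M k j| by apply: sumr_ge0.
rewrite ler_pXn2r ?nnegrE ?mulr_ge0 ?sqrtr_ge0// mulr_suml.
apply: (le_trans (ler_norm_sum _ _ _)); apply: ler_sum => k _.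
rewrite normrM mulrC ler_wpM2l// -sqrtr_sqr ler_wsqrtr//.
exact: coord_le_sqnorm.
Qed.

Lemma lvec_mulmx n (B C : 'M[R]_n) z : lvec (B *m C) z = lvec B z *m C.
Proof. by rewrite !lvecE mulmxA. Qed.

Lemma lvec_ge n (B : 'M[R]_n) : B \in unitmx -> exists2 c : R, 0 < c &
  forall z, c * sqnorm (ir R z) <= sqnorm (lvec B z).
Proof.
move=> uB; have [K K0 hK] := sqnorm_mulmx_le (invmx B).
exists K^-1; rewrite ?invr_gt0// => z.
by rewrite mulrC ler_pdivrMr// mulrC; have := hK (lvec B z); rewrite lvecE mulmxK.
Qed.

Lemma ir_inj n : injective (@ir R n).
Proof. by move=> x y /rowP h; apply/rowP => i; have := h i; rewrite !mxE => /intr_inj. Qed.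

Lemma ir_eq0 n (z : 'rV[int]_n) : (ir R z == 0) = (z == 0).
Proof.
apply/eqP/eqP => [h|->]; last by apply/rowP => i; rewrite !mxE.
by apply: ir_inj; rewrite h; apply/rowP => i; rewrite !mxE.
Qed.

Lemma sqnorm_ir_ge1 n (z : 'rV[int]_n) : z != 0 -> 1 <= sqnorm (ir R z).
Proof.
rewrite -ir_eq0 -sqnorm_eq0 => h.
have e : sqnorm (ir R z) = (\sum_i z 0 i ^+ 2)%:~R.
  by rewrite rmorph_sum/=; apply: eq_bigr => i _; rewrite mxE rmorphXn.
have : 0 < sqnorm (ir R z) by rewrite lt_neqAle eq_sym h sqnorm_ge0.
by rewrite e ltr0z ler1z gtz0_ge1.
Qed.

Lemma lvec_inj n (B : 'M[R]_n) : B \in unitmx -> injective (lvec B).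
Proof. by move=> uB x y; rewrite !lvecE => /(can_inj (mulmxK uB)) /ir_inj. Qed.

Lemma sqnorm_lvec_gt0 n (B : 'M[R]_n) z : B \in unitmx -> nzidx z -> 0 < sqnorm (lvec B z).
Proof.
move=> uB z0; have [c c0 hc] := lvec_ge uB.
by apply: lt_le_trans (hc z); rewrite mulr_gt0// (lt_le_trans ltr01)// sqnorm_ir_ge1.
Qed.

Lemma lvec_min n (B : 'M[R]_n) : B \in unitmx -> exists2 c : R, 0 < c &
  forall z, nzidx z -> c <= sqnorm (lvec B z).
Proof.
move=> uB; have [c c0 hc] := lvec_ge uB; exists c => // z z0.
by apply: le_trans (hc z); apply: ler_peMr (sqnorm_ir_ge1 z0); exact: ltW.
Qed.

Lemma ler_powRN (a b p : R) : 0 < a -> a <= b -> 0 <= p -> b `^ (- p) <= a `^ (- p).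
Proof.
move=> a0 ab p0; rewrite !powRN lef_pV2 ?posrE ?powR_gt0//; last exact: lt_le_trans ab.
by rewrite ge0_ler_powR// nnegrE ltW//; exact: lt_le_trans ab.
Qed.

Lemma summ_prod_int n (q : R) : 1 / 2 < q ->
  summ [set: 'rV[int]_n] (fun z => \prod_i (1 + (z 0 i)%:~R ^+ 2) `^ (- q)).
Proof.
move=> q12; elim: n => [|n IH].
  apply: summ_fset; apply: (@sub_finite_set _ _ [set 0]); last exact: finite_set1.
  by move=> z _; apply/rowP => -[].
rewrite -(summ_reindex _ (@pair_row_bij n)).
have := summ_pair IH (summ_int_inv q12); rewrite setXTT.
apply: summ_eq => -[z k] _ /=.
rewrite [RHS](big_ord_recl n) mulrC; congr (_ * _).
  by have /rowP/(_ 0) := ir_pair_row R z k; rewrite !mxE/= split1 unlift_none/= mxE eqxx mulr1n => ->.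
apply: eq_bigr => i _; have /rowP/(_ (lift ord0 i)) := ir_pair_row R z k.
by rewrite [LHS]mxE => ->; rewrite mxE split1 liftK/= mxE.
Qed.

Lemma summ_pow_int n (p : R) : n%:R / 2 < p ->
  summ [set: 'rV[int]_n] (fun z => (1 + sqnorm (ir R z)) `^ (- p)).
Proof.
case: n => [|n] np.
  apply: summ_fset; apply: (@sub_finite_set _ _ [set 0]); last exact: finite_set1.
  by move=> z _; apply/rowP => -[].
(* The exponent is shared equally among the coordinates: [1 + |z|^2] is at least [1 + z_i^2] for
   each [i], which reduces to a product of one-dimensional series. *)
have q12 : 1 / 2 < p / n.+1%:R by rewrite ltr_pdivlMr//; lra.
apply: summ_le (summ_prod_int n.+1 q12) => z _.
rewrite ger0_norm ?powR_ge0//.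
have -> : - p = - (p / n.+1%:R) * n.+1%:R by rewrite mulNr divfK.
rewrite powRrM powR_mulrn ?powR_ge0// -{4}[n.+1]card_ord -prodr_const.
apply: ler_prod => i _; rewrite powR_ge0/=; apply: ler_powRN.
- by rewrite ltr_pwDl// sqr_ge0.
- by rewrite lerD2l; have := coord_le_sqnorm (ir R z) i; rewrite mxE.
- by apply: ltW; apply: lt_trans q12; lra.
Qed.

Lemma summ_lvec_pow n (B : 'M[R]_n) (p : R) : B \in unitmx -> n%:R / 2 < p ->
  summ (@nzidx n) (fun z => sqnorm (lvec B z) `^ (- p)).
Proof.
move=> uB np; have [c c0 hc] := lvec_ge uB.
have p0 : 0 <= p by apply: ltW; apply: le_lt_trans np; rewrite divr_ge0.
have := summZ ((c / 2) `^ (- p)) (summ_pow_int np) => /(summ_subset (@subsetT _ (@nzidx n))).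
apply: summ_le => z z0; rewrite ger0_norm ?powR_ge0//.
have z1 := sqnorm_ir_ge1 z0.
have c20 : 0 < c / 2 by rewrite divr_gt0.
have z2 : 0 < 1 + sqnorm (ir R z) by lra.
rewrite -powRM ?(ltW c20) ?(ltW z2)//; apply: ler_powRN => //; first exact: mulr_gt0.
apply: le_trans (hc z); rewrite -mulrA ler_pM2l//; lra.
Qed.

(** All vectors of the layer contribute the same [exp (- pi m)] to the convergent theta series, so
    none of them can lie in a tail smaller than this value. *)
Lemma finite_layer n (B : 'M[R]_n) (m : R) : B \in unitmx -> finite_set [set z | sqnorm (lvec B z) = m].
Proof.
move=> uB; have [s _ _] := theta_functional uB (@ltr01 R).
have [F [fF _ hF]] := summ_tail (expR_gt0 (- (pi * 1 * m))) (fun i _ => expR_ge0 _) s.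
apply: sub_finite_set fF => z /= zm; apply: contrapT => zF.
move: hF; apply/negP; rewrite -leNgt.
have e : rsum [set z] (fun z => expR (- (pi * 1 * sqnorm (lvec B z)))) = expR (- (pi * 1 * m)).
  by rewrite rsum_fset ?fsbig_set1 ?zm//; exact: finite_set1.
rewrite -e [leRHS](rsumID [set z]); last exact: summ_subset s.
have -> : setT `&` ~` F `&` [set z] = [set z] by apply/seteqP; split => y /=; [case|move=> ->].
rewrite lerDl; apply: rsum_ge0 => [i _|]; first exact: expR_ge0.
exact: summ_subset s.
Qed.

End LatticeBounds.

(** * Moments of radial lattice sums *)

Section LayerMoments.
Variable R : realType.
Implicit Types n : nat.

(** Fubini on the graph of [k]: indexing by all real values [m] avoids enumerating the values of
    [k]. *)
Lemma rsum_group (T : choiceType) (D : set T) (k : T -> R) (f : T -> R) : summ D f ->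
  rsum D f = rsum [set: R] (fun m => rsum [set z | D z /\ k z = m] f).
Proof.
move=> sD; pose F (p : R * T) : R := if (p.1 == k p.2) && (p.2 \in D) then f p.2 else 0.
have bij : set_bij D [set p : R * T | p.1 = k p.2 /\ D p.2] (fun z => (k z, z)).
  split => [z Dz|x y _ _ [_ //]|[m z] [/= -> Dz]] //.
  by exists z.
have Fin (p : R * T) : p \in [set p : R * T | p.1 = k p.2 /\ D p.2] = (p.1 == k p.2) && (p.2 \in D).
  by apply/idP/andP; rewrite !inE => -[/eqP].
have sF : summ ([set: R] `*` [set: T]) F.
  rewrite setXTT; have h := (summ_reindex (fun p : R * T => f p.2) bij).1 sD.
  apply: summ_eq ((summ_mkcond _ _).1 h) => p _ /=.
  by rewrite Fin.
have [_ E] := rsum_fubini sF.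
transitivity (rsum ([set: R] `*` [set: T]) F).
  rewrite setXTT -(rsum_reindex (fun p : R * T => f p.2) bij) rsum_mkcond.
  by apply: eq_rsum => p _; rewrite Fin.
rewrite E; apply: eq_rsum => m _; rewrite [RHS]rsum_mkcond; apply: eq_rsum => z _.
rewrite /F /=; congr (if _ then _ else _).
by apply/andP/idP; rewrite !inE => -[]; [move=> /eqP -> Dz|move=> Dz ->; split].
Qed.

Lemma layer_design_moments n (B : 'M[R]_n) (m : R) : (0 < n)%N -> B \in unitmx ->
  all_layers_design 4 B -> 0 < m ->
  let D := [set z : 'rV[int]_n | nzidx z /\ sqnorm (lvec B z) = m] in
  (forall a, rsum D (fun z => dot a (lvec B z) ^+ 2) = rsum D (fun=> 1) * m * (sqnorm a / n%:R)) /\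
  (forall a b, rsum D (fun z => dot a (lvec B z) ^+ 2 * dot b (lvec B z) ^+ 2) =
     rsum D (fun=> 1) * m ^+ 2 * ((sqnorm a * sqnorm b + 2 * dot a b ^+ 2) / (n%:R * (n%:R + 2)))).
Proof.
move=> n0 uB des m0 D; have sm : Num.sqrt m != 0 by rewrite gt_eqF// sqrtr_gt0.
(* The design hypothesis speaks of nonempty layers only; on an empty one all sums are 0. *)
have [[z1 Dz1]|D0] := pselect (D !=set0); last first.
  have {}D0 z : ~ D z by move=> Dz; apply: D0; exists z.
  by split=> [a|a b]; rewrite !(@rsum_eq0 _ _ D) ?mul0r// => z /D0.
have fD : finite_set D by apply: sub_finite_set (finite_layer m uB) => z [].
pose X := [set (Num.sqrt m)^-1 *: x | x in layer B m].
pose e z := (Num.sqrt m)^-1 *: lvec B z.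
have be : set_bij D X e.
  split => [z [_ zm]|x y _ _ /scalerI h|_ [_ [[z ->] zm] <-]].
  - by exists (lvec B z) => //; split => //; exists z.
  - by apply: (lvec_inj uB); apply: h; rewrite invr_eq0.
  - exists z => //; split => //; apply/eqP => z0.
    move: zm; rewrite z0 (_ : lvec B 0 = 0); last first.
      by rewrite lvecE (_ : ir R 0 = 0) ?mul0mx//; apply/rowP => i; rewrite !mxE.
    rewrite (_ : sqnorm 0 = 0); last by apply/eqP; rewrite sqnorm_eq0.
    by move=> h; move: m0; rewrite -h ltxx.
have fX : finite_set X.
  by apply: sub_finite_set (finite_image e fD); case: be.
have toX (g : 'rV[R]_n -> R) : \sum_(x \in X) g x = rsum D (g \o e).
  by rewrite -rsum_fset// (rsum_reindex _ be).
have X1 x : X x -> sqnorm x = 1.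
  move=> [y [_ yE] <-]; rewrite sqnorm_dot dotZl dotC dotZl -sqnorm_dot yE.
  by rewrite mulrA -expr2 exprVn sqr_sqrtr ?ltW// mulVf// gt_eqF.
have lD : layer B m !=set0.
  by exists (lvec B z1); case: Dz1 => _ h; split => //; exists z1.
have [H2 H4] := design_moments n0 fX (ex_intro _ (e z1) (let: And3 h _ _ := be in h _ Dz1)) X1 (des m m0 lD).
have yE z : lvec B z = Num.sqrt m *: e z by rewrite scalerA mulfV// scale1r.
have sD f : summ D f by exact: summ_fset.
have m2 : Num.sqrt m ^+ 2 = m by rewrite sqr_sqrtr// ltW.
clearbody e; split=> [a|a b].
  transitivity (rsum D (fun z => m * dot a (e z) ^+ 2)).
    by apply: eq_rsum => z _; rewrite yE dotC dotZl exprMn m2 dotC.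
  by rewrite rsumZ// -[rsum D _](toX (fun x => dot a x ^+ 2)) H2 toX /=; ring.
transitivity (rsum D (fun z => m ^+ 2 * (dot a (e z) ^+ 2 * dot b (e z) ^+ 2))).
  apply: eq_rsum => z _; rewrite yE (dotC a) (dotC b) !dotZl !exprMn m2 (dotC _ a) (dotC _ b); ring.
by rewrite rsumZ// -[rsum D _](toX (fun x => dot a x ^+ 2 * dot b x ^+ 2)) H4 toX /=; ring.
Qed.

Lemma dot_row n (P : 'M[R]_n) i (x : 'rV[R]_n) : dot (row i P) x = (x *m P^T) 0 i.
Proof. by rewrite dotC /dot !mxE; apply: eq_bigr => k _; rewrite !mxE. Qed.

Lemma dot_row_orth n (P : 'M[R]_n) i j : P *m P^T = 1%:M -> dot (row i P) (row j P) = (i == j)%:R.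
Proof. by move=> PP; rewrite dot_row -row_mul PP !mxE eq_sym. Qed.

Lemma sqnorm_orth n (P : 'M[R]_n) (x : 'rV[R]_n) : P *m P^T = 1%:M -> sqnorm (x *m P^T) = sqnorm x.
Proof.
move=> PP; rewrite !sqnorm_dot /dot trmx_mul trmxK mulmxA -[x *m P^T *m P]mulmxA.
by rewrite (mulmx1C PP) mulmx1.
Qed.

(** The rotated coordinates are inner products with the orthonormal rows of [P], and rotation
    preserves the layers. On each layer the weight is constant, so the moments of the layers add
    up. *)
Lemma lattice_moments n (B P : 'M[R]_n) : (0 < n)%N -> B \in unitmx ->
  all_layers_design 4 B -> P *m P^T = 1%:M -> forall (w : R -> R),
  let y z := lvec (B *m P^T) z in let r z := sqnorm (y z) in
  summ (@nzidx n) (fun z => w (r z)) ->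
  (forall i, rsum (@nzidx n) (fun z => w (r z) * (y z 0 i ^+ 2 / r z)) =
     n%:R^-1 * rsum (@nzidx n) (fun z => w (r z))) /\
  (forall i j, rsum (@nzidx n) (fun z => w (r z) * ((y z 0 i ^+ 2 / r z) * (y z 0 j ^+ 2 / r z))) =
     (1 + 2 * (i == j)%:R) / (n%:R * (n%:R + 2)) * rsum (@nzidx n) (fun z => w (r z))).
Proof.
move=> n0 uB des PP w y r sw.
have rE z : r z = sqnorm (lvec B z) by rewrite /r /y lvec_mulmx sqnorm_orth.
have yE z i : y z 0 i = dot (row i P) (lvec B z) by rewrite dot_row /y lvec_mulmx.
have r0 z : nzidx z -> 0 < r z by move=> z0; rewrite rE sqnorm_lvec_gt0.
have p0 z i : 0 <= y z 0 i ^+ 2 / r z by rewrite divr_ge0 ?sqr_ge0 ?sqnorm_ge0.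
have p1 z i : nzidx z -> y z 0 i ^+ 2 / r z <= 1.
  by move=> z0; rewrite ler_pdivrMr ?r0// mul1r coord_le_sqnorm.
have group (f : 'rV[int]_n -> R) (c : R) : (forall z, nzidx z -> 0 <= f z <= 1) ->
    (forall m, 0 < m -> rsum [set z | nzidx z /\ r z = m] f = c * rsum [set z | nzidx z /\ r z = m] (fun=> 1)) ->
    rsum (@nzidx n) (fun z => w (r z) * f z) = c * rsum (@nzidx n) (fun z => w (r z)).
  move=> f01 H.
  have sf : summ (@nzidx n) (fun z => w (r z) * f z).
    apply: summ_le (summ_norm sw) => z z0; have /andP[f0 f1] := f01 z z0.
    by rewrite normrM ler_piMr// ger0_norm.
  rewrite -rsumZ// (rsum_group r sf) (rsum_group r (summZ c sw)); apply: eq_rsum => m _.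
  have [m0|m0] := ltP 0 m; last first.
    by rewrite !rsum_eq0// => z [/r0 + rm]; rewrite rm ltNge m0.
  have fD : finite_set [set z | nzidx z /\ r z = m].
    by apply: sub_finite_set (finite_layer m uB) => z [_]; rewrite rE.
  transitivity (rsum [set z | nzidx z /\ r z = m] (fun z => w m * f z)).
    by apply: eq_rsum => z [_ ->].
  rewrite rsumZ; last exact: summ_fset.
  transitivity (rsum [set z | nzidx z /\ r z = m] (fun z => c * w m * 1)); last first.
    by apply: eq_rsum => z [_ ->]; rewrite mulr1.
  rewrite rsumZ; last exact: summ_fset.
  by rewrite H//; ring.
have Dr m : [set z | nzidx z /\ r z = m] = [set z : 'rV[int]_n | nzidx z /\ sqnorm (lvec B z) = m].
  by apply/seteqP; split => z [z0 h]; split => //; rewrite -h rE.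
have rowN i : sqnorm (row i P) = 1 by rewrite sqnorm_dot dot_row_orth// eqxx.
split=> [i|i j]; apply: group => [z z0|m m0].
- by rewrite p0 p1.
- have [H2 _] := layer_design_moments n0 uB des m0.
  transitivity (rsum [set z | nzidx z /\ r z = m] (fun z => m^-1 * dot (row i P) (lvec B z) ^+ 2)).
    by apply: eq_rsum => z [_ ->]; rewrite yE mulrC.
  rewrite rsumZ; last first.
    by apply: summ_fset; rewrite Dr; apply: sub_finite_set (finite_layer m uB) => z [].
  rewrite Dr H2 rowN; move: (rsum _ _) => N; field.
  by rewrite pnatr_eq0 -lt0n n0 gt_eqF.
- by rewrite mulr_ge0// mulr_ile1// p1.
- have [_ H4] := layer_design_moments n0 uB des m0.
  transitivity (rsum [set z | nzidx z /\ r z = m] (fun z => m^-2 *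
      (dot (row i P) (lvec B z) ^+ 2 * dot (row j P) (lvec B z) ^+ 2))).
    apply: eq_rsum => z [_ ->]; rewrite !yE; move: (dot _ _) (dot _ _) => u v; field.
    by rewrite gt_eqF.
  rewrite rsumZ; last first.
    by apply: summ_fset; rewrite Dr; apply: sub_finite_set (finite_layer m uB) => z [].
  rewrite Dr H4 !rowN dot_row_orth//.
  have -> : (i == j)%:R ^+ 2 = (i == j)%:R :> R by case: (i == j); rewrite ?expr1n ?expr0n.
  move: (rsum _ _) ((i == j)%:R : R) => N d; field.
  by rewrite ?(gt_eqF m0) pnatr_eq0 -lt0n n0 gt_eqF// ltr_wpDl.
Qed.

End LayerMoments.

(** * Second-order expansion under a deformation *)

Section Taylor.
Variable R : realType.

(** Each bound is integrated from the one of lower order through [derive_ge0_le]. *)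
Lemma expR_taylor_pos (x : R) : 0 <= x ->
  0 <= expR x - 1 - x - x ^+ 2 / 2 <= x ^+ 3 * expR x.
Proof.
have e1 (y : R) : 0 <= y -> 0 <= expR y - 1 - y <= y ^+ 2 * expR y.
  move=> y0; apply/andP; split; first by have := expR_ge1Dx y; lra.
  have b (z : R) : 0 <= z -> expR z - 1 <= z * expR z.
    by move=> z0; have := expR_ge1Dx (- z); rewrite expRN -(ler_pM2r (expR_gt0 z)) mulVf ?gt_eqF ?expR_gt0//; lra.
  rewrite -subr_ge0.
  have := @derive_ge0_le R (fun z => z ^+ 2 * expR z - (expR z - 1 - z))
    (fun z => 2 * z * expR z + z ^+ 2 * expR z - (expR z - 1)) y y0.
  rewrite /= expr0n/= mul0r expR0 !subrr; apply.
    by move=> z; apply: is_derive_eq; rewrite /GRing.scale/=; ring.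
  move=> z /andP[z0 _]; have := b z z0; have : 0 <= z * expR z by rewrite mulr_ge0 ?expR_ge0.
  have : 0 <= z ^+ 2 * expR z by rewrite mulr_ge0 ?sqr_ge0 ?expR_ge0.
  lra.
move=> x0; apply/andP; split.
  have := @derive_ge0_le R (fun z => expR z - 1 - z - z ^+ 2 / 2) (fun z => expR z - 1 - z) x x0.
  rewrite /= expr0n/= mul0r expR0 !subrr; apply.
    by move=> z; apply: is_derive_eq; rewrite /GRing.scale/=; field.
  by move=> z /andP[z0 _]; case/andP: (e1 z z0).
rewrite -subr_ge0.
have := @derive_ge0_le R (fun z => z ^+ 3 * expR z - (expR z - 1 - z - z ^+ 2 / 2))
  (fun z => 3 * z ^+ 2 * expR z + z ^+ 3 * expR z - (expR z - 1 - z)) x x0.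
rewrite /= !expr0n/= !mul0r expR0 !subrr; apply.
  by move=> z; apply: is_derive_eq; rewrite /GRing.scale/=; field.
move=> z /andP[z0 _]; case/andP: (e1 z z0) => _.
have : 0 <= z ^+ 3 * expR z by rewrite mulr_ge0 ?exprn_ge0 ?expR_ge0.
have : 0 <= z ^+ 2 * expR z by rewrite mulr_ge0 ?sqr_ge0 ?expR_ge0.
lra.
Qed.

Lemma expR_taylor_neg (x : R) : 0 <= x ->
  0 <= 1 - x + x ^+ 2 / 2 - expR (- x) <= x ^+ 3.
Proof.
have b (z : R) : 0 <= z -> 0 <= 1 - expR (- z) <= z.
  move=> z0; have := expR_ge1Dx (- z); have : expR (- z) <= 1 by rewrite -expR0 ler_expR; lra.
  by move=> h1 h2; apply/andP; split; lra.
have e1 (y : R) : 0 <= y -> 0 <= expR (- y) - 1 + y <= y ^+ 2.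
  move=> y0; apply/andP; split; first by have := expR_ge1Dx (- y); lra.
  rewrite -subr_ge0.
  have := @derive_ge0_le R (fun z => z ^+ 2 - (expR (- z) - 1 + z))
    (fun z => 2 * z - (1 - expR (- z))) y y0.
  rewrite /= expr0n/= oppr0 expR0 !subrr addr0 subr0; apply.
    by move=> z; apply: is_derive_eq; rewrite /GRing.scale/=; ring.
  by move=> z /andP[z0 _]; case/andP: (b z z0); lra.
move=> x0; apply/andP; split.
  have := @derive_ge0_le R (fun z => 1 - z + z ^+ 2 / 2 - expR (- z)) (fun z => expR (- z) - 1 + z) x x0.
  rewrite /= expr0n/= mul0r oppr0 expR0 !addr0 subrr; apply.
    by move=> z; apply: is_derive_eq; rewrite /GRing.scale/=; field.
  by move=> z /andP[z0 _]; case/andP: (e1 z z0).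
rewrite -subr_ge0.
have := @derive_ge0_le R (fun z => z ^+ 3 - (1 - z + z ^+ 2 / 2 - expR (- z)))
  (fun z => 3 * z ^+ 2 - (expR (- z) - 1 + z)) x x0.
rewrite /= !expr0n/= mul0r oppr0 expR0 !addr0 !subrr; apply.
  by move=> z; apply: is_derive_eq; rewrite /GRing.scale/=; field.
move=> z /andP[z0 _]; case/andP: (e1 z z0) => _; have : 0 <= z ^+ 2 by exact: sqr_ge0.
lra.
Qed.

Lemma expR_taylor (y : R) : `|expR y - 1 - y - y ^+ 2 / 2| <= `|y| ^+ 3 * expR `|y|.
Proof.
have [y0|y0] := leP 0 y.
  by have /andP[h1 h2] := expR_taylor_pos y0; rewrite (ger0_norm y0) ger0_norm.
have x0 : 0 <= - y by lra.
have /andP[] := expR_taylor_neg x0; rewrite opprK sqrrN => h1 h2.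
rewrite (ltr0_norm y0) -normrN ger0_norm; last by lra.
apply: (@le_trans _ _ ((- y) ^+ 3)); first by lra.
by rewrite ler_peMr ?exprn_ge0// -expR0 ler_expR.
Qed.

(** Read off from the expansion of the exponential at [l = ln (1 + v)]: the bound [|l| <= 2 |v|]
    makes [l - v] quadratic in [v], and this makes [l ^ 2 - v ^ 2] cubic. *)
Lemma ln_taylor : exists2 K : R, 0 <= K & forall v : R, `|v| <= 1 / 2 ->
  `|ln (1 + v) - v + v ^+ 2 / 2| <= K * `|v| ^+ 3 /\ `|ln (1 + v)| <= 2 * `|v|.
Proof.
pose E : R := expR 1.
have E1 : 1 <= E by rewrite /E -expR0 ler_expR.
exists (40 * E) => [|v]; first by lra.
rewrite ler_norml => /andP[v1 v2].
have l2 : `|ln (1 + v)| <= 2 * `|v|.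
  by rewrite (mulrC 2); have := @ln_norm_le R (1 + v); rewrite (_ : 1 + v - 1 = v); [apply; lra|ring].
split=> //; have ev : expR (ln (1 + v)) = 1 + v by rewrite lnK// posrE; lra.
move: (ln (1 + v)) l2 ev => l l2 ev.
have a0 : 0 <= `|v| by [].
have a1 : `|v| <= 1 / 2 by rewrite ler_norml v1.
have t := expR_taylor l.
have t1 : `|expR l - 1 - l - l ^+ 2 / 2| <= 8 * E * `|v| ^+ 3.
  apply: (le_trans t).
  have -> : 8 * E * `|v| ^+ 3 = (2 * `|v|) ^+ 3 * E by ring.
  rewrite ler_pM ?exprn_ge0 ?expR_ge0//; first by rewrite lerXn2r ?nnegrE ?mulr_ge0.
  by rewrite ler_expR; lra.
have c3 : `|v| ^+ 3 <= `|v| ^+ 2 / 2.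
  by rewrite exprS mulrC ler_wpM2l ?sqr_ge0//; lra.
have q : `|l| ^+ 2 <= 4 * `|v| ^+ 2.
  have -> : 4 * `|v| ^+ 2 = (2 * `|v|) ^+ 2 by ring.
  by rewrite lerXn2r ?nnegrE ?mulr_ge0.
have t2 : `|l - v| <= 6 * E * `|v| ^+ 2.
  have -> : l - v = - (expR l - 1 - l - l ^+ 2 / 2) - l ^+ 2 / 2 by rewrite ev; ring.
  apply: (le_trans (ler_normB _ _)); rewrite normrN normrM [`|l ^+ 2|]normrX [`|2^-1|]ger0_norm//.
  have v20 : 0 <= `|v| ^+ 2 by exact: sqr_ge0.
  have h1 : E * `|v| ^+ 3 <= E * (`|v| ^+ 2 / 2) by rewrite ler_wpM2l//; lra.
  have h2 : `|v| ^+ 2 <= E * `|v| ^+ 2 by rewrite ler_peMl.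
  move: t1 h1 h2 q; rewrite -!mulrA; lra.
have t3 : `|l + v| <= 3 * `|v| by apply: (le_trans (ler_normD _ _)); lra.
have t4 : `|l ^+ 2 - v ^+ 2| <= 18 * E * `|v| ^+ 3.
  rewrite subr_sqr normrM.
  have -> : 18 * E * `|v| ^+ 3 = 6 * E * `|v| ^+ 2 * (3 * `|v|) by ring.
  by rewrite ler_pM.
have -> : l - v + v ^+ 2 / 2 = - (expR l - 1 - l - l ^+ 2 / 2) - (l ^+ 2 - v ^+ 2) / 2.
  by rewrite ev; field.
apply: (le_trans (ler_normB _ _)); rewrite normrN normrM [`|2^-1|]ger0_norm//.
have : 0 <= E * `|v| ^+ 3 by rewrite mulr_ge0 ?exprn_ge0//; lra.
move: t1 t4; rewrite -!mulrA; lra.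
Qed.

Lemma powR_taylor (s : R) : 0 <= s -> exists2 K : R, 0 <= K & forall v : R, `|v| <= 1 / 2 ->
  `|(1 + v) `^ (- s) - 1 + s * v - s * (s + 1) / 2 * v ^+ 2| <= K * `|v| ^+ 3.
Proof.
move=> s0; have [K K0 hK] := ln_taylor.
have E0 : 0 <= expR s by exact: expR_ge0.
have s20 : 0 <= s ^+ 2 by exact: sqr_ge0.
exists (s * K + s ^+ 2 * (2 + K) + 8 * s ^+ 3 * expR s) => [|v v12].
  by rewrite !addr_ge0 ?mulr_ge0 ?exprn_ge0//; lra.
have [l1 l2] := hK v v12.
have v1 : 0 < 1 + v by move: v12; rewrite ler_norml => /andP[]; lra.
rewrite /powR gt_eqF//; move: (ln (1 + v)) l1 l2 => l l1 l2.
have a0 : 0 <= `|v| by [].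
have t := expR_taylor (- s * l).
have t1 : `|expR (- s * l) - 1 - (- s * l) - (- s * l) ^+ 2 / 2| <= 8 * s ^+ 3 * expR s * `|v| ^+ 3.
  apply: (le_trans t); rewrite normrM normrN (ger0_norm s0).
  have -> : 8 * s ^+ 3 * expR s * `|v| ^+ 3 = (s * (2 * `|v|)) ^+ 3 * expR s by ring.
  have b : s * `|l| <= s * (2 * `|v|) by rewrite ler_wpM2l.
  rewrite ler_pM ?exprn_ge0 ?mulr_ge0 ?expR_ge0//; first by rewrite lerXn2r ?nnegrE ?mulr_ge0.
  rewrite ler_expR (le_trans b)// ler_piMr//; lra.
have c3 : `|v| ^+ 3 <= `|v| ^+ 2 / 2.
  by rewrite exprS mulrC ler_wpM2l ?sqr_ge0//; lra.
have t2 : `|l - v| <= (1 + K) / 2 * `|v| ^+ 2.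
  have -> : l - v = (l - v + v ^+ 2 / 2) - v ^+ 2 / 2 by ring.
  apply: (le_trans (ler_normB _ _)); rewrite [X in _ + X]normrM [`|v ^+ 2|]normrX [`|2^-1|]ger0_norm//.
  have h1 : K * `|v| ^+ 3 <= K * (`|v| ^+ 2 / 2) by rewrite ler_wpM2l.
  by move: l1 h1; lra.
have t3 : `|l + v| <= 3 * `|v| by apply: (le_trans (ler_normD _ _)); lra.
have t4 : `|l ^+ 2 - v ^+ 2| <= 3 * ((1 + K) / 2) * `|v| ^+ 3.
  rewrite subr_sqr normrM.
  have -> : 3 * ((1 + K) / 2) * `|v| ^+ 3 = (1 + K) / 2 * `|v| ^+ 2 * (3 * `|v|) by ring.
  by rewrite ler_pM.
have -> : expR (- s * l) - 1 + s * v - s * (s + 1) / 2 * v ^+ 2 =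
  (expR (- s * l) - 1 - (- s * l) - (- s * l) ^+ 2 / 2) - s * (l - v + v ^+ 2 / 2) +
  s ^+ 2 * ((l ^+ 2 - v ^+ 2) / 2) by field.
apply: (le_trans (ler_normD _ _)); apply: (le_trans (lerD (ler_normB _ _) (lexx _))).
rewrite [`|s * _|]normrM [`|s ^+ 2 * _|]normrM [`|_ / 2|]normrM [`|2^-1|]ger0_norm// normrX (ger0_norm s0).
have b1 : s * `|l - v + v ^+ 2 / 2| <= s * (K * `|v| ^+ 3) by rewrite ler_wpM2l.
have b2 : s ^+ 2 * (`|l ^+ 2 - v ^+ 2| / 2) <= s ^+ 2 * ((2 + K) * `|v| ^+ 3).
  rewrite ler_wpM2l//; have : 0 <= `|v| ^+ 3 by rewrite exprn_ge0.
  have : 0 <= K * `|v| ^+ 3 by rewrite mulr_ge0 ?exprn_ge0.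
  by move: t4; rewrite !mulrDl !mul1r; lra.
rewrite [leRHS]mulrDl [(s * K + _) * _]mulrDl -[s * K * _]mulrA -[s ^+ 2 * _ * _]mulrA; lra.
Qed.

(** Since [|v| <= 1 / 2], the factor [exp (x |v|)] of the remainder consumes at most half of the
    decay [exp (- x)]. *)
Lemma expR_radial_taylor (x v : R) : 0 <= x -> `|v| <= 1 / 2 ->
  `|expR (- (x * (1 + v))) - expR (- x) - (- x * expR (- x)) * v - (x ^+ 2 * expR (- x)) * v ^+ 2 / 2|
    <= x ^+ 3 * expR (- (x / 2)) * `|v| ^+ 3.
Proof.
move=> x0 v12; have t := expR_taylor (- (x * v)).
have -> : expR (- (x * (1 + v))) = expR (- x) * expR (- (x * v)) by rewrite -expRD; congr expR; ring.
have -> : expR (- x) * expR (- (x * v)) - expR (- x) - - x * expR (- x) * v -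
   x ^+ 2 * expR (- x) * v ^+ 2 / 2 =
  expR (- x) * (expR (- (x * v)) - 1 - (- (x * v)) - (- (x * v)) ^+ 2 / 2) by field.
rewrite normrM (ger0_norm (expR_ge0 _)).
apply: (@le_trans _ _ (expR (- x) * (`|- (x * v)| ^+ 3 * expR `|- (x * v)|))).
  by rewrite ler_wpM2l ?expR_ge0.
rewrite normrN normrM (ger0_norm x0) exprMn.
have e : expR (- x) * expR (x * `|v|) <= expR (- (x / 2)).
  rewrite -expRD ler_expR; have : x * `|v| <= x * (1 / 2) by rewrite ler_wpM2l.
  lra.
have -> : expR (- x) * (x ^+ 3 * `|v| ^+ 3 * expR (x * `|v|)) =
  x ^+ 3 * `|v| ^+ 3 * (expR (- x) * expR (x * `|v|)) by ring.
by rewrite [leRHS]mulrAC ler_wpM2l// mulr_ge0 ?exprn_ge0.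
Qed.

(** With [c = 4 (k + 1)], the inequality [x / c <= exp (x / c)] raised to the power [k + 1]. *)
Lemma xk_expR_le (k : nat) (x : R) : 0 <= x -> x ^+ k.+1 <= (4 * k.+1%:R) ^+ k.+1 * expR (x / 4).
Proof.
move=> x0; have k0 : 0 < k.+1%:R :> R by rewrite ltr0n.
have -> : x / 4 = k.+1%:R * (x / (4 * k.+1%:R)) by field; rewrite gt_eqF.
rewrite expRM_natl -exprMn lerXn2r ?nnegrE ?mulr_ge0 ?expR_ge0//.
rewrite {1}(_ : x = 4 * k.+1%:R * (x / (4 * k.+1%:R))); last by field; rewrite gt_eqF.
by rewrite ler_wpM2l ?mulr_ge0//; apply: le_trans (expR_ge1Dx _); rewrite lerDr.
Qed.

End Taylor.

(** * Expansion of radial sums under diagonal deformations *)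

Section Deformation.
Variable R : realType.
Implicit Types n : nat.

(* With p_i = y_i^2 / |y|^2, the deformed square length is |y|^2 (1 + v) for
   v = sum_i (e^{2 h_i} - 1) p_i, and v = 2 sum_i h_i p_i + 2 sum_i h_i^2 p_i + O(d^3). *)
Lemma deformed_taylor n (y h : 'rV[R]_n) (p : 'I_n -> R) (F : R -> R) (al be G d : R) :
  0 < sqnorm y -> 0 <= d <= 1 / 8 -> (forall i, `|h 0 i| <= d) -> 0 <= G -> (forall i, p i = y 0 i ^+ 2 / sqnorm y) ->
  (forall v : R, `|v| <= 1 / 2 ->
    `|F (sqnorm y * (1 + v)) - F (sqnorm y) - al * v - be * v ^+ 2 / 2| <= G * `|v| ^+ 3) ->
  `|F (\sum_i expR (2 * h 0 i) * y 0 i ^+ 2) - F (sqnorm y)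
    - (\sum_i (2 * h 0 i + 2 * h 0 i ^+ 2) * (al * p i)
       + 2 * \sum_i \sum_j h 0 i * h 0 j * (be * (p i * p j)))|
  <= 27 * d ^+ 3 * (`|al| + `|be| + G).
Proof.
move=> r0 /andP[d0 d8] hd G0 pE T.
have p0 i : 0 <= p i by rewrite pE divr_ge0 ?sqr_ge0 ?sqnorm_ge0.
have p1 : \sum_i p i = 1.
  by rewrite (eq_bigr _ (fun i _ => pE i)) -mulr_suml divff// gt_eqF.
(* The [p_i] are probability weights, so averages against them inherit uniform bounds. *)
have avg (f : 'I_n -> R) (c : R) : (forall i, `|f i| <= c) -> `|\sum_i f i * p i| <= c.
  move=> fc; apply: (le_trans (ler_norm_sum _ _ _)); rewrite -[c]mulr1 -p1 mulr_sumr.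
  by apply: ler_sum => i _; rewrite normrM (ger0_norm (p0 i)) ler_wpM2r.
pose v := \sum_i (expR (2 * h 0 i) - 1) * p i.
pose w := \sum_i h 0 i * p i; pose w2 := \sum_i h 0 i ^+ 2 * p i.
have -> : \sum_i expR (2 * h 0 i) * y 0 i ^+ 2 = sqnorm y * (1 + v).
  rewrite mulrDr mulr1 /v mulr_sumr {1}/sqnorm -big_split/=; apply: eq_bigr => i _.
  by rewrite pE; field; rewrite gt_eqF.
have -> : \sum_i (2 * h 0 i + 2 * h 0 i ^+ 2) * (al * p i) = al * (2 * w + 2 * w2).
  rewrite /w /w2 !mulr_sumr -big_split/= mulr_sumr; apply: eq_bigr => i _; ring.
have -> : \sum_i \sum_j h 0 i * h 0 j * (be * (p i * p j)) = be * w ^+ 2.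
  rewrite expr2 /w mulr_suml mulr_sumr; apply: eq_bigr => i _.
  by rewrite mulr_sumr mulr_sumr; apply: eq_bigr => j _; ring.
have d20 : 0 <= d ^+ 2 by exact: sqr_ge0.
have d30 : 0 <= d ^+ 3 by exact: exprn_ge0.
have d2 : d ^+ 2 <= d / 8 by rewrite expr2 ler_wpM2l//; lra.
have d3 : d ^+ 3 <= d ^+ 2 / 8 by rewrite exprSr ler_wpM2l//; lra.
have E2 : expR (1 / 4) <= 2 :> R.
  have := expR_ge1Dx (- (1 / 4) : R); rewrite expRN => h1.
  have := expR_gt0 (1 / 4 : R) => e0.
  by rewrite -[leLHS]invrK -[leRHS]invrK lef_pV2 ?posrE ?invr_gt0//; lra.
have ev : `|v - 2 * w - 2 * w2| <= 16 * d ^+ 3.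
  have -> : v - 2 * w - 2 * w2 = \sum_i (expR (2 * h 0 i) - 1 - 2 * h 0 i - (2 * h 0 i) ^+ 2 / 2) * p i.
    by rewrite /v /w /w2 !mulr_sumr -!sumrB; apply: eq_bigr => i _; field.
  apply: avg => i; apply: (le_trans (expR_taylor _)).
  have h2 : `|2 * h 0 i| <= 2 * d by rewrite normrM ger0_norm// ler_wpM2l.
  have -> : 16 * d ^+ 3 = (2 * d) ^+ 3 * 2 by ring.
  rewrite ler_pM ?exprn_ge0 ?expR_ge0//; first by rewrite lerXn2r ?nnegrE ?mulr_ge0.
  by apply: le_trans E2; rewrite ler_expR; lra.
have ew : `|w| <= d by exact: avg.
have ew2 : `|w2| <= d ^+ 2 by apply: avg => i; rewrite normrX lerXn2r ?nnegrE.
clearbody v w w2.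
have /andP[w_1 w_2] : - d <= w <= d by rewrite -ler_norml.
have /andP[w2_1 w2_2] : - d ^+ 2 <= w2 <= d ^+ 2 by rewrite -ler_norml.
have /andP[v_1 v_2] : - (16 * d ^+ 3) <= v - 2 * w - 2 * w2 <= 16 * d ^+ 3 by rewrite -ler_norml.
(* This bound yields the constant [27 = 3 ^ 3] for the remainder; the errors in [al] and [be] have
   the smaller constants 16 and 10. *)
have v3 : `|v| <= 3 * d by rewrite ler_norml; apply/andP; split; lra.
have vw : `|v ^+ 2 - (2 * w) ^+ 2| <= 20 * d ^+ 3.
  rewrite subr_sqr normrM; have -> : 20 * d ^+ 3 = 4 * d ^+ 2 * (5 * d) by ring.
  by rewrite ler_pM//; rewrite ler_norml; apply/andP; split; lra.
have v12 : `|v| <= 1 / 2 by lra.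
have -> : F (sqnorm y * (1 + v)) - F (sqnorm y) - (al * (2 * w + 2 * w2) + 2 * (be * w ^+ 2)) =
  (F (sqnorm y * (1 + v)) - F (sqnorm y) - al * v - be * v ^+ 2 / 2) +
  (al * (v - 2 * w - 2 * w2) + be * ((v ^+ 2 - (2 * w) ^+ 2) / 2)) by field.
apply: (le_trans (ler_normD _ _)).
have t1 : `|F (sqnorm y * (1 + v)) - F (sqnorm y) - al * v - be * v ^+ 2 / 2| <= 27 * d ^+ 3 * G.
  apply: (le_trans (T v v12)); rewrite mulrC ler_wpM2r//.
  have -> : 27 * d ^+ 3 = (3 * d) ^+ 3 by ring.
  by rewrite lerXn2r ?nnegrE ?mulr_ge0.
have t2 : `|al * (v - 2 * w - 2 * w2)| <= 16 * d ^+ 3 * `|al|.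
  by rewrite normrM mulrC ler_wpM2r.
have t3 : `|be * ((v ^+ 2 - (2 * w) ^+ 2) / 2)| <= 10 * d ^+ 3 * `|be|.
  rewrite normrM mulrC ler_wpM2r// normrM [`|2^-1|]ger0_norm//; lra.
have := ler_normD (al * (v - 2 * w - 2 * w2)) (be * ((v ^+ 2 - (2 * w) ^+ 2) / 2)).
have u1 : 0 <= d ^+ 3 * `|al| by rewrite mulr_ge0.
have u2 : 0 <= d ^+ 3 * `|be| by rewrite mulr_ge0.
move=> t4; apply: (le_trans (lerD t1 (le_trans t4 (lerD t2 t3)))); lra.
Qed.

(** The expansion of [al v + be v ^ 2 / 2] to second order in [h], summed over the lattice:
    [2 h + 2 h ^ 2] comes from [exp (2 h) - 1], and [v ^ 2 / 2] contributes [2 (sum_i h_i p_i) ^ 2].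
    The arguments [a] and [b] receive the first and second moments of the weights [p_i]. *)
Definition quad_dev n (a : 'I_n -> R) (b : 'I_n -> 'I_n -> R) (h : 'rV[R]_n) : R :=
  \sum_i (2 * h 0 i + 2 * h 0 i ^+ 2) * a i + 2 * \sum_i \sum_j h 0 i * h 0 j * b i j.

Definition lin_moment n (C : 'M[R]_n) (al : R -> R) (i : 'I_n) : R :=
  rsum (@nzidx n) (fun z => al (sqnorm (lvec C z)) * (lvec C z 0 i ^+ 2 / sqnorm (lvec C z))).

Definition quad_moment n (C : 'M[R]_n) (be : R -> R) (i j : 'I_n) : R :=
  rsum (@nzidx n) (fun z => be (sqnorm (lvec C z)) *
    ((lvec C z 0 i ^+ 2 / sqnorm (lvec C z)) * (lvec C z 0 j ^+ 2 / sqnorm (lvec C z)))).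

Lemma coord_ratio n (C : 'M[R]_n) z i : C \in unitmx -> nzidx z ->
  0 <= lvec C z 0 i ^+ 2 / sqnorm (lvec C z) <= 1.
Proof.
move=> uC z0; rewrite divr_ge0 ?sqr_ge0 ?sqnorm_ge0//= ler_pdivrMr ?sqnorm_lvec_gt0//.
by rewrite mul1r coord_le_sqnorm.
Qed.

Lemma summ_lin_moment n (C : 'M[R]_n) (al : R -> R) i : C \in unitmx ->
  summ (@nzidx n) (fun z => al (sqnorm (lvec C z))) ->
  summ (@nzidx n) (fun z => al (sqnorm (lvec C z)) * (lvec C z 0 i ^+ 2 / sqnorm (lvec C z))).
Proof.
move=> uC sa; apply: summ_le (summ_norm sa) => z z0; have /andP[p0 p1] := coord_ratio i uC z0.
by rewrite normrM ler_piMr// ger0_norm.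
Qed.

Lemma summ_quad_moment n (C : 'M[R]_n) (be : R -> R) i j : C \in unitmx ->
  summ (@nzidx n) (fun z => be (sqnorm (lvec C z))) ->
  summ (@nzidx n) (fun z => be (sqnorm (lvec C z)) *
    ((lvec C z 0 i ^+ 2 / sqnorm (lvec C z)) * (lvec C z 0 j ^+ 2 / sqnorm (lvec C z)))).
Proof.
move=> uC sb; apply: summ_le (summ_norm sb) => z z0.
have /andP[p0 p1] := coord_ratio i uC z0; have /andP[q0 q1] := coord_ratio j uC z0.
by rewrite normrM ler_piMr// ger0_norm; [exact: mulr_ile1|exact: mulr_ge0].
Qed.

Lemma deformation_expansion n (C : 'M[R]_n) (F al be G : R -> R) (h : 'rV[R]_n) (d : R) :
  C \in unitmx -> 0 <= d <= 1 / 8 -> (forall i, `|h 0 i| <= d) ->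
  (forall r, 0 <= G r) ->
  (forall r v : R, 0 < r -> `|v| <= 1 / 2 ->
    `|F (r * (1 + v)) - F r - al r * v - be r * v ^+ 2 / 2| <= G r * `|v| ^+ 3) ->
  let r z := sqnorm (lvec C z) in
  let Fh z := F (sqnorm (lvec (C *m exp_diag h) z)) in
  summ (@nzidx n) (fun z => F (r z)) -> summ (@nzidx n) (fun z => al (r z)) ->
  summ (@nzidx n) (fun z => be (r z)) -> summ (@nzidx n) (fun z => G (r z)) ->
  summ (@nzidx n) Fh /\
  `|rsum (@nzidx n) Fh - rsum (@nzidx n) (fun z => F (r z))
     - quad_dev (lin_moment C al) (quad_moment C be) h| <=
  27 * d ^+ 3 * rsum (@nzidx n) (fun z => `|al (r z)| + `|be (r z)| + G (r z)).
Proof.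
move=> uC d8 hd G0 T r Fh sF sa sb sG.
pose Q z := \sum_i (2 * h 0 i + 2 * h 0 i ^+ 2) * (al (r z) * (lvec C z 0 i ^+ 2 / r z))
  + 2 * \sum_i \sum_j h 0 i * h 0 j * (be (r z) * ((lvec C z 0 i ^+ 2 / r z) * (lvec C z 0 j ^+ 2 / r z))).
have sQ1 : summ (@nzidx n) (fun z => \sum_i (2 * h 0 i + 2 * h 0 i ^+ 2) * (al (r z) * (lvec C z 0 i ^+ 2 / r z))).
  by apply: summ_sum => i _; apply: summZ; exact: summ_lin_moment.
have sQ2 i : summ (@nzidx n) (fun z => \sum_j h 0 i * h 0 j * (be (r z) * ((lvec C z 0 i ^+ 2 / r z) * (lvec C z 0 j ^+ 2 / r z)))).
  by apply: summ_sum => j _; apply: summZ; exact: summ_quad_moment.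
have sQ3 : summ (@nzidx n) (fun z => \sum_i \sum_j h 0 i * h 0 j * (be (r z) * ((lvec C z 0 i ^+ 2 / r z) * (lvec C z 0 j ^+ 2 / r z)))).
  by apply: summ_sum => i _; exact: sQ2.
have sQ : summ (@nzidx n) Q by apply: summD => //; exact: summZ.
have QE : rsum (@nzidx n) Q = quad_dev (lin_moment C al) (quad_moment C be) h.
  rewrite /Q rsumD//; last exact: summZ.
  rewrite rsumZ// /quad_dev; congr (_ + _ * _).
    rewrite rsum_sum; last by move=> i _; apply: summZ; exact: summ_lin_moment.
    by apply: eq_bigr => i _; rewrite rsumZ//; exact: summ_lin_moment.
  rewrite rsum_sum//; apply: eq_bigr => i _.
  rewrite rsum_sum; last by move=> j _; apply: summZ; exact: summ_quad_moment.
  by apply: eq_bigr => j _; rewrite rsumZ//; exact: summ_quad_moment.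
have sE : summ (@nzidx n) (fun z => `|al (r z)| + `|be (r z)| + G (r z)).
  by apply: summD => //; apply: summD; exact: summ_norm.
have sE27 := summZ (27 * d ^+ 3) sE.
have main z : nzidx z -> `|Fh z - F (r z) - Q z| <= 27 * d ^+ 3 * (`|al (r z)| + `|be (r z)| + G (r z)).
  move=> z0; rewrite /Fh lvec_diag; apply: (deformed_taylor (y := lvec C z)) => //.
    exact: sqnorm_lvec_gt0.
  by move=> v v12; apply: T => //; exact: sqnorm_lvec_gt0.
have sD : summ (@nzidx n) (fun z => Fh z - F (r z) - Q z) by apply: summ_le sE27.
have sFh : summ (@nzidx n) Fh.
  by have := summD (summD sD sQ) sF; apply: summ_eq => z _; ring.
split=> //; rewrite -QE -!rsumB//; last exact: summB.
by rewrite -rsumZ//; apply: rsum_norm_le.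
Qed.

End Deformation.

(** * Strict local minima *)

Section LocalMinima.
Variable R : realType.
Implicit Types n : nat.

(** The first moments are equal, so the linear term is a multiple of the sum of the [h_i], which is
    0. The second moments are a constant plus a multiple of the identity; the constant part pairs
    with the square of that sum, and only [|h| ^ 2] remains. *)
Lemma quad_dev_design n (B P : 'M[R]_n) (al be : R -> R) (h : 'rV[R]_n) :
  (0 < n)%N -> B \in unitmx -> all_layers_design 4 B -> P *m P^T = 1%:M ->
  let C := B *m P^T in let r z := sqnorm (lvec C z) in
  summ (@nzidx n) (fun z => al (r z)) -> summ (@nzidx n) (fun z => be (r z)) ->
  \sum_i h 0 i = 0 ->
  quad_dev (lin_moment C al) (quad_moment C be) h =
  sqnorm h * (2 / n%:R * rsum (@nzidx n) (fun z => al (r z)) +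
              4 / (n%:R * (n%:R + 2)) * rsum (@nzidx n) (fun z => be (r z))).
Proof.
move=> n0 uB des PP C r sa sb h0.
have [H2 _] := lattice_moments n0 uB des PP sa.
have [_ H4] := lattice_moments n0 uB des PP sb.
rewrite /quad_dev; set A := rsum _ _ in H2 *; set D := rsum _ _ in H4 *.
have lE i : lin_moment C al i = n%:R^-1 * A by exact: H2.
have qE i j : quad_moment C be i j = (1 + 2 * (i == j)%:R) / (n%:R * (n%:R + 2)) * D by exact: H4.
clearbody A D.
have nn : n%:R != 0 :> R by rewrite pnatr_eq0 -lt0n.
have n2 : n%:R + 2 != 0 :> R by rewrite gt_eqF// ltr_wpDl.
have -> : \sum_i (2 * h 0 i + 2 * h 0 i ^+ 2) * lin_moment C al i = 2 / n%:R * A * sqnorm h.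
  transitivity (2 / n%:R * A * (\sum_i h 0 i) + 2 / n%:R * A * sqnorm h); last by rewrite h0 mulr0 add0r.
  rewrite /sqnorm !mulr_sumr -big_split/=; apply: eq_bigr => i _; rewrite lE; by field.
have -> : \sum_i \sum_j h 0 i * h 0 j * quad_moment C be i j = 2 / (n%:R * (n%:R + 2)) * D * sqnorm h.
  transitivity ((n%:R * (n%:R + 2))^-1 * D * ((\sum_i h 0 i) * (\sum_i h 0 i)) +
     2 / (n%:R * (n%:R + 2)) * D * sqnorm h); last by rewrite h0 !mulr0 add0r.
  rewrite mulr_suml !mulr_sumr -big_split/=; apply: eq_bigr => i _.
  rewrite (mulr_sumr _ _ _ (h 0 i)) mulr_sumr.
  rewrite [LHS](bigD1 i)//= [X in _ = X + _](bigD1 i)//= qE eqxx (_ : true%:R = 1 :> R)//.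
  rewrite [RHS]addrAC; congr (_ + _); first by field; rewrite ?nn ?n2.
  by apply: eq_bigr => j ji; rewrite qE eq_sym (negbTE ji) mulr0 addr0; field; rewrite ?nn ?n2.
by field; rewrite ?nn ?n2.
Qed.

(** For a dilation only [sum_i p_i = 1] enters. It serves in [theta_scaling] to read off radial
    moments of the dual theta series. *)
Lemma quad_dev_scalar n (C : 'M[R]_n) (al be : R -> R) (u : R) : C \in unitmx ->
  let r z := sqnorm (lvec C z) in
  summ (@nzidx n) (fun z => al (r z)) -> summ (@nzidx n) (fun z => be (r z)) ->
  quad_dev (lin_moment C al) (quad_moment C be) (const_mx u) =
  (2 * u + 2 * u ^+ 2) * rsum (@nzidx n) (fun z => al (r z)) +
  2 * u ^+ 2 * rsum (@nzidx n) (fun z => be (r z)).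
Proof.
move=> uC r sa sb.
have p1 z : nzidx z -> \sum_i (lvec C z 0 i ^+ 2 / sqnorm (lvec C z)) = 1.
  by move=> z0; rewrite -mulr_suml divff// gt_eqF// sqnorm_lvec_gt0.
have lE : \sum_i lin_moment C al i = rsum (@nzidx n) (fun z => al (r z)).
  rewrite /lin_moment -rsum_sum; last by move=> i _; exact: summ_lin_moment.
  by apply: eq_rsum => z z0; rewrite -mulr_sumr p1// mulr1.
have qE : \sum_i \sum_j quad_moment C be i j = rsum (@nzidx n) (fun z => be (r z)).
  have s2 i : summ (@nzidx n) (fun z => \sum_j be (sqnorm (lvec C z)) *
    ((lvec C z 0 i ^+ 2 / sqnorm (lvec C z)) * (lvec C z 0 j ^+ 2 / sqnorm (lvec C z)))).
    by apply: summ_sum => j _; exact: summ_quad_moment.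
  transitivity (\sum_i rsum (@nzidx n) (fun z => \sum_j be (sqnorm (lvec C z)) *
    ((lvec C z 0 i ^+ 2 / sqnorm (lvec C z)) * (lvec C z 0 j ^+ 2 / sqnorm (lvec C z))))).
    by apply: eq_bigr => i _; rewrite rsum_sum// => j _; exact: summ_quad_moment.
  rewrite -rsum_sum//; apply: eq_rsum => z z0.
  under eq_bigr do rewrite -mulr_sumr -mulr_sumr p1// mulr1.
  by rewrite -mulr_sumr p1// mulr1.
rewrite /quad_dev -lE -qE !mulr_sumr; congr (_ + _).
  by apply: eq_bigr => i _; rewrite mxE.
apply: eq_bigr => i _; rewrite !mulr_sumr; apply: eq_bigr => j _.
by rewrite !mxE; ring.
Qed.

Lemma orth_det n (P : 'M[R]_n) : P *m P^T = 1%:M -> `|\det P^T| = 1.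
Proof.
move=> PP; have : `|\det P^T| ^+ 2 = 1 ^+ 2.
  by rewrite -normrX expr2 -{1}det_tr trmxK -det_mulmx PP det1 normr1 expr1n.
by move/eqP; rewrite eqrXn2// => /eqP.
Qed.

Lemma covol_orth n (B P : 'M[R]_n) : covol B = 1 -> P *m P^T = 1%:M -> covol (B *m P^T) = 1.
Proof. by move=> cB PP; rewrite /covol det_mulmx normrM orth_det// mulr1. Qed.

Lemma covol_exp_diag n (C : 'M[R]_n) (h : 'rV[R]_n) : covol C = 1 -> \sum_i h 0 i = 0 ->
  covol (C *m exp_diag h) = 1.
Proof. by move=> cC h0; rewrite /covol det_mulmx det_exp_diag h0 expR0 mulr1. Qed.

Lemma gram_orth n (B P : 'M[R]_n) : P *m P^T = 1%:M -> (B *m P^T) *m (B *m P^T)^T = B *m B^T.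
Proof.
move=> PP; rewrite trmx_mul trmxK mulmxA -[B *m P^T *m P]mulmxA.
by rewrite (mulmx1C PP) mulmx1.
Qed.

(** Applied with [d = |h|]: the gain [c d ^ 2] exceeds the loss [K d ^ 3] as soon as
    [d < c / (K + 1)], and [h = 0] would make the lattices isometric. *)
Lemma strict_min_of_expansion n (B0 : 'M[R]_n) (F : 'M[R]_n -> R) (c K : R) :
  covol B0 = 1 -> 0 < c -> 0 <= K ->
  (forall B C : 'M[R]_n, covol B = 1 -> covol C = 1 -> B *m B^T = C *m C^T -> F B = F C) ->
  (forall (P : 'M[R]_n) (h : 'rV[R]_n) d, P *m P^T = 1%:M -> \sum_i h 0 i = 0 ->
     0 <= d <= 1 / 8 -> (forall i, `|h 0 i| <= d) ->
     F (B0 *m P^T) + (c * sqnorm h - K * d ^+ 3) <= F (B0 *m P^T *m exp_diag h)) ->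
  strict_local_min F B0.
Proof.
move=> c0 cp K0 FG Fexp.
pose d1 := Num.min (1 / 8) (c / (K + 1)).
have d10 : 0 < d1 by rewrite lt_min !divr_gt0//; lra.
have n1 : 0 < n%:R + 1 :> R by rewrite ltr_wpDl.
(* Coordinates below [del] give [|h| ^ 2 <= n del ^ 2 < d1 ^ 2]. *)
pose del := d1 / (n%:R + 1).
have del0 : 0 < del by rewrite divr_gt0.
have [e e0 He] := frame_near c0 del0.
exists e => // B cB Bnear niso.
have [P [h [PP h0 hd BE]]] := He B cB Bnear.
have hn0 : h != 0.
  by apply/eqP => hz; apply: niso; move: BE; rewrite hz; exact: frame0_isometric.
have cC := covol_orth c0 PP.
have -> : F B = F (B0 *m P^T *m exp_diag h) by apply: FG => //; exact: covol_exp_diag.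
have -> : F B0 = F (B0 *m P^T) by apply: FG => //; rewrite gram_orth.
pose d := Num.sqrt (sqnorm h).
have s0 : 0 < sqnorm h by rewrite lt_neqAle eq_sym sqnorm_eq0 hn0 sqnorm_ge0.
have d0 : 0 < d by rewrite sqrtr_gt0.
have d2 : d ^+ 2 = sqnorm h by rewrite sqr_sqrtr// ltW.
have dd1 : d < d1.
  rewrite -(@ltr_pXn2r _ 2)// ?nnegrE ?ltW// d2.
  apply: (@le_lt_trans _ _ (n%:R * del ^+ 2)).
    have -> : n%:R * del ^+ 2 = \sum_(i < n) del ^+ 2 by rewrite sumr_const card_ord mulr_natl.
    apply: ler_sum => i _; rewrite -[leLHS]real_normK ?num_real//.
    by rewrite lerXn2r ?nnegrE ?(ltW del0)// ltW.
  have -> : d1 ^+ 2 = (n%:R + 1) ^+ 2 * del ^+ 2 by rewrite /del; field; rewrite gt_eqF.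
  rewrite ltr_pM2r ?exprn_gt0//; have : 0 <= n%:R :> R by [].
  by move: (n%:R : R) => x x0; have := sqr_ge0 x; lra.
have dK : d < c / (K + 1) by apply: lt_le_trans dd1 _; rewrite ge_min lexx orbT.
have d8 : d < 1 / 8 by apply: lt_le_trans dd1 _; rewrite ge_min lexx.
have := Fexp P h d PP h0 _ _; have -> : 0 <= d <= 1 / 8 by rewrite !ltW.
move=> /(_ isT) H; apply: lt_le_trans (H _); last first.
  move=> i; rewrite -(@ler_pXn2r _ 2)// ?nnegrE ?(ltW d0)// d2 real_normK ?num_real//.
  exact: coord_le_sqnorm.
rewrite ltrDl subr_gt0 -d2.
have K1 : 0 < K + 1 by lra.
move: dK; rewrite ltr_pdivlMr// => dK.
have -> : K * d ^+ 3 = (K * d) * d ^+ 2 by ring.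
by rewrite ltr_pM2r ?exprn_gt0//; lra.
Qed.

Lemma strict_min_dim0 (B0 : 'M[R]_0) (F : 'M[R]_0 -> R) : strict_local_min F B0.
Proof.
exists 1 => // B _ _ []; exists 1%:M; split; first by rewrite trmx1 mulmx1.
by congr lattice; apply/matrixP => -[].
Qed.

Lemma nzidx_ex n : (0 < n)%N -> exists z : 'rV[int]_n, nzidx z.
Proof.
case: n => // n _; exists (const_mx 1); apply/eqP => /rowP/(_ ord0).
by rewrite !mxE.
Qed.

Lemma rsum_gt0 (T : choiceType) (D : set T) (f : T -> R) z : summ D f ->
  (forall i, D i -> 0 < f i) -> D z -> 0 < rsum D f.
Proof.
move=> sf f0 Dz; rewrite (rsumID [set z])//.
apply: ltr_pwDl; last first.
  apply: rsum_ge0; last by apply: summ_subset sf => i [].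
  by move=> i [/f0/ltW].
have -> : D `&` [set z] = [set z] by apply/seteqP; split => y /=; [case|move=> ->].
by rewrite rsum_fset ?fsbig_set1 ?f0//; exact: finite_set1.
Qed.

Definition radial_summ n (C : 'M[R]_n) (F : R -> R) : Prop :=
  summ (@nzidx n) (fun z => F (sqnorm (lvec C z))).

Definition radial_sum n (C : 'M[R]_n) (F : R -> R) : R :=
  rsum (@nzidx n) (fun z => F (sqnorm (lvec C z))).

Lemma radial_summ_gram n (B C : 'M[R]_n) F : B *m B^T = C *m C^T -> radial_summ B F -> radial_summ C F.
Proof. by move=> G; apply: summ_eq => z _; rewrite (gram_sqnorm z G). Qed.

Lemma radial_sum_gram n (B C : 'M[R]_n) F : B *m B^T = C *m C^T -> radial_sum B F = radial_sum C F.
Proof. by move=> G; apply: eq_rsum => z _; rewrite (gram_sqnorm z G). Qed.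

Lemma radial_sumZ n (B : 'M[R]_n) c F : radial_summ B F ->
  radial_sum B (fun r => c * F r) = c * radial_sum B F.
Proof. exact: rsumZ. Qed.

Lemma radial_sum_gt0 n (B : 'M[R]_n) F : (0 < n)%N -> B \in unitmx -> radial_summ B F ->
  (forall r, 0 < r -> 0 < F r) -> 0 < radial_sum B F.
Proof.
move=> n0 uB sF F0; have [z z0] := nzidx_ex n0; apply: (rsum_gt0 (z := z)) => // i i0.
by apply: F0; exact: sqnorm_lvec_gt0.
Qed.

Lemma eq_radial_sum n (B : 'M[R]_n) F F' : B \in unitmx -> (forall r, 0 < r -> F r = F' r) ->
  radial_sum B F = radial_sum B F'.
Proof. by move=> uB FF; apply: eq_rsum => z z0; apply: FF; exact: sqnorm_lvec_gt0. Qed.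

Lemma design_expansion n (B P : 'M[R]_n) (F al be G : R -> R) (h : 'rV[R]_n) (d W A D E : R) :
  (0 < n)%N -> B \in unitmx -> all_layers_design 4 B -> P *m P^T = 1%:M ->
  \sum_i h 0 i = 0 -> 0 <= d <= 1 / 8 -> (forall i, `|h 0 i| <= d) ->
  (forall r, 0 <= G r) ->
  (forall r v : R, 0 < r -> `|v| <= 1 / 2 ->
    `|F (r * (1 + v)) - F r - al r * v - be r * v ^+ 2 / 2| <= G r * `|v| ^+ 3) ->
  radial_summ B F -> radial_summ B al -> radial_summ B be -> radial_summ B G ->
  radial_sum B F = W -> radial_sum B al = A -> radial_sum B be = D ->
  radial_sum B (fun r => `|al r| + `|be r| + G r) = E ->
  `|radial_sum (B *m P^T *m exp_diag h) F - W -
     sqnorm h * (2 / n%:R * A + 4 / (n%:R * (n%:R + 2)) * D)| <= 27 * d ^+ 3 * E.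
Proof.
move=> n0 uB des PP h0 d8 hd G0 T sF sa sb sG <- <- <- <-.
have gB := esym (gram_orth B PP).
have uC : B *m P^T \in unitmx by rewrite unitmx_mul uB unitmx_tr; case: (mulmx1_unit PP).
have [] := deformation_expansion uC d8 hd G0 T (radial_summ_gram gB sF) (radial_summ_gram gB sa)
  (radial_summ_gram gB sb) (radial_summ_gram gB sG).
move=> _; rewrite (quad_dev_design n0 uB des PP (radial_summ_gram gB sa) (radial_summ_gram gB sb) h0).
by rewrite !(radial_sum_gram _ gB).
Qed.

Opaque radial_sum.

Lemma epstein_gt n (B : 'M[R]_n) s : B \in unitmx -> n%:R / 2 < s ->
  epstein B s = radial_sum B (fun r => r `^ (- s)).
Proof.
move=> uB ns; rewrite /epstein ns; apply/esym/rsum_psum; last exact: summ_lvec_pow.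
by move=> z _; exact: powR_ge0.
Qed.

Lemma powR_radial_taylor (s : R) : 0 <= s -> exists2 K : R, 0 <= K &
  forall r v : R, 0 < r -> `|v| <= 1 / 2 -> `|(r * (1 + v)) `^ (- s) - r `^ (- s)
    - (- s * r `^ (- s)) * v - (s * (s + 1) * r `^ (- s)) * v ^+ 2 / 2| <= K * r `^ (- s) * `|v| ^+ 3.
Proof.
move=> s0; have [K K0 hK] := powR_taylor s0; exists K => // r v r0 v12.
have v1 : 0 < 1 + v by move: v12; rewrite ler_norml => /andP[]; lra.
rewrite (powRM _ (ltW r0) (ltW v1)).
have -> : r `^ (- s) * (1 + v) `^ (- s) - r `^ (- s) - - s * r `^ (- s) * v -
  s * (s + 1) * r `^ (- s) * v ^+ 2 / 2 =
  r `^ (- s) * ((1 + v) `^ (- s) - 1 + s * v - s * (s + 1) / 2 * v ^+ 2) by field.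
rewrite normrM (ger0_norm (powR_ge0 _ _)) (_ : K * _ * _ = r `^ (- s) * (K * `|v| ^+ 3)); last by ring.
by rewrite ler_wpM2l ?powR_ge0// hK.
Qed.

Lemma zeta_extreme_gt n (B : 'M[R]_n) s : covol B = 1 -> all_layers_design 4 B ->
  n%:R / 2 < s -> zeta_extreme B s.
Proof.
move=> cB des ns; case: (posnP n) => [n0|n0].
  by move: n0 B cB des ns => -> B _ _ _; exact: strict_min_dim0.
have uB := covol1_unit cB.
have nR : 0 < n%:R :> R by rewrite ltr0n.
have s0 : 0 < s by apply: lt_trans ns; rewrite divr_gt0.
have s1 : 0 < s + 1 by rewrite addr_gt0.
have q : 0 < s - n%:R / 2 by rewrite subr_gt0.
have n2 : 0 < n%:R * (n%:R + 2) :> R by rewrite mulr_gt0// addr_gt0.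
have [K K0 hK] := powR_radial_taylor (ltW s0).
pose pw (r : R) := r `^ (- s).
have pw0 r : 0 <= pw r := powR_ge0 _ _.
have sZ : radial_summ B pw by exact: summ_lvec_pow.
have sZc c : radial_summ B (fun r => c * pw r) by exact: summZ sZ.
have Z0 : 0 < radial_sum B pw.
  by apply: radial_sum_gt0 => // r r0; rewrite powR_gt0.
(* With first and second coefficients [- s] and [s (s + 1)], the factor is [- 2 s / n + 4 s (s + 1)
   / (n (n + 2)) = 4 s (s - n / 2) / (n (n + 2))], positive exactly because [s > n / 2]. *)
pose c := 4 * s * (s - n%:R / 2) / (n%:R * (n%:R + 2)) * radial_sum B pw.
have c0 : 0 < c by exact: mulr_gt0 (divr_gt0 (mulr_gt0 (mulr_gt0 _ s0) q) n2) Z0.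
pose L := s + s * (s + 1) + K.
have L0 : 0 <= L by apply: addr_ge0 K0; apply: addr_ge0 (ltW s0) (ltW (mulr_gt0 s0 s1)).
have LZ : 0 <= 27 * (L * radial_sum B pw) by apply: mulr_ge0 => //; exact: mulr_ge0 L0 (ltW Z0).
apply: (strict_min_of_expansion cB c0 LZ).
  move=> B1 B2 c1 c2 G.
  by rewrite (epstein_gt (covol1_unit c1) ns) (epstein_gt (covol1_unit c2) ns) (radial_sum_gram _ G).
move=> P h d PP h0 d8 hd.
have cC := covol_orth cB PP.
rewrite (epstein_gt (covol1_unit cC) ns) (epstein_gt (covol1_unit (covol_exp_diag cC h0)) ns).
rewrite (radial_sum_gram _ (gram_orth B PP)).
have EE : radial_sum B (fun r => `|- s * pw r| + `|s * (s + 1) * pw r| + K * pw r) = L * radial_sum B pw.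
  rewrite -radial_sumZ//; apply: eq_radial_sum => // r _.
  rewrite !normrM normrN (ger0_norm (pw0 r)) (gtr0_norm s0) (gtr0_norm s1) /L; ring.
have := design_expansion n0 uB des PP h0 d8 hd (fun r => mulr_ge0 K0 (pw0 r)) hK sZ (sZc _) (sZc _) (sZc _)
  erefl (radial_sumZ _ sZ) (radial_sumZ _ sZ) EE.
have -> : 2 / n%:R * (- s * radial_sum B pw) + 4 / (n%:R * (n%:R + 2)) * (s * (s + 1) * radial_sum B pw) = c.
  by rewrite /c; field; rewrite !gt_eqF// addr_gt0.
rewrite ler_norml -/pw => /andP[H _].
have -> : 27 * (L * radial_sum B pw) * d ^+ 3 = 27 * d ^+ 3 * (L * radial_sum B pw) by ring.
move: H; move: (radial_sum _ _) (radial_sum _ _) (27 * d ^+ 3 * _) => W1 W2 E; rewrite (mulrC c); lra.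
Qed.

End LocalMinima.

(** * Theta series near a lattice with design layers *)

Section CubicErrors.
Variable R : realType.

Definition O3 (e : R) (f : R -> R) := exists K : R, forall u, 0 <= u <= e -> `|f u| <= K * u ^+ 3.

Lemma eq_O3 e (f g : R -> R) : (forall u, 0 <= u <= e -> f u = g u) -> O3 e f -> O3 e g.
Proof. by move=> fg [K hK]; exists K => u ue; rewrite -fg// hK. Qed.

Lemma O3D e (f g : R -> R) : O3 e f -> O3 e g -> O3 e (fun u => f u + g u).
Proof.
move=> [K hK] [K' hK']; exists (K + K') => u ue; rewrite mulrDl.
by apply: (le_trans (ler_normD _ _)); rewrite lerD ?hK ?hK'.
Qed.

Lemma O3M e (f g : R -> R) (M : R) : (forall u, 0 <= u <= e -> `|f u| <= M) -> O3 e g ->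
  O3 e (fun u => f u * g u).
Proof.
move=> fM [K hK]; exists (M * K) => u ue; rewrite normrM -mulrA ler_pM ?fM ?hK//.
Qed.

Lemma O3Z e (c : R) (g : R -> R) : O3 e g -> O3 e (fun u => c * g u).
Proof. by apply: (@O3M e (fun=> c) g `|c|). Qed.

Lemma O3B e (f g : R -> R) : O3 e f -> O3 e g -> O3 e (fun u => f u - g u).
Proof.
move=> Hf Hg; apply: eq_O3 (O3D Hf (O3Z (-1) Hg)) => u _; ring.
Qed.

Lemma O3_cube e : O3 e (fun u => u ^+ 3).
Proof. by exists 1 => u /andP[u0 _]; rewrite mul1r ger0_norm// exprn_ge0. Qed.

Lemma small_eq0 (a c e : R) : 0 < e -> (forall u, 0 < u <= e -> `|a| <= c * u) -> a = 0.
Proof.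
move=> e0 H; apply/eqP; rewrite -normr_eq0; apply/eqP/le_anti/andP; split => //.
apply/ler_addgt0Pl => eps eps0; rewrite addr0.
have c1 : 0 < `|c| + 1 by have := normr_ge0 c; lra.
pose u := Num.min e (eps / (`|c| + 1)).
have u0 : 0 < u by rewrite lt_min e0 divr_gt0.
have ue : u <= e by rewrite ge_min lexx.
have uc : u * (`|c| + 1) <= eps by rewrite -ler_pdivlMr// ge_min lexx orbT.
apply: (le_trans (H u _)); first by rewrite u0.
apply: le_trans uc; rewrite mulrC ler_wpM2l ?(ltW u0)//.
by apply: (le_trans (ler_norm c)); rewrite lerDl.
Qed.

(** Uniqueness of second-order coefficients: dividing by [u] and letting [u] tend to 0 kills [L],
    and a second division kills [Q]. *)
Lemma O3_poly (e L Q : R) : 0 < e -> O3 e (fun u => u * L + u ^+ 2 * Q) -> L = 0 /\ Q = 0.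
Proof.
move=> e0 [K hK].
have bnd u : 0 < u <= e -> `|L + u * Q| <= `|K| * u ^+ 2.
  move=> /andP[u0 ue]; have := hK u; rewrite ue ltW// => /(_ isT).
  have -> : u * L + u ^+ 2 * Q = u * (L + u * Q) by ring.
  rewrite normrM (gtr0_norm u0) exprS mulrCA ler_pM2l// => /le_trans; apply.
  by rewrite ler_wpM2r ?sqr_ge0// ler_norm.
have L0 : L = 0.
  apply: (@small_eq0 _ (`|K| * e + `|Q|) e e0) => u ue; have /andP[u0 ue'] := ue.
  have -> : L = (L + u * Q) - u * Q by ring.
  apply: (le_trans (ler_normB _ _)); rewrite mulrDl lerD//; last by rewrite normrM (gtr0_norm u0) mulrC.
  apply: (le_trans (bnd u ue)); rewrite expr2 mulrA ler_wpM2r ?(ltW u0)//.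
  by rewrite ler_wpM2l.
split=> //; apply: (@small_eq0 _ `|K| e e0) => u ue; have /andP[u0 ue'] := ue.
have := bnd u ue; rewrite L0 add0r normrM (gtr0_norm u0) expr2 mulrCA ler_pM2l//.
Qed.

End CubicErrors.

(** * Theta series of deformed lattices and of their duals *)

Section ThetaExpansion.
Variable R : realType.
Implicit Types n k : nat.

(* Up to sign and factorials, the Taylor coefficients at v = 0 of v |-> e^{-pi t r (1 + v)}. *)
Definition gm k (t r : R) : R := (pi * t * r) ^+ k * expR (- (pi * t * r)).

Definition ex (c r : R) : R := expR (- (c * r)).

Lemma ex_ge0 c r : 0 <= ex c r. Proof. exact: expR_ge0. Qed.

Lemma radial_summ_ex n (B : 'M[R]_n) c : B \in unitmx -> 0 < c -> radial_summ B (ex c).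
Proof.
move=> uB c0; have p0 := @pi_gt0 R.
have [s _ _] := theta_functional uB (divr_gt0 c0 p0).
apply: summ_subset (@subsetT _ _) _; apply: summ_eq s => z _.
by rewrite /ex mulrCA mulfV ?gt_eqF// mulr1.
Qed.

(** A constant for which [x ^ k <= gk k * exp (x / 4)] when [x >= 0], as in [xk_expR_le]. *)
Definition gk k : R := (4 * k%:R) ^+ k.

Lemma gk_ge0 k : 0 <= gk k.
Proof. by rewrite exprn_ge0// mulr_ge0. Qed.

Lemma gm_le k (t r : R) : 0 < t -> 0 < r ->
  0 <= gm k t r <= gk k * ex (pi * t / 4) r.
Proof.
move=> t0 r0; have x0 : 0 < pi * t * r by rewrite !mulr_gt0// pi_gt0.
rewrite /gm /ex /gk mulr_ge0 ?exprn_ge0 ?expR_ge0 ?(ltW x0)//=.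
have -> : pi * t / 4 * r = pi * t * r / 4 by ring.
move: (pi * t * r) x0 => x x0; case: k => [|k].
  by rewrite !expr0 !mul1r ler_expR; lra.
apply: (@le_trans _ _ ((4 * k.+1%:R) ^+ k.+1 * expR (x / 4) * expR (- x))).
  by rewrite ler_wpM2r ?expR_ge0// xk_expR_le// ltW.
rewrite -mulrA -expRD ler_wpM2l ?exprn_ge0 ?mulr_ge0// ler_expR; lra.
Qed.

Lemma radial_summ_le n (B : 'M[R]_n) (F G : R -> R) : B \in unitmx ->
  (forall r, 0 < r -> `|F r| <= G r) -> radial_summ B G -> radial_summ B F.
Proof. by move=> uB FG; apply: summ_le => z z0; apply: FG; exact: sqnorm_lvec_gt0. Qed.

Lemma radial_summZ n (B : 'M[R]_n) (F : R -> R) c : radial_summ B F -> radial_summ B (fun r => c * F r).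
Proof. exact: summZ. Qed.

Lemma radial_summN n (B : 'M[R]_n) (F : R -> R) : radial_summ B F -> radial_summ B (fun r => - F r).
Proof. exact: summN. Qed.

Transparent radial_sum.
Lemma radial_sumN n (B : 'M[R]_n) (F : R -> R) : radial_summ B F ->
  radial_sum B (fun r => - F r) = - radial_sum B F.
Proof. exact: rsumN. Qed.

Lemma radial_sumD n (B : 'M[R]_n) (F G : R -> R) : radial_summ B F -> radial_summ B G ->
  radial_sum B (fun r => F r + G r) = radial_sum B F + radial_sum B G.
Proof. exact: rsumD. Qed.

Lemma le_radial_sum n (B : 'M[R]_n) (F G : R -> R) : B \in unitmx ->
  radial_summ B F -> radial_summ B G -> (forall r, 0 < r -> F r <= G r) ->
  radial_sum B F <= radial_sum B G.
Proof. by move=> uB sF sG FG; apply: le_rsum => // z z0; apply: FG; exact: sqnorm_lvec_gt0. Qed.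

Lemma radial_sum_ge0 n (B : 'M[R]_n) (F : R -> R) : B \in unitmx ->
  radial_summ B F -> (forall r, 0 < r -> 0 <= F r) -> 0 <= radial_sum B F.
Proof. by move=> uB sF F0; apply: rsum_ge0 => // z z0; apply: F0; exact: sqnorm_lvec_gt0. Qed.

Lemma theta1E n (B : 'M[R]_n) t : B \in unitmx -> 0 < t -> theta1 B t = radial_sum B (gm 0 t).
Proof.
move=> uB t0; rewrite /radial_sum rsum_psum//.
- by rewrite /theta1 /psum; congr fine; apply: eq_esum => z _; rewrite /gm expr0 mul1r !mulNr.
- by move=> z _; rewrite /gm expr0 mul1r expR_ge0.
apply: summ_eq (radial_summ_ex uB (mulr_gt0 (@pi_gt0 R) t0)) => z _.
by rewrite /gm /ex expr0 mul1r.
Qed.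

(** The functional equation at [1 / t], with the term of the zero vector separated as the summand
    1. *)
Lemma theta_inversion n (B : 'M[R]_n) t : B \in unitmx -> 0 < t ->
  1 + radial_sum (dual B) (gm 0 t) =
  Num.sqrt (t^-1 ^+ n * \det B ^+ 2) * (1 + radial_sum B (gm 0 t^-1)).
Proof.
move=> uB t0; have ti0 : 0 < t^-1 by rewrite invr_gt0.
have [s1 s2 E] := theta_functional uB ti0.
have full (C : 'M[R]_n) c : summ setT (fun z => expR (- (c * sqnorm (lvec C z)))) ->
    rsum setT (fun z => expR (- (c * sqnorm (lvec C z)))) =
    1 + rsum (@nzidx n) (fun z => expR (- (c * sqnorm (lvec C z)))).
  move=> s; rewrite (rsumID [set 0] s).
  have -> : [set: 'rV[int]_n] `&` ~` [set 0] = @nzidx n.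
    by rewrite setTI; apply/seteqP; split => z /= /eqP.
  congr (_ + _); rewrite setTI rsum_fset; last exact: finite_set1.
  rewrite fsbig_set1 lvecE (_ : ir R 0 = 0); last by apply/rowP => i; rewrite !mxE.
  by rewrite mul0mx (_ : sqnorm 0 = 0) ?mulr0 ?oppr0 ?expR0//; apply/eqP; rewrite sqnorm_eq0.
have g0 (C : 'M[R]_n) c : radial_sum C (gm 0 c) = rsum (@nzidx n) (fun z => expR (- (pi * c * sqnorm (lvec C z)))).
  by apply: eq_rsum => z _; rewrite /gm expr0 mul1r.
move: s1 s2 E; rewrite invrK => s1 s2; rewrite (full _ _ s1) (full _ _ s2) -!g0 => ->.
rewrite mulrA mulfV ?mul1r// gt_eqF// sqrtr_gt0; apply: mulr_gt0; first exact: exprn_gt0.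
rewrite lt_neqAle sqr_ge0 andbT eq_sym sqrf_eq0.
by move: uB; rewrite unitmxE unitfE.
Qed.
Opaque radial_sum.

Lemma radial_summ_gm n (B : 'M[R]_n) k t : B \in unitmx -> 0 < t -> radial_summ B (gm k t).
Proof.
move=> uB t0; have c0 : 0 < pi * t / 4 by rewrite divr_gt0// mulr_gt0// pi_gt0.
apply: radial_summ_le uB _ (radial_summZ (gk k) (radial_summ_ex uB c0)) => r r0.
by have /andP[g0 gle] := gm_le k t0 r0; rewrite ger0_norm.
Qed.

(** The constant 27 of [deformed_taylor] times the bounds for the first coefficient, the second
    coefficient and the remainder. *)
Definition theta_err : R := 27 * (gk 1 + gk 2 + gk 3).

(** Of the decay [exp (- x)], half goes into the variation of [v] and a quarter into the power
    [x ^ 3]; what is left is [exp (- x / 4)]. *)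
Lemma gm_taylor (t r v : R) : 0 < t -> 0 < r -> `|v| <= 1 / 2 ->
  `|gm 0 t (r * (1 + v)) - gm 0 t r - (- gm 1 t r) * v - gm 2 t r * v ^+ 2 / 2|
    <= gk 3 * ex (pi * t / 4) r * `|v| ^+ 3.
Proof.
move=> t0 r0 v12; have x0 : 0 < pi * t * r by rewrite !mulr_gt0// pi_gt0.
rewrite /gm /ex !expr0 !mul1r expr1 [pi * t * (r * _)]mulrA.
have -> : pi * t / 4 * r = pi * t * r / 4 by ring.
move: (pi * t * r) x0 => x x0; rewrite -[- (x * expR (- x))]mulNr.
apply: (le_trans (expR_radial_taylor (ltW x0) v12)); rewrite ler_wpM2r ?exprn_ge0//.
apply: (@le_trans _ _ (gk 3 * expR (x / 4) * expR (- (x / 2)))).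
  by rewrite ler_wpM2r ?expR_ge0//; exact: (@xk_expR_le R 2 x (ltW x0)).
rewrite -mulrA -expRD; apply: (ler_wpM2l (gk_ge0 3)); rewrite ler_expR; lra.
Qed.

Lemma gm_err_le n (B : 'M[R]_n) t : B \in unitmx -> 0 < t ->
  27 * radial_sum B (fun r => `|- gm 1 t r| + `|gm 2 t r| + gk 3 * ex (pi * t / 4) r) <=
  theta_err * radial_sum B (ex (pi * t / 4)).
Proof.
move=> uB t0; have c0 : 0 < pi * t / 4 by rewrite divr_gt0// mulr_gt0// pi_gt0.
have se := radial_summ_ex uB c0.
rewrite /theta_err -(mulrA 27) ler_pM2l//; rewrite -radial_sumZ//.
have H r : 0 < r -> `|- gm 1 t r| + `|gm 2 t r| + gk 3 * ex (pi * t / 4) r <=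
    (gk 1 + gk 2 + gk 3) * ex (pi * t / 4) r.
  move=> r0; have /andP[g0 g1] := gm_le 1 t0 r0; have /andP[g20 g2] := gm_le 2 t0 r0.
  rewrite normrN !ger0_norm// (mulrDl (gk 1 + gk 2)) (mulrDl (gk 1)).
  exact: lerD (lerD g1 g2) (lexx _).
have sR := radial_summZ (gk 1 + gk 2 + gk 3) se.
apply: (le_radial_sum uB _ sR H); apply: radial_summ_le uB _ sR => r r0.
rewrite ger0_norm ?H//; apply: addr_ge0; first exact: addr_ge0.
exact: mulr_ge0 (gk_ge0 3) (ex_ge0 _ _).
Qed.

Lemma theta_deform n (C : 'M[R]_n) t (h : 'rV[R]_n) d : C \in unitmx -> 0 < t ->
  0 <= d <= 1 / 8 -> (forall i, `|h 0 i| <= d) ->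
  `|radial_sum (C *m exp_diag h) (gm 0 t) - radial_sum C (gm 0 t)
    - quad_dev (lin_moment C (fun r => - gm 1 t r)) (quad_moment C (gm 2 t)) h| <=
  d ^+ 3 * (theta_err * radial_sum C (ex (pi * t / 4))).
Proof.
move=> uC t0 d8 hd; have c0 : 0 < pi * t / 4 by rewrite divr_gt0// mulr_gt0// pi_gt0.
have se := radial_summ_ex uC c0.
have Gp r : 0 <= gk 3 * ex (pi * t / 4) r by exact: mulr_ge0 (gk_ge0 3) (ex_ge0 _ _).
have [_ H] := deformation_expansion uC d8 hd Gp (fun r v r0 => gm_taylor t0 r0)
  (radial_summ_gm 0 uC t0) (radial_summN (radial_summ_gm 1 uC t0)) (radial_summ_gm 2 uC t0)
  (radial_summZ (gk 3) se).
have d30 : 0 <= d ^+ 3 by rewrite exprn_ge0//; case/andP: d8.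
apply: (le_trans H); rewrite (mulrC 27) -(mulrA _ 27).
by apply: ler_wpM2l d30 _ _ _; apply: gm_err_le.
Qed.

(** The coefficient of [|h| ^ 2] given by [quad_dev_design] for the theta series at time [t]. *)
Definition kappa n (B : 'M[R]_n) (t : R) : R :=
  4 / (n%:R * (n%:R + 2)) * (radial_sum B (gm 2 t) - (1 + n%:R / 2) * radial_sum B (gm 1 t)).

Lemma theta_design_expansion n (B P : 'M[R]_n) t (h : 'rV[R]_n) d : (0 < n)%N -> B \in unitmx ->
  all_layers_design 4 B -> P *m P^T = 1%:M -> 0 < t -> \sum_i h 0 i = 0 ->
  0 <= d <= 1 / 8 -> (forall i, `|h 0 i| <= d) ->
  `|radial_sum (B *m P^T *m exp_diag h) (gm 0 t) - radial_sum B (gm 0 t) - sqnorm h * kappa B t| <=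
  d ^+ 3 * (theta_err * radial_sum B (ex (pi * t / 4))).
Proof.
move=> n0 uB des PP t0 h0 d8 hd; have c0 : 0 < pi * t / 4 by rewrite divr_gt0// mulr_gt0// pi_gt0.
have se := radial_summ_ex uB c0.
have Gp r : 0 <= gk 3 * ex (pi * t / 4) r by exact: mulr_ge0 (gk_ge0 3) (ex_ge0 _ _).
have := design_expansion n0 uB des PP h0 d8 hd Gp (fun r v r0 => gm_taylor t0 r0)
  (radial_summ_gm 0 uB t0) (radial_summN (radial_summ_gm 1 uB t0)) (radial_summ_gm 2 uB t0)
  (radial_summZ (gk 3) se) erefl (radial_sumN (radial_summ_gm 1 uB t0)) erefl erefl.
have -> : 2 / n%:R * - radial_sum B (gm 1 t) + 4 / (n%:R * (n%:R + 2)) * radial_sum B (gm 2 t) = kappa B t.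
  rewrite /kappa; field; rewrite pnatr_eq0 -lt0n n0 gt_eqF// ltr_wpDl.
move=> H; have d30 : 0 <= d ^+ 3 by rewrite exprn_ge0//; case/andP: d8.
apply: (le_trans H); rewrite (mulrC 27) -(mulrA _ 27).
by apply: ler_wpM2l d30 _ _ _; apply: gm_err_le.
Qed.

Lemma quad_devZ n (a : 'I_n -> R) (b : 'I_n -> 'I_n -> R) (h : 'rV[R]_n) (u : R) :
  quad_dev a b (u *: h) = u * (2 * \sum_i h 0 i * a i) +
    u ^+ 2 * (quad_dev a b h - 2 * \sum_i h 0 i * a i).
Proof.
have e1 (v : 'rV[R]_n) : \sum_i (2 * v 0 i + 2 * v 0 i ^+ 2) * a i =
    2 * \sum_i v 0 i * a i + 2 * \sum_i v 0 i ^+ 2 * a i.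
  by rewrite !mulr_sumr -big_split/=; apply: eq_bigr => i _; ring.
rewrite /quad_dev !e1.
have -> : \sum_i (u *: h) 0 i * a i = u * \sum_i h 0 i * a i.
  by rewrite mulr_sumr; apply: eq_bigr => i _; rewrite mxE mulrA.
have -> : \sum_i (u *: h) 0 i ^+ 2 * a i = u ^+ 2 * \sum_i h 0 i ^+ 2 * a i.
  by rewrite mulr_sumr; apply: eq_bigr => i _; rewrite mxE; ring.
have -> : \sum_i \sum_j (u *: h) 0 i * (u *: h) 0 j * b i j = u ^+ 2 * \sum_i \sum_j h 0 i * h 0 j * b i j.
  rewrite mulr_sumr; apply: eq_bigr => i _; rewrite mulr_sumr; apply: eq_bigr => j _.
  by rewrite !mxE; ring.
by ring.
Qed.

Lemma dual_unit n (B : 'M[R]_n) : B \in unitmx -> dual B \in unitmx.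
Proof. by move=> uB; rewrite /dual unitmx_tr unitmx_inv. Qed.

Lemma dual_frame n (B P : 'M[R]_n) (h : 'rV[R]_n) : B \in unitmx -> P *m P^T = 1%:M ->
  dual (B *m P^T *m exp_diag h) = dual B *m P^T *m exp_diag (- h).
Proof.
move=> uB PP; have uP : P^T \in unitmx by rewrite unitmx_tr; case: (mulmx1_unit PP).
rewrite diag_dual ?unitmx_mul ?uB// orth_dual//.
by rewrite trmxK; exact: mulmx1C.
Qed.

(* The second-order behaviour of the dual theta series is read off the functional equation. *)
Lemma dual_quad_dev n (B P : 'M[R]_n) t (h : 'rV[R]_n) : (0 < n)%N -> covol B = 1 ->
  all_layers_design 4 B -> P *m P^T = 1%:M -> 0 < t -> \sum_i h 0 i = 0 ->
  let D := dual B *m P^T in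
  quad_dev (lin_moment D (fun r => - gm 1 t r)) (quad_moment D (gm 2 t)) (- h) =
  sqnorm h * (Num.sqrt (t^-1 ^+ n) * kappa B t^-1).
Proof.
move=> n0 cB des PP t0 h0 D; have uB := covol1_unit cB.
have ti0 : 0 < t^-1 by rewrite invr_gt0.
have uD : D \in unitmx.
  by rewrite unitmx_mul dual_unit// unitmx_tr; case: (mulmx1_unit PP).
pose nu : R := \sum_i `|h 0 i|.
have nu0 : 0 <= nu by exact: sumr_ge0.
have hnu i : `|h 0 i| <= nu by rewrite /nu (bigD1 i)//= lerDl sumr_ge0.
(* For [u <= e] all coordinates of [u h] are at most [1 / 8], as the expansions require. *)
pose e : R := (8 * (nu + 1))^-1.
have e0 : 0 < e by rewrite invr_gt0 mulr_gt0// ltr_wpDl.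
have ue u : 0 <= u <= e -> 0 <= u * nu <= 1 / 8.
  move=> /andP[u0 ue]; rewrite mulr_ge0//=; apply: (@le_trans _ _ (e * nu)); first by rewrite ler_wpM2r.
  have -> : 1 / 8 = e * (nu + 1) by rewrite /e; field; rewrite gt_eqF// ltr_wpDl.
  by rewrite ler_wpM2l ?(ltW e0)// lerDl.
pose rho : R := Num.sqrt (t^-1 ^+ n).
pose a := lin_moment D (fun r => - gm 1 t r); pose b := quad_moment D (gm 2 t).
have inv (C : 'M[R]_n) : covol C = 1 -> 1 + radial_sum (dual C) (gm 0 t) = rho * (1 + radial_sum C (gm 0 t^-1)).
  move=> cC; rewrite (theta_inversion (covol1_unit cC) t0) /rho.
  by rewrite -[\det C ^+ 2]real_normK ?num_real// -/(covol C) cC expr1n mulr1.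
have gD : D *m D^T = dual B *m (dual B)^T by exact: gram_orth.
pose E1 := theta_err * radial_sum D (ex (pi * t / 4)).
pose E2 := theta_err * radial_sum B (ex (pi * t^-1 / 4)).
(* Along the ray [u h] the dual series is expanded directly and also through the functional
   equation. The two expansions differ by a cubic error, so their coefficients agree. *)
have key : O3 e (fun u => u * (2 * \sum_i (- h) 0 i * a i) +
   u ^+ 2 * (quad_dev a b (- h) - 2 * \sum_i (- h) 0 i * a i - sqnorm h * (rho * kappa B t^-1))).
  exists (nu ^+ 3 * E1 + rho * (nu ^+ 3 * E2)) => u uu; have /andP[u0 _] := uu.
  have hu0 : \sum_i (u *: h) 0 i = 0.
    by under eq_bigr do rewrite mxE; rewrite -mulr_sumr h0 mulr0.
  have hud i : `|(u *: h) 0 i| <= u * nu by rewrite mxE normrM (ger0_norm u0) ler_wpM2l.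
  have hud' i : `|(u *: - h) 0 i| <= u * nu by rewrite scalerN mxE normrN.
  have H1 := theta_deform uD t0 (ue u uu) hud'.
  have H2 := theta_design_expansion n0 uB des PP ti0 hu0 (ue u uu) hud.
  move: H1; rewrite quad_devZ -/a -/b scalerN -dual_frame// => H1.
  have I1 := inv _ (covol_exp_diag (covol_orth cB PP) hu0).
  have I0 := inv _ cB; rewrite -(radial_sum_gram _ gD) in I0.
  have nh : sqnorm (u *: h) = u ^+ 2 * sqnorm h.
    by rewrite /sqnorm mulr_sumr; apply: eq_bigr => i _; rewrite mxE exprMn.
  move: H1 H2 I1 I0; rewrite nh -/E1 -/E2.
  move: (radial_sum _ _) => X1; move: (radial_sum D _) => X0.
  move: (radial_sum _ _) => Y1; move: (radial_sum B _) => Y0.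
  move: (kappa B _) (2 * _) (quad_dev _ _ _) => k l q.
  move=> H1 H2 I1 I0.
  have rho0 : 0 <= rho by exact: sqrtr_ge0.
  have -> : u * l + u ^+ 2 * (q - l - sqnorm h * (rho * k)) =
     - (X1 - X0 - (u * l + u ^+ 2 * (q - l))) + rho * (Y1 - Y0 - u ^+ 2 * sqnorm h * k).
    have -> : X1 = rho * (1 + Y1) - 1 by rewrite -I1; ring.
    have -> : X0 = rho * (1 + Y0) - 1 by rewrite -I0; ring.
    by ring.
  apply: (le_trans (ler_normD _ _)); rewrite normrN normrM (ger0_norm rho0) mulrDl; apply: lerD.
    by apply: (le_trans H1); rewrite le_eqVlt; apply/orP; left; apply/eqP; ring.
  rewrite -(mulrA rho); apply: ler_wpM2l => //.
  by apply: (le_trans H2); rewrite le_eqVlt; apply/orP; left; apply/eqP; ring.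
have [L0 Q0] := O3_poly e0 key.
by move/eqP: Q0; rewrite L0 subr0 subr_eq0 => /eqP.
Qed.

(** The first two derivatives of the functional equation under dilation: the lattice scaled by
    [exp u] satisfies [1 + X u = rho exp (n u) (1 + Y u)], and the coefficients of [u] and [u ^ 2]
    are compared. *)
Lemma theta_scaling n (B : 'M[R]_n) t : covol B = 1 -> 0 < t ->
  let rho := Num.sqrt (t^-1 ^+ n) in
  let M0 := 1 + radial_sum B (gm 0 t^-1) in
  let M1 := radial_sum B (gm 1 t^-1) in let M2 := radial_sum B (gm 2 t^-1) in
  2 * radial_sum (dual B) (gm 1 t) = rho * (n%:R * M0 - 2 * M1) /\
  2 * radial_sum (dual B) (gm 2 t) - 2 * radial_sum (dual B) (gm 1 t) =
    rho * (n%:R ^+ 2 / 2 * M0 - 2 * n%:R * M1 - 2 * M1 + 2 * M2).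
Proof.
move=> cB t0 rho M0 M1 M2; have uB := covol1_unit cB.
have ti0 : 0 < t^-1 by rewrite invr_gt0.
have uD := dual_unit uB.
pose e : R := 1 / 8.
have e0 : 0 < e by rewrite divr_gt0.
pose N : R := n%:R.
have N0 : 0 <= N by [].
have M00 : 1 + radial_sum (dual B) (gm 0 t) = rho * M0.
  rewrite (theta_inversion uB t0) -/rho.
  by rewrite -[\det B ^+ 2]real_normK ?num_real// -/(covol B) cB expr1n mulr1.
have hcm (u : R) i : 0 <= u -> `|(const_mx u : 'rV[R]_n) 0 i| <= u by move=> u0; rewrite mxE ger0_norm.
have hcn (u : R) i : 0 <= u -> `|(const_mx (- u) : 'rV[R]_n) 0 i| <= u by move=> u0; rewrite mxE normrN ger0_norm.
(* Introducing [Y] and [X] through their defining equations makes them opaque, which keeps the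
   algebra below in terms of plain functions of [u]. *)
have [Y YE] : {Y : R -> R | forall u, Y u = radial_sum (B *m exp_diag (const_mx u)) (gm 0 t^-1)}.
  exists (fun u => radial_sum (B *m exp_diag (const_mx u)) (gm 0 t^-1)) => u; reflexivity.
have [X XE] : {X : R -> R | forall u, X u = radial_sum (dual B *m exp_diag (const_mx (- u))) (gm 0 t)}.
  exists (fun u => radial_sum (dual B *m exp_diag (const_mx (- u))) (gm 0 t)) => u; reflexivity.
have XY u : 1 + X u = rho * expR (N * u) * (1 + Y u).
  have uE : exp_diag (const_mx u : 'rV[R]_n) \in unitmx.
    by rewrite unitmxE unitfE det_exp_diag gt_eqF// expR_gt0.
  have uBE : B *m exp_diag (const_mx u) \in unitmx by rewrite unitmx_mul uB.
  have E := theta_inversion uBE t0.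
  have dE : dual (B *m exp_diag (const_mx u)) = dual B *m exp_diag (const_mx (- u)).
    by rewrite diag_dual//; congr (_ *m exp_diag _); apply/rowP => i; rewrite !mxE.
  rewrite XE YE -dE; apply: (etrans E); move: (1 + _) => y; congr (_ * _).
  rewrite sqrtrM ?exprn_ge0 ?(ltW ti0)// -/rho sqrtr_sqr; congr (_ * _).
  rewrite det_mulmx normrM -/(covol B) cB mul1r det_exp_diag (gtr0_norm (expR_gt0 _)); congr expR.
  by under eq_bigr do rewrite mxE; rewrite sumr_const card_ord mulr_natl.
have EX : O3 e (fun u => X u - radial_sum (dual B) (gm 0 t) -
    ((- 2 * u + 2 * u ^+ 2) * - radial_sum (dual B) (gm 1 t) + 2 * u ^+ 2 * radial_sum (dual B) (gm 2 t))).
  exists (theta_err * radial_sum (dual B) (ex (pi * t / 4))) => u uu; have /andP[u0 _] := uu.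
  rewrite [leRHS]mulrC; have := theta_deform uD t0 uu (fun i => hcn u i u0).
  rewrite XE (quad_dev_scalar _ uD (radial_summN (radial_summ_gm 1 uD t0)) (radial_summ_gm 2 uD t0)).
  by rewrite [2 * - u]mulrN mulNr sqrrN -[rsum _ (fun z => - _)]/(radial_sum (dual B) (fun r => - gm 1 t r))
    (radial_sumN (radial_summ_gm 1 uD t0)).
have EY : O3 e (fun u => Y u - radial_sum B (gm 0 t^-1) -
    ((2 * u + 2 * u ^+ 2) * - M1 + 2 * u ^+ 2 * M2)).
  exists (theta_err * radial_sum B (ex (pi * t^-1 / 4))) => u uu; have /andP[u0 _] := uu.
  rewrite [leRHS]mulrC; have := theta_deform uB ti0 uu (fun i => hcm u i u0).
  rewrite YE (quad_dev_scalar _ uB (radial_summN (radial_summ_gm 1 uB ti0)) (radial_summ_gm 2 uB ti0)).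
  by rewrite -[rsum _ (fun z => - _)]/(radial_sum B (fun r => - gm 1 t^-1 r))
    (radial_sumN (radial_summ_gm 1 uB ti0)).
have EE : O3 e (fun u => expR (N * u) - 1 - N * u - (N * u) ^+ 2 / 2).
  exists (N ^+ 3 * expR (N * e)) => u /andP[u0 ue].
  apply: (le_trans (expR_taylor (N * u))).
  have Nu : 0 <= N * u by rewrite mulr_ge0.
  rewrite (ger0_norm Nu) exprMn -!(mulrA (N ^+ 3)) (mulrC (expR _)).
  by rewrite ler_wpM2l ?exprn_ge0// ler_wpM2l ?exprn_ge0// ler_expR ler_wpM2l.
move: (radial_sum (dual B) (gm 1 t)) EX => A1 EX.
move: (radial_sum (dual B) (gm 2 t)) EX => A2 EX.
have Eexp : forall u, 0 <= u <= e -> `|rho * expR (N * u)| <= rho * expR (N * e).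
  move=> u /andP[u0 ue]; rewrite normrM (ger0_norm (expR_ge0 _)) ger0_norm ?sqrtr_ge0//.
  by rewrite ler_wpM2l ?sqrtr_ge0// ler_expR ler_wpM2l.
pose Q u := M0 + (2 * u + 2 * u ^+ 2) * - M1 + 2 * u ^+ 2 * M2.
have Qb : forall u, 0 <= u <= e -> `|rho * Q u| <= rho * (`|M0| + `|M1| + `|M2|).
  move=> u /andP[u0 ue]; rewrite normrM (ger0_norm (sqrtr_ge0 _)); apply: ler_wpM2l; first exact: sqrtr_ge0.
  have ue8 : u <= 1 / 8 by exact: ue.
  have u2 : u ^+ 2 <= u / 8 by rewrite expr2 ler_wpM2l//; move: ue8; rewrite mul1r.
  have u20 : 0 <= u ^+ 2 by exact: sqr_ge0.
  clear ue; apply: (le_trans (ler_normD _ _)); apply: lerD.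
    apply: (le_trans (ler_normD _ _)); apply: lerD => //.
    rewrite normrM normrN ger0_norm ?ler_piMl//; lra.
  rewrite normrM ger0_norm ?ler_piMl//; lra.
(* the cubic and quartic terms of the product of the two second-order polynomials *)
pose c3 := rho * (N * (2 * M2 - 2 * M1) - N ^+ 2 * M1).
pose c4 := rho * (N ^+ 2 / 2 * (2 * M2 - 2 * M1)).
have C34 : O3 e (fun u => c3 * u ^+ 3 + c4 * u * u ^+ 3).
  apply: O3D; first exact: O3Z (O3_cube e).
  apply: (@O3M _ _ _ _ (`|c4| * e)) (O3_cube e) => u /andP[u0 ue].
  by rewrite normrM (ger0_norm u0) ler_wpM2l.
have key : O3 e (fun u => u * (2 * A1 - rho * (N * M0 - 2 * M1)) +
    u ^+ 2 * (2 * A2 - 2 * A1 - rho * (N ^+ 2 / 2 * M0 - 2 * N * M1 - 2 * M1 + 2 * M2))).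
  have := O3D (O3B (O3M Eexp EY) EX) (O3D (O3M Qb EE) C34).
  apply: eq_O3 => u _.
  have Xu : X u = rho * expR (N * u) * (1 + Y u) - 1 by rewrite -XY; ring.
  have D0 : radial_sum (dual B) (gm 0 t) = rho * M0 - 1 by rewrite -M00; ring.
  rewrite Xu D0 /Q /c3 /c4 /M0.
  move: (radial_sum B (gm 0 t^-1)) (Y u) (expR (N * u)) => y0 y E.
  by clearbody N rho M1 M2; field.
have [L0 Q0] := O3_poly e0 key.
by split; apply/eqP; rewrite -subr_eq0 ?L0 ?Q0.
Qed.

(** In the combination of the second and first moments that defines [kappa], the contributions of
    the theta value [M0] in [theta_scaling] cancel. The dual series thus expands as if the dual
    layers were designs too. *)
Lemma kappa_dual n (B : 'M[R]_n) t : (0 < n)%N -> covol B = 1 -> 0 < t ->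
  Num.sqrt (t^-1 ^+ n) * kappa B t^-1 = kappa (dual B) t.
Proof.
move=> n0 cB t0; have [] := theta_scaling cB t0; rewrite /kappa.
move: (Num.sqrt _) (radial_sum (dual B) _) (radial_sum (dual B) _) => rho A2 A1.
move: (radial_sum B _) (radial_sum B _) (1 + _) => M2 M1 M0 e1 e2.
have -> : A2 - (1 + n%:R / 2) * A1 = (2 * A2 - 2 * A1) / 2 - n%:R / 4 * (2 * A1) by field.
rewrite e2 e1; field; rewrite pnatr_eq0 -lt0n n0 gt_eqF// ltr_wpDl.
Qed.

Lemma theta_dual_expansion n (B P : 'M[R]_n) t (h : 'rV[R]_n) d : (0 < n)%N -> covol B = 1 ->
  all_layers_design 4 B -> P *m P^T = 1%:M -> 0 < t -> \sum_i h 0 i = 0 ->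
  0 <= d <= 1 / 8 -> (forall i, `|h 0 i| <= d) ->
  `|radial_sum (dual (B *m P^T *m exp_diag h)) (gm 0 t) - radial_sum (dual B) (gm 0 t)
     - sqnorm h * kappa (dual B) t| <= d ^+ 3 * (theta_err * radial_sum (dual B) (ex (pi * t / 4))).
Proof.
move=> n0 cB des PP t0 h0 d8 hd; have uB := covol1_unit cB.
have uD : dual B *m P^T \in unitmx.
  by rewrite unitmx_mul dual_unit// unitmx_tr; case: (mulmx1_unit PP).
have hd' i : `|(- h) 0 i| <= d by rewrite mxE normrN.
have := theta_deform uD t0 d8 hd'.
rewrite (dual_quad_dev n0 cB des PP t0 h0) (kappa_dual n0 cB t0) (dual_frame h uB PP).
by rewrite (radial_sum_gram (gm 0 t) (gram_orth (dual B) PP)) (radial_sum_gram (ex _) (gram_orth (dual B) PP)).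
Qed.

End ThetaExpansion.

(** * Integrals over the half-line *)

Section CountableTonelli.
Variables (R : realType) (T : countType).
Local Open Scope ereal_scope.

(** The family transported to the natural numbers along [pickle] and extended by 0, so that the
    theorems on series of nonnegative measurable functions apply to [\esum]. *)
Definition on_code (D : set T) (f : T -> \bar R) (k : nat) : \bar R :=
  if pickle_inv k is Some z then (if z \in D then f z else 0) else 0.

Lemma on_code_ge0 (D : set T) (f : T -> \bar R) k : (forall z, D z -> 0 <= f z) -> 0 <= on_code D f k.
Proof.
move=> f0; rewrite /on_code; case: pickle_inv => // z; case: ifPn => //; rewrite inE; exact: f0.
Qed.

Lemma esum_on_code (D : set T) (f : T -> \bar R) : (forall z, D z -> 0 <= f z) ->
  \esum_(z in D) f z = \sum_(k <oo) on_code D f k.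
Proof.
move=> f0; rewrite nneseries_esumT; last by move=> k; exact: on_code_ge0.
rewrite esum_mkcond.
have bij : set_bij [set: T] (range (@pickle T)) (@pickle T).
  split; [by move=> x _; exists x|move=> x y _ _; exact: (pcan_inj pickleK)|by move=> _ [x _ <-]; exists x].
transitivity (\esum_(k in range (@pickle T)) on_code D f k).
  rewrite (reindex_esum [set: T] (range (@pickle T)) (@pickle T) _ bij); apply: eq_esum => z _.
  by rewrite /on_code pickleK_inv.
rewrite esum_mkcond; apply: eq_esum => k _; case: ifPn => //; rewrite notin_setE => kr.
rewrite /on_code; case e : pickle_inv => [z|]//.
exfalso; apply: kr; exists z => //; have := @pickle_invK T k.
by rewrite e.
Qed.

Variables (d : measure_display) (X : measurableType d).

Lemma measurable_esum (A : set X) (D : set T) (F : T -> X -> \bar R) : measurable A ->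
  (forall z x, D z -> A x -> 0 <= F z x) -> (forall z, D z -> measurable_fun A (F z)) ->
  measurable_fun A (fun x => \esum_(z in D) F z x).
Proof.
move=> mA F0 mF.
apply: (eq_measurable_fun (fun x => \sum_(k <oo) on_code D (F ^~ x) k)).
  by move=> x; rewrite inE => Ax; rewrite esum_on_code// => z Dz; exact: F0.
apply: (@ge0_emeasurable_sum _ _ _ A (fun k x => on_code D (F ^~ x) k) xpredT).
  by move=> k x Ax _; apply: on_code_ge0 => z Dz; exact: F0.
move=> k _; rewrite /on_code; case: pickle_inv => [z|]; last exact: measurable_cst.
by case: (boolP (z \in D)) => [|_]; [rewrite inE; exact: mF|exact: measurable_cst].
Qed.

Lemma integral_esum (mu : {measure set X -> \bar R}) (A : set X) (D : set T) (F : T -> X -> \bar R) :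
  measurable A -> (forall z x, D z -> A x -> 0 <= F z x) -> (forall z, D z -> measurable_fun A (F z)) ->
  \int[mu]_(x in A) (\esum_(z in D) F z x) = \esum_(z in D) \int[mu]_(x in A) F z x.
Proof.
move=> mA F0 mF.
transitivity (\int[mu]_(x in A) \sum_(k <oo) on_code D (F ^~ x) k).
  by apply: eq_integral => x; rewrite inE => Ax; rewrite esum_on_code// => z Dz; exact: F0.
rewrite (integral_nneseries mu mA (f := fun k x => on_code D (F ^~ x) k)); last 2 first.
- move=> k; rewrite /on_code; case: pickle_inv => [z|]; last exact: measurable_cst.
  by case: (boolP (z \in D)) => [|_]; [rewrite inE; exact: mF|exact: measurable_cst].
- by move=> k x Ax; apply: on_code_ge0 => z Dz; exact: F0.
rewrite esum_on_code => [|z Dz]; last by apply: integral_ge0 => x Ax; exact: F0.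
apply: eq_eseriesr => k _; rewrite /on_code; case: pickle_inv => [z|]; last by rewrite integral0.
by case: ifP => // _; rewrite integral0.
Qed.

End CountableTonelli.

(** * Exponential decay and integration by parts *)

Section HalfLine.
Variable R : realType.
Local Notation mu := (@lebesgue_measure R).
Local Notation hl := (`[1%R, +oo[%classic : set R).

(** From [ln x <= x - 1] at [x = t c / b]; the exponent [b = |a| + 1] is positive and dominates [a]
    for [t >= 1]. *)
Lemma powR_le_exp (a c : R) : 0 < c -> exists2 K : R, 0 <= K &
  forall t, 1 <= t -> t `^ a <= K * expR (c * t).
Proof.
move=> c0; pose b : R := `|a| + 1; have b0 : 0 < b by rewrite /b ltr_wpDl.
exists (expR (- b * (1 + ln (c / b)))) => [|t t1]; first exact: expR_ge0.
have t0 : 0 < t by lra.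
have ab : a <= b by rewrite /b; have := ler_norm a; lra.
apply: (le_trans (ler_powR t1 ab)); rewrite /powR gt_eqF// -expRD ler_expR.
have cb0 : 0 < c / b by rewrite divr_gt0.
have := ln_le_sub1 (mulr_gt0 t0 cb0); rewrite (@lnM R t (c / b)) ?posrE// => h.
have h2 : ln t <= t * (c / b) - 1 - ln (c / b) by lra.
have h3 : b * ln t <= b * (t * (c / b) - 1 - ln (c / b)) by rewrite ler_wpM2l// ltW.
apply: (le_trans h3); rewrite le_eqVlt; apply/orP; left; apply/eqP.
by field; rewrite gt_eqF.
Qed.

Lemma cvg_exp_decay (c : R) : 0 < c -> expR (- (c * t)) @[t --> +oo] --> (0 : R).
Proof.
move=> c0; apply/cvgrPdist_le => e e0.
near=> t; rewrite sub0r normrN ger0_norm ?expR_ge0//.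
rewrite -[leRHS]lnK// ler_expR.
have : - ln e / c <= t by near: t; apply: nbhs_pinfty_ge; exact: num_real.
by rewrite ler_pdivrMr//; lra.
Unshelve. all: by end_near. Qed.

Lemma measurable_hl : measurable (hl : set (measurableTypeR R)).
Proof. exact: measurable_itv. Qed.

Lemma integral_exp_decay (c : R) : 0 < c ->
  (\int[mu]_(t in hl) (expR (- (c * t)))%:E = (expR (- c) / c)%:E)%E.
Proof.
move=> c0; have cn : c != 0 by rewrite gt_eqF.
have dF (x : R) : is_derive x 1 (fun t => - (expR (- (c * t)) / c)) (expR (- (c * x))).
  by apply: is_derive_eq; rewrite /GRing.scale/=; field.
rewrite (@ge0_continuous_FTC2y R _ (fun t => - (expR (- (c * t)) / c)) 1 0) /=.
- by rewrite mulr1 -EFinB; congr EFin; ring.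
- by move=> x _; exact: expR_ge0.
- apply: continuous_subspaceT => x; apply: differentiable_continuous.
  by apply/derivable1_diffP.
- rewrite -oppr0; apply: cvgN; rewrite -[0](mul0r c^-1); apply: cvgMl.
  exact: cvg_exp_decay.
- by move=> x _; case: (dF x).
- have c1 : {for 1, continuous (fun t => - (expR (- (c * t)) / c))}.
    by apply: differentiable_continuous; apply/derivable1_diffP; case: (dF 1).
  exact: cvg_at_right_filter c1.
- by move=> x _; rewrite derive1E; case: (dF x).
Qed.

Lemma integrable_exp_decay (c : R) : 0 < c -> mu.-integrable hl (fun t => (expR (- (c * t)))%:E).
Proof.
move=> c0; apply/integrableP; split.
  apply/measurable_EFinP; apply: measurable_funTS; apply: (measurableT_comp (@measurable_expR R)).
  by apply: measurable_funN; exact: measurable_funM.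
under eq_integral do rewrite gee0_abs ?lee_fin ?expR_ge0//.
by rewrite integral_exp_decay// ltry.
Qed.

Lemma integrable_dominated (f : R -> R) (K c : R) : 0 < c ->
  measurable_fun hl (f : measurableTypeR R -> measurableTypeR R) ->
  (forall t, 1 <= t -> `|f t| <= K * expR (- (c * t))) -> mu.-integrable hl (EFin \o f).
Proof.
move=> c0 mf fK.
have iE := integrableZl measurable_hl K (integrable_exp_decay c0).
apply: le_integrable iE => //; first exact/measurable_EFinP.
move=> t /=; rewrite in_itv/= andbT => t1.
rewrite lee_fin; apply: (le_trans (fK t t1)); exact: ler_norm.
Qed.

Lemma measurable_powR_hl (a : R) : measurable_fun (hl : set (measurableTypeR R)) (fun t : measurableTypeR R => (t `^ a : measurableTypeR R)).
Proof. by apply: measurable_funTS; exact: measurable_powR. Qed.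

Lemma continuous_powR (b x : R) : 0 < x -> {for x, continuous (fun t : R => t `^ b)}.
Proof.
move=> x0; apply: differentiable_continuous; apply/derivable1_diffP.
by have [] := is_derive1_powR b x0.
Qed.

Lemma continuous_exp_decay (c x : R) : {for x, continuous (fun t : R => expR (- (c * t)))}.
Proof.
apply: differentiable_continuous; apply/derivable1_diffP.
have : is_derive x 1 (fun t => expR (- (c * t))) (- c * expR (- (c * x))).
  by apply: is_derive_eq; rewrite /GRing.scale/=; ring.
by case.
Qed.

Lemma measurable_exp_decay (c : R) :
  measurable_fun (hl : set (measurableTypeR R)) (fun t : measurableTypeR R => (expR (- (c * (t : R))) : measurableTypeR R)).
Proof.
apply: measurable_funTS; apply: (measurableT_comp (@measurable_expR R)).
by apply: measurable_funN; exact: measurable_funM.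
Qed.

Lemma integrable_pow_exp (b c : R) : 0 < c ->
  mu.-integrable hl (fun t => (t `^ b * expR (- (c * t)))%:E).
Proof.
move=> c0; have c2 : 0 < c / 2 by rewrite divr_gt0.
have [K K0 hK] := powR_le_exp b c2.
apply: (@integrable_dominated (fun t => t `^ b * expR (- (c * t))) K (c / 2)) => //.
  exact: measurable_funM (measurable_powR_hl b) (measurable_exp_decay c).
move=> t t1; rewrite ger0_norm ?mulr_ge0 ?powR_ge0 ?expR_ge0//.
have -> : K * expR (- (c / 2 * t)) = K * expR (c / 2 * t) * expR (- (c * t)).
  by rewrite -(mulrA K) -expRD; congr (_ * expR _); field.
by rewrite ler_wpM2r ?expR_ge0// hK.
Qed.

(** Integration by parts. The fundamental theorem on the half-line is applied to nonnegative
    integrands, and the derivative of [- t ^ b exp (- c t)] changes sign; a multiple of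
    [exp (- c t / 2)], whose integral is known, is added and removed again. *)
Lemma pow_exp_recursion (b c : R) : 0 < c -> 0 <= b ->
  c * (\int[mu]_(t in hl) (t `^ b * expR (- (c * t)))) =
  expR (- c) + b * (\int[mu]_(t in hl) (t `^ (b - 1) * expR (- (c * t)))).
Proof.
move=> c0 b0; have c2 : 0 < c / 2 by rewrite divr_gt0.
have [K K0 hK] := powR_le_exp (b - 1) c2; have [K' K'0 hK'] := powR_le_exp b c2.
have cn : c != 0 by rewrite gt_eqF.
(* By the choice of [K], [b t ^ (b - 1) exp (- c t) <= C exp (- c t / 2)]. *)
pose C := b * K.
pose g1 (t : R) := t `^ b * expR (- (c * t)); pose g2 (t : R) := t `^ (b - 1) * expR (- (c * t)).
pose g3 (t : R) := expR (- (c / 2 * t)).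
pose f (t : R) := (c * g1 t - b * g2 t) + C * g3 t.
pose F (t : R) := - g1 t - C * (g3 t / (c / 2)).
have i1 : mu.-integrable hl (EFin \o g1) by exact: integrable_pow_exp.
have i2 : mu.-integrable hl (EFin \o g2) by exact: integrable_pow_exp.
have i3 : mu.-integrable hl (EFin \o g3) by exact: integrable_exp_decay.
have decay t : 1 <= t -> expR (c / 2 * t) * expR (- (c * t)) = g3 t.
  by move=> _; rewrite -expRD; congr expR; field.
have f0 t : 1 <= t -> 0 <= f t.
  move=> t1; rewrite /f -addrA; apply: addr_ge0.
    by apply: mulr_ge0 (ltW c0) _; apply: mulr_ge0 (powR_ge0 _ _) (expR_ge0 _).
  rewrite addrC subr_ge0 /C -mulrA; apply: ler_wpM2l => //.
  rewrite -(decay t t1) mulrA; apply: ler_wpM2r; [exact: expR_ge0|exact: hK].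
have cg1 (x : R) : 0 < x -> {for x, continuous g1}.
  by move=> x0; apply: continuousM; [exact: continuous_powR|exact: continuous_exp_decay].
have cg2 (x : R) : 0 < x -> {for x, continuous g2}.
  by move=> x0; apply: continuousM; [exact: continuous_powR|exact: continuous_exp_decay].
have cg3 (x : R) : {for x, continuous g3} by exact: continuous_exp_decay.
have dF (x : R) : 0 < x -> is_derive x 1 F (f x).
  move=> x0; have dp := is_derive1_powR b x0.
  have d1 : is_derive x 1 g1 (b * x `^ (b - 1) * expR (- (c * x)) - c * g1 x).
    by rewrite /g1; apply: is_derive_eq; rewrite /GRing.scale/=; ring.
  have d3 : is_derive x 1 g3 (- (c / 2) * g3 x).
    by rewrite /g3; apply: is_derive_eq; rewrite /GRing.scale/=; ring.
  rewrite /F; apply: is_derive_eq; rewrite /GRing.scale/= /f /g2; field.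
  by rewrite cn.
have H : \int[mu]_(t in hl) f t = 0 - F 1.
  apply: Rintegral_ge0_continuous_FTC2y => //.
  - apply: continuous_in_subspaceT => x; rewrite inE/= in_itv/= andbT => x1.
    have x0 : 0 < x by lra.
    apply: cvgD; last by apply: cvgM; [exact: cvg_cst|exact: cg3].
    apply: cvgB; (apply: cvgM; first exact: cvg_cst); [exact: cg1|exact: cg2].
  - rewrite -[0]subr0 -[X in _ - X](mulr0 C) -{1}oppr0; apply: cvgB.
      apply: cvgN; apply: (squeeze_cvgr (f := fun=> 0) (h := fun t => K' * g3 t)).
      - near=> t; have t1 : 1 <= t by near: t; apply: nbhs_pinfty_ge; exact: num_real.
        rewrite /g1 mulr_ge0 ?powR_ge0 ?expR_ge0//= -(decay t t1) mulrA.
        by apply: ler_wpM2r; [exact: expR_ge0|exact: hK'].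
      - exact: cvg_cst.
      - by rewrite -[0](mulr0 K'); apply: cvgM; [exact: cvg_cst|exact: cvg_exp_decay].
    apply: cvgM; first exact: cvg_cst.
    by rewrite -[0](mul0r (c / 2)^-1); apply: cvgM; [exact: cvg_exp_decay|exact: cvg_cst].
  - by move=> x x1; case: (dF x _) => //; lra.
  - have d1 : derivable F 1 1 by case: (dF 1 ltr01).
    have c1 : {for 1, continuous F} by apply: differentiable_continuous; apply/derivable1_diffP.
    exact: cvg_at_right_filter c1.
  - move=> x; rewrite in_itv/= andbT => x1; rewrite derive1E; case: (dF x _) => //; lra.
have H3 : \int[mu]_(t in hl) g3 t = expR (- (c / 2)) / (c / 2) by rewrite /Rintegral integral_exp_decay.
have I1 : mu.-integrable hl (EFin \o (fun t => c * g1 t)) by exact: integrableZl i1.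
have I2 : mu.-integrable hl (EFin \o (fun t => b * g2 t)) by exact: integrableZl i2.
have I3 : mu.-integrable hl (EFin \o (fun t => C * g3 t)) by exact: integrableZl i3.
have I12 : mu.-integrable hl (EFin \o (fun t => c * g1 t - b * g2 t)) by exact: integrableB I1 I2.
move: H; rewrite /f RintegralD// RintegralB// !RintegralZl// H3 /F /g1 /g3 powR1 !mulr1 mul1r => H.
rewrite -/g1 -/g2; move: H; move: (\int[mu]_(x in hl) g1 x) (\int[mu]_(x in hl) g2 x) => G1 G2 H.
lra.
Unshelve. all: by end_near. Qed.

End HalfLine.

(** * Mellin-type integrals of the theta moments *)

Section ThetaIntegrals.
Variable R : realType.
Local Notation mu := (@lebesgue_measure R).
Local Notation hl := (`[1%R, +oo[%classic : set R).
Implicit Types (n k : nat) (a t r : R).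

Definition gmi k a r : R := \int[mu]_(t in hl) (gm k t r * t `^ (a - 1)).

Lemma gm_pow k a t r : 0 < t ->
  gm k t r * t `^ (a - 1) = (pi * r) ^+ k * (t `^ (a - 1 + k%:R) * expR (- (pi * r * t))).
Proof.
move=> t0; rewrite /gm (@powRD _ t (a - 1) k%:R); last by rewrite (gt_eqF t0) implybT.
rewrite powR_mulrn ?(ltW t0)// (_ : pi * t * r = pi * r * t); last by ring.
by rewrite exprMn; ring.
Qed.

Lemma integrable_gm k a r : 0 < r -> mu.-integrable hl (EFin \o (fun t => gm k t r * t `^ (a - 1))).
Proof.
move=> r0; have c0 : 0 < pi * r by rewrite mulr_gt0// pi_gt0.
have I := integrableZl (@measurable_hl R) ((pi * r) ^+ k) (integrable_pow_exp (a - 1 + k%:R) c0).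
apply: (eq_integrable (@measurable_hl R) _ _ _ I) => t; rewrite inE/= in_itv/= andbT => t1.
by rewrite gm_pow//; lra.
Qed.

Lemma gmiE k a r : 0 < r ->
  gmi k a r = (pi * r) ^+ k * \int[mu]_(t in hl) (t `^ (a - 1 + k%:R) * expR (- (pi * r * t))).
Proof.
move=> r0; have c0 : 0 < pi * r by rewrite mulr_gt0// pi_gt0.
rewrite /gmi -RintegralZl//; last exact: integrable_pow_exp.
apply: eq_Rintegral => t; rewrite inE/= in_itv/= andbT => t1.
by rewrite gm_pow//; lra.
Qed.

Lemma gmi_rec k a r : 0 < r -> 0 <= a + k%:R ->
  gmi k.+1 a r = gm k 1 r + (a + k%:R) * gmi k a r.
Proof.
move=> r0 ak; have c0 : 0 < pi * r by rewrite mulr_gt0// pi_gt0.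
rewrite !gmiE//; have := pow_exp_recursion c0 ak.
have -> : a - 1 + k.+1%:R = a + k%:R by rewrite -natr1; ring.
have -> : a - 1 + k%:R = a + k%:R - 1 by ring.
rewrite /gm mulr1 exprSr -[(pi * r) ^+ k * (pi * r) * _]mulrA => ->.
by ring.
Qed.

Lemma gmi_ge0 k a r : 0 < r -> 0 <= gmi k a r.
Proof.
move=> r0; apply: Rintegral_ge0 => t; rewrite /= in_itv/= andbT => t1.
apply: mulr_ge0 (powR_ge0 _ _); have t0 : 0 < t by lra.
by case/andP: (gm_le k t0 r0).
Qed.

(** The exponent [pi t r / 4] is cut in two halves: in one, [r] is at least the minimum [m], giving
    decay in [t]; in the other, [t >= 1] leaves a convergent lattice sum. *)
Lemma radial_tail n (B : 'M[R]_n) : B \in unitmx -> exists2 c : R, 0 < c &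
  exists2 K : R, 0 <= K & forall t, 1 <= t -> radial_sum B (ex (pi * t / 4)) <= K * expR (- (c * t)).
Proof.
move=> uB; have [m m0 hm] := lvec_min uB.
have p0 := @pi_gt0 R.
have p8 : 0 < pi / 8 :> R by rewrite divr_gt0.
have s8 := radial_summ_ex uB p8.
exists (pi / 8 * m); first by rewrite mulr_gt0.
exists (radial_sum B (ex (pi / 8))); first by apply: radial_sum_ge0 => // r _; exact: ex_ge0.
move=> t t1; have t0 : 0 < t by lra.
have pt : 0 < pi * t / 4 by rewrite divr_gt0// mulr_gt0.
rewrite [leRHS]mulrC -(radial_sumZ _ s8).
Transparent radial_sum.
apply: le_rsum; [|exact: radial_summ_ex uB pt|exact: radial_summZ s8].
Opaque radial_sum.
move=> z z0; rewrite /ex -expRD ler_expR.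
have r1 := hm z z0; have r0 := sqnorm_lvec_gt0 uB z0.
move: (sqnorm _) r1 r0 => r r1 r0.
have h1 : pi / 8 * m * t <= pi / 8 * r * t by rewrite ler_wpM2r ?(ltW t0)// ler_wpM2l// ltW.
have h2 : pi / 8 * r <= pi / 8 * r * t by rewrite ler_peMr// ltW// mulr_gt0.
rewrite (_ : pi * t / 4 * r = pi / 8 * r * t + pi / 8 * r * t); last by field.
lra.
Qed.

Lemma radial_gm_bound n (B : 'M[R]_n) k t : B \in unitmx -> 0 < t ->
  0 <= radial_sum B (gm k t) <= gk R k * radial_sum B (ex (pi * t / 4)).
Proof.
move=> uB t0; have pt : 0 < pi * t / 4 by rewrite divr_gt0// mulr_gt0// pi_gt0.
have s := radial_summ_gm k uB t0; have se := radial_summ_ex uB pt.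
apply/andP; split; first by apply: radial_sum_ge0 => // r r0; case/andP: (gm_le k t0 r0).
rewrite -(radial_sumZ _ se); apply: (le_radial_sum uB s (radial_summZ _ se)) => r r0.
by case/andP: (gm_le k t0 r0).
Qed.

Transparent radial_sum.
Lemma radial_sum_esum n (B : 'M[R]_n) F : B \in unitmx -> radial_summ B F -> (forall r, 0 < r -> 0 <= F r) ->
  ((radial_sum B F)%:E = \esum_(z in @nzidx n) (F (sqnorm (lvec B z)))%:E)%E.
Proof.
move=> uB sF F0; have F0z z : nzidx z -> 0 <= F (sqnorm (lvec B z)) by move=> z0; apply: F0; exact: sqnorm_lvec_gt0.
by rewrite /radial_sum rsum_psum// psumE.
Qed.

Lemma radial_sum_of_esum n (B : 'M[R]_n) F (x : R) : B \in unitmx -> (forall r, 0 < r -> 0 <= F r) ->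
  (x%:E = \esum_(z in @nzidx n) (F (sqnorm (lvec B z)))%:E)%E ->
  radial_summ B F /\ x = radial_sum B F.
Proof.
move=> uB F0 E; have F0z z : nzidx z -> 0 <= F (sqnorm (lvec B z)) by move=> z0; apply: F0; exact: sqnorm_lvec_gt0.
have sF : radial_summ B F.
  rewrite /radial_summ /summ (eq_esum (b := fun z => (F (sqnorm (lvec B z)))%:E)); first by rewrite -E ltry.
  by move=> z z0; rewrite ger0_norm// F0z.
by split=> //; apply: EFin_inj; rewrite E radial_sum_esum.
Qed.
Opaque radial_sum.

Lemma measurable_gm k r : measurable_fun (hl : set (measurableTypeR R))
  (fun t : measurableTypeR R => (gm k (t : R) r : measurableTypeR R)).
Proof.
have mx : measurable_fun (hl : set (measurableTypeR R)) (fun t : measurableTypeR R => (pi * (t : R) * r : measurableTypeR R)).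
  by apply: measurable_funTS; apply: measurable_funM => //; exact: measurable_funM.
apply: measurable_funM; first exact: measurable_funX.
by apply: (measurableT_comp (@measurable_expR R)); exact: measurable_funN.
Qed.

Lemma measurable_radial_gm n (B : 'M[R]_n) k : B \in unitmx ->
  measurable_fun (hl : set (measurableTypeR R))
    (fun t : measurableTypeR R => (radial_sum B (gm k t) : measurableTypeR R)).
Proof.
move=> uB; apply/measurable_EFinP.
apply: (eq_measurable_fun (fun t => \esum_(z in @nzidx n) (gm k t (sqnorm (lvec B z)))%:E)%E).
  move=> t; rewrite inE/= in_itv/= andbT => t1; have t0 : 0 < t by lra.
  by rewrite radial_sum_esum//; [exact: radial_summ_gm|move=> r r0; case/andP: (gm_le k t0 r0)].
apply: measurable_esum => [|z t z0|z z0]; first exact: measurable_hl.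
  rewrite /= in_itv/= andbT => t1; have t0 : 0 < t by lra.
  by rewrite lee_fin; case/andP: (gm_le k t0 (sqnorm_lvec_gt0 uB z0)).
by apply/measurable_EFinP; exact: measurable_gm.
Qed.

Lemma integrable_radial_gm n (B : 'M[R]_n) k a : B \in unitmx ->
  mu.-integrable hl (EFin \o (fun t => radial_sum B (gm k t) * t `^ (a - 1))).
Proof.
move=> uB; have [c c0 [K K0 hK]] := radial_tail uB.
have c2 : 0 < c / 2 by rewrite divr_gt0.
have [K' K'0 hK'] := powR_le_exp (a - 1) c2.
apply: (@integrable_dominated _ _ (gk R k * K * K') (c / 2)) => //.
  exact: measurable_funM (measurable_radial_gm k uB) (measurable_powR_hl (a - 1)).
move=> t t1; have t0 : 0 < t by lra.
have /andP[g0 g1] := radial_gm_bound k uB t0.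
rewrite ger0_norm ?(mulr_ge0 g0) ?powR_ge0//.
have -> : gk R k * K * K' * expR (- (c / 2 * t)) = gk R k * (K * expR (- (c * t))) * (K' * expR (c / 2 * t)).
  have -> : expR (- (c / 2 * t)) = expR (- (c * t)) * expR (c / 2 * t) by rewrite -expRD; congr expR; field.
  by ring.
apply: ler_pM => //; [exact: powR_ge0| |exact: hK'].
by apply: (le_trans g1); apply: ler_wpM2l; [exact: gk_ge0|exact: hK].
Qed.

Definition IM n (B : 'M[R]_n) k a : R := \int[mu]_(t in hl) (radial_sum B (gm k t) * t `^ (a - 1)).

(** Tonelli: the integral is again a radial lattice sum, so the recursion [gmi_rec] for one vector
    can be summed. *)
Lemma IM_radial n (B : 'M[R]_n) k a : B \in unitmx ->
  radial_summ B (gmi k a) /\ IM B k a = radial_sum B (gmi k a).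
Proof.
move=> uB; apply: radial_sum_of_esum => // [r|]; first exact: gmi_ge0.
rewrite /IM /Rintegral fineK; last by apply: integrable_fin_num => //; exact: integrable_radial_gm.
transitivity (\int[mu]_(t in hl) (\esum_(z in @nzidx n) (gm k t (sqnorm (lvec B z)) * t `^ (a - 1))%:E))%E.
  apply: eq_integral => t; rewrite inE/= in_itv/= andbT => t1; have t0 : 0 < t by lra.
  have g0 r : 0 < r -> 0 <= gm k t r by move=> r0; case/andP: (gm_le k t0 r0).
  have s := radial_summ_gm k uB t0.
  have sZ : radial_summ B (fun r => t `^ (a - 1) * gm k t r) by exact: radial_summZ.
  rewrite mulrC -radial_sumZ// radial_sum_esum// => [|r r0]; last exact: mulr_ge0 (powR_ge0 _ _) (g0 r r0).
  by apply: eq_esum => z _; rewrite mulrC.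
rewrite integral_esum; last 3 first.
- exact: measurable_hl.
- move=> z t z0; rewrite /= in_itv/= andbT => t1; have t0 : 0 < t by lra.
  rewrite lee_fin; apply: mulr_ge0 (powR_ge0 _ _).
  by case/andP: (gm_le k t0 (sqnorm_lvec_gt0 uB z0)).
- move=> z z0; apply/measurable_EFinP.
  exact: measurable_funM (measurable_gm k _) (measurable_powR_hl (a - 1)).
apply: eq_esum => z z0; rewrite /gmi /Rintegral fineK//.
by apply: integrable_fin_num => //; apply: integrable_gm; exact: sqnorm_lvec_gt0.
Qed.

Lemma IM_rec n (B : 'M[R]_n) k a : B \in unitmx -> 0 <= a + k%:R ->
  IM B k.+1 a = radial_sum B (gm k 1) + (a + k%:R) * IM B k a.
Proof.
move=> uB ak; have [s ->] := IM_radial k a uB; have [_ ->] := IM_radial k.+1 a uB.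
rewrite -radial_sumZ// -radial_sumD//; [|exact: radial_summ_gm|exact: radial_summZ].
by apply: eq_radial_sum => // r r0; exact: gmi_rec.
Qed.

Lemma theta_int_IM n (B : 'M[R]_n) a : B \in unitmx -> theta_int B a = IM B 0 a.
Proof.
move=> uB; apply: eq_Rintegral => t; rewrite inE/= in_itv/= andbT => t1.
by rewrite theta1E//; lra.
Qed.

Lemma IM_gram n (B C : 'M[R]_n) k a : B *m B^T = C *m C^T -> IM B k a = IM C k a.
Proof. by move=> G; apply: eq_Rintegral => t _; rewrite (radial_sum_gram _ G). Qed.

End ThetaIntegrals.

(** * Expansion of the theta integrals and the range below [n / 2] *)

Section ThetaIntegralExpansion.
Variable R : realType.
Local Notation mu := (@lebesgue_measure R).
Local Notation hl := (`[1%R, +oo[%classic : set R).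
Implicit Types (n k : nat) (a t r s : R).

Definition ikappa n (B : 'M[R]_n) a : R :=
  4 / (n%:R * (n%:R + 2)) * (IM B 2 a - (1 + n%:R / 2) * IM B 1 a).

(** The pointwise expansion is a hypothesis, so that the statement serves both the lattice and its
    dual. The error is integrable by [radial_tail]. *)
Lemma IM_expansion n (B : 'M[R]_n) a : B \in unitmx -> exists2 K : R, 0 <= K &
  forall (X : 'M[R]_n) (S e : R), X \in unitmx -> 0 <= e ->
  (forall t, 1 <= t -> `|radial_sum X (gm 0 t) - radial_sum B (gm 0 t) - S * kappa B t|
     <= e * (theta_err R * radial_sum B (ex (pi * t / 4)))) ->
  `|IM X 0 a - IM B 0 a - S * ikappa B a| <= e * K.
Proof.
move=> uB; have [c c0 [K K0 hK]] := radial_tail uB.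
have te0 : 0 <= theta_err R by rewrite /theta_err mulr_ge0// !addr_ge0// gk_ge0.
pose J : R := \int[mu]_(t in hl) (t `^ (a - 1) * expR (- (c * t))).
have J0 : 0 <= J by apply: Rintegral_ge0 => t _; rewrite mulr_ge0 ?powR_ge0 ?expR_ge0.
exists (theta_err R * K * J); first exact: mulr_ge0 (mulr_ge0 te0 K0) J0.
move=> X S e uX e0 H.
pose w := 4 / (n%:R * (n%:R + 2)) : R; pose v := 1 + n%:R / 2 : R.
pose gX t := radial_sum X (gm 0 t) * t `^ (a - 1).
pose g k t := radial_sum B (gm k t) * t `^ (a - 1).
have mh := @measurable_hl R.
have iX : mu.-integrable hl (EFin \o gX) by exact: integrable_radial_gm.
have ig k : mu.-integrable hl (EFin \o g k) by exact: integrable_radial_gm.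
have ig1 : mu.-integrable hl (EFin \o (fun t => v * g 1%N t)) by exact: (integrableZl mh v (ig 1%N)).
have ig2 : mu.-integrable hl (EFin \o (fun t => g 2 t - v * g 1%N t)) by exact: (integrableB mh (ig 2) ig1).
have ig3 : mu.-integrable hl (EFin \o (fun t => S * w * (g 2 t - v * g 1%N t))) by exact: (integrableZl mh (S * w) ig2).
have ig4 : mu.-integrable hl (EFin \o (fun t => gX t - g 0 t)) by exact: (integrableB mh iX (ig 0)).
have ig5 : mu.-integrable hl (EFin \o (fun t => (gX t - g 0 t) - S * w * (g 2 t - v * g 1%N t))) by exact: (integrableB mh ig4 ig3).
have -> : IM X 0 a - IM B 0 a - S * ikappa B a = \int[mu]_(t in hl) ((gX t - g 0 t) - S * w * (g 2 t - v * g 1%N t)).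
  rewrite (RintegralB mh ig4 ig3) (RintegralB mh iX (ig 0)) (RintegralZl _ mh ig2) (RintegralB mh (ig 2) ig1) (RintegralZl _ mh (ig 1%N)).
  by rewrite /ikappa mulrA.
apply: (le_trans (le_normr_Rintegral mh ig5)).
have iE := integrable_pow_exp (a - 1) c0.
have -> : e * (theta_err R * K * J) = \int[mu]_(t in hl) (e * (theta_err R * K) * (t `^ (a - 1) * expR (- (c * t)))).
  by rewrite RintegralZl// -/J; ring.
apply: le_Rintegral => //; [exact: (integrable_norm ig5)|exact: (integrableZl mh _ iE)|].
move=> t; rewrite /= in_itv/= andbT => t1.
have p0 := powR_ge0 t (a - 1).
have -> : gX t - g 0 t - S * w * (g 2 t - v * g 1%N t) =
   (radial_sum X (gm 0 t) - radial_sum B (gm 0 t) - S * kappa B t) * t `^ (a - 1).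
  by rewrite /gX /g /kappa -/w -/v; move: (radial_sum X _) (radial_sum B _) (radial_sum B _) (radial_sum B _) => *; ring.
rewrite normrM (ger0_norm p0).
have -> : e * (theta_err R * K) * (t `^ (a - 1) * expR (- (c * t))) = e * (theta_err R * (K * expR (- (c * t)))) * t `^ (a - 1) by ring.
apply: ler_wpM2r => //; apply: (le_trans (H t t1)).
by apply: ler_wpM2l => //; apply: ler_wpM2l => //; exact: hK.
Qed.

(** Two integrations by parts lower the moments to order 0; the factor [(a + 1) - (1 + n / 2)]
    produces [a - n / 2]. *)
Lemma ikappaE n (B : 'M[R]_n) a : (0 < n)%N -> B \in unitmx -> 0 <= a ->
  ikappa B a = 4 / (n%:R * (n%:R + 2)) *
    (radial_sum B (gm 1 1) + (a - n%:R / 2) * (radial_sum B (gm 0 1) + a * IM B 0 a)).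
Proof.
move=> n0 uB a0; rewrite /ikappa.
have r1 : IM B 1 a = radial_sum B (gm 0 1) + a * IM B 0 a.
  by have := IM_rec (k := 0) (a := a) uB; rewrite addr0 => ->.
have r2 := IM_rec (k := 1) (a := a) uB (addr_ge0 a0 ler01).
by rewrite r2 r1; congr (_ * _); ring.
Qed.

Definition Lam n (B : 'M[R]_n) s : R := theta_int B s + theta_int (dual B) (n%:R / 2 - s).

Lemma Lam_IM n (B : 'M[R]_n) s : B \in unitmx -> Lam B s = IM B 0 s + IM (dual B) 0 (n%:R / 2 - s).
Proof. by move=> uB; rewrite /Lam !theta_int_IM// dual_unit. Qed.

Lemma Lam_gram n (B C : 'M[R]_n) s : B \in unitmx -> C \in unitmx -> B *m B^T = C *m C^T -> Lam B s = Lam C s.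
Proof.
move=> uB uC G; rewrite (Lam_IM s uB) (Lam_IM s uC).
by rewrite (IM_gram 0 s G) (IM_gram 0 _ (gram_dual uB uC G)).
Qed.

Definition Lam_coef n (B : 'M[R]_n) s : R :=
  4 / (n%:R * (n%:R + 2)) * (n%:R / 2 + s * (s - n%:R / 2) * Lam B s).

(** The two integrals acquire the same factor [s (s - n / 2)]. The boundary terms at [t = 1] are
    related by the functional equation and by [theta_scaling], and add up to [n / 2]. *)
Lemma ikappa_sum n (B : 'M[R]_n) s : (0 < n)%N -> covol B = 1 -> 0 <= s <= n%:R / 2 ->
  ikappa B s + ikappa (dual B) (n%:R / 2 - s) = Lam_coef B s.
Proof.
move=> n0 cB /andP[s0 sn]; have uB := covol1_unit cB; have uD := dual_unit uB.
rewrite (ikappaE n0 uB s0) (ikappaE n0 uD); last by rewrite subr_ge0.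
rewrite /Lam_coef Lam_IM//.
have [e1 _] := theta_scaling cB ltr01; have e0 := theta_inversion uB ltr01.
have d1 : \det B ^+ 2 = 1 by rewrite -real_normK ?num_real// -/(covol B) cB expr1n.
move: e1 e0; rewrite invr1 expr1n d1 mul1r sqrtr1 !mul1r.
move: (radial_sum (dual B) _) (radial_sum (dual B) _) (radial_sum B _) (radial_sum B _) => D0 D1 M1 M0.
move: (IM B _ _) (IM (dual B) _ _) => I1 I2 e1 e0.
have -> : D0 = M0 by lra.
rewrite -mulrDr; congr (_ * _).
have -> : D1 = (n%:R * (1 + M0) - 2 * M1) / 2 by lra.
by field.
Qed.

Lemma Lam_expansion n (B : 'M[R]_n) s : (0 < n)%N -> covol B = 1 -> all_layers_design 4 B ->
  0 <= s <= n%:R / 2 -> exists2 K : R, 0 <= K & forall (P : 'M[R]_n) (h : 'rV[R]_n) (d : R),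
  P *m P^T = 1%:M -> \sum_i h 0 i = 0 -> 0 <= d <= 1 / 8 -> (forall i, `|h 0 i| <= d) ->
  Lam B s + (Lam_coef B s * sqnorm h - K * d ^+ 3) <= Lam (B *m P^T *m exp_diag h) s.
Proof.
move=> n0 cB des sn; have uB := covol1_unit cB; have uD := dual_unit uB.
have [K1 K10 H1] := IM_expansion s uB; have [K2 K20 H2] := IM_expansion (n%:R / 2 - s) uD.
exists (K1 + K2); first exact: addr_ge0.
move=> P h d PP h0 d8 hd; have d30 : 0 <= d ^+ 3 by rewrite exprn_ge0//; case/andP: d8.
have cX : covol (B *m P^T *m exp_diag h) = 1 by apply: covol_exp_diag => //; exact: covol_orth.
have uX := covol1_unit cX; have uDX := dual_unit uX.
have h1 := H1 _ _ _ uX d30 (fun t ht => theta_design_expansion n0 uB des PP (lt_le_trans ltr01 ht) h0 d8 hd).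
have h2 := H2 _ _ _ uDX d30 (fun t ht => theta_dual_expansion n0 cB des PP (lt_le_trans ltr01 ht) h0 d8 hd).
rewrite -(ikappa_sum n0 cB sn) (Lam_IM s uB) (Lam_IM s uX).
move: h1 h2; set b1 := IM B 0 s; set b2 := IM (dual B) 0 _; set x1 := IM _ 0 s; set x2 := IM _ 0 _.
move: b1 b2 x1 x2 (ikappa B s) (ikappa (dual B) _) (d ^+ 3) (sqnorm h) => b1 b2 x1 x2 k1 k2 e S.
clear; rewrite !ler_norml => /andP[A _] /andP[A' _]; lra.
Qed.

Lemma epstein_lt n (B : 'M[R]_n) s : covol B = 1 -> s <= n%:R / 2 ->
  epstein B s = pi `^ s / Gamma1 s * (-1 + s * ((s - n%:R / 2)^-1 + Lam B s)).
Proof.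
by move=> cB sn; rewrite /epstein ltNge sn/= cB invr1 !mul1r addrA.
Qed.

Lemma Gamma1_ge0 s : 0 <= Gamma1 s.
Proof. by apply: Rintegral_ge0 => t _; rewrite mulr_ge0 ?powR_ge0 ?expR_ge0. Qed.

Lemma zeta_extreme_lt n (B : 'M[R]_n) s : covol B = 1 -> all_layers_design 4 B ->
  0 < s < n%:R / 2 -> epstein B s < 0 -> zeta_extreme B s.
Proof.
move=> cB des /andP[s0 sn]; case: (posnP n) => [n0|n0].
  by move: n0 B cB des sn => -> B _ _ _ _; exact: strict_min_dim0.
rewrite (epstein_lt cB (ltW sn)) => neg.
have q0 : 0 <= pi `^ s / Gamma1 s by rewrite mulr_ge0 ?powR_ge0 ?invr_ge0 ?Gamma1_ge0.
(* A zero factor would make the zeta value 0, contrary to its being negative. *)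
have qp : 0 < pi `^ s / Gamma1 s.
  rewrite lt_neqAle q0 andbT; apply/eqP => E; move: neg; rewrite -E mul0r ltxx//.
have sn0 : s - n%:R / 2 < 0 by rewrite subr_lt0.
have br : -1 + s * ((s - n%:R / 2)^-1 + Lam B s) < 0 by move: neg; rewrite pmulr_rlt0.
have N0 : 0 < n%:R :> R by rewrite ltr0n.
have c0 : 0 < Lam_coef B s.
  apply: mulr_gt0; first by rewrite divr_gt0// mulr_gt0// addr_gt0.
  (* The coefficient is the negative number [s - n / 2] times the bracket in [epstein_lt], which has
     the sign of the zeta value. *)
  have -> : n%:R / 2 + s * (s - n%:R / 2) * Lam B s =
    (s - n%:R / 2) * (-1 + s * ((s - n%:R / 2)^-1 + Lam B s)).
    move: (Lam B s) sn0 => L; set y := s - _ => y0.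
    rewrite (_ : n%:R / 2 = s - y); last by rewrite /y; ring.
    by move: y y0 => y y0; field; rewrite lt_eqF.
  by rewrite nmulr_rgt0.
have sr : 0 <= s <= n%:R / 2 by rewrite !ltW.
have [K K0 HK] := Lam_expansion n0 cB des sr.
have qs : 0 < pi `^ s / Gamma1 s * s by exact: mulr_gt0.
apply: (strict_min_of_expansion (c := pi `^ s / Gamma1 s * s * Lam_coef B s) (K := pi `^ s / Gamma1 s * s * K) cB).
- exact: mulr_gt0.
- exact: mulr_ge0 (ltW qs) K0.
- move=> B1 B2 c1 c2 G.
  by rewrite (epstein_lt c1 (ltW sn)) (epstein_lt c2 (ltW sn)) (Lam_gram s (covol1_unit c1) (covol1_unit c2) G).
move=> P h d PP h0 d8 hd.
have cC := covol_orth cB PP; have cX := covol_exp_diag cC h0.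
rewrite (epstein_lt cC (ltW sn)) (epstein_lt cX (ltW sn)).
rewrite (Lam_gram s (covol1_unit cC) (covol1_unit cB) (gram_orth B PP)).
have := HK P h d PP h0 d8 hd.
move: (Lam _ _) (Lam _ _) (pi `^ s / Gamma1 s) qs (Lam_coef _ _) => L1 L2 q qs w H.
have := ler_wpM2l (ltW qs) H; move: (_^-1) => z.
move: (sqnorm h) (d ^+ 3) => S e; lra.
Qed.

End ThetaIntegralExpansion.

(** * The gamma function at 0 *)

Section GammaAtZero.
Variable R : realType.
Local Notation mu := (@lebesgue_measure R).
Local Notation pl := (`]0%R, +oo[%classic : set R).
Implicit Types (s t : R).

(** A dominating function for the Gamma integrand near [s = 0], chosen for its explicit
    antiderivative [- 2 exp (- sqrt t)] and its integrable singularity at 0. *)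
Definition esq t : R := t `^ (- (1 / 2)) * expR (- (t `^ (1 / 2))).

Lemma esq_ge0 t : 0 <= esq t. Proof. by rewrite mulr_ge0 ?powR_ge0 ?expR_ge0. Qed.

Lemma powR_expR s t : 0 < t -> t `^ s = expR (s * ln t).
Proof. by move=> t0; rewrite /powR gt_eqF. Qed.

Lemma is_derive_esq (x : R) : 0 < x -> is_derive x 1 (fun t => - (2 * expR (- (t `^ (1 / 2))))) (esq x).
Proof.
move=> x0; have dp := is_derive1_powR (1 / 2) x0.
apply: is_derive_eq; rewrite /GRing.scale/= /esq.
have -> : 1 / 2 - 1 = - (1 / 2) :> R by field.
by field.
Qed.

Lemma continuous_esq (x : R) : 0 < x -> {for x, continuous esq}.
Proof.
move=> x0; apply: continuousM; first exact: continuous_powR.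
have dp := is_derive1_powR (1 / 2) x0.
apply: differentiable_continuous; apply/derivable1_diffP.
suff : is_derive x 1 (fun t => expR (- (t `^ (1 / 2)))) (- (1 / 2 * x `^ (1 / 2 - 1)) * expR (- (x `^ (1 / 2)))) by case.
by apply: is_derive_eq; rewrite /GRing.scale/=; ring.
Qed.

Lemma measurable_esq (D : set R) : measurable_fun (D : set (measurableTypeR R)) (esq : measurableTypeR R -> measurableTypeR R).
Proof.
apply: measurable_funTS; apply: measurable_funM; first exact: measurable_powR.
by apply: (measurableT_comp (@measurable_expR R)); apply: measurable_funN; exact: measurable_powR.
Qed.

Lemma integral_esq_le (a : R) : 0 < a -> (\int[mu]_(t in `[a, +oo[) (esq t)%:E <= 2%:E)%E.
Proof.
move=> a0.
rewrite (@ge0_continuous_FTC2y R _ (fun t => - (2 * expR (- (t `^ (1 / 2))))) a 0) /=.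
- rewrite -EFinB lee_fin sub0r opprK.
  have : expR (- a `^ (1 / 2)) <= 1 :> R by rewrite -[leRHS]expR0 ler_expR oppr_le0 powR_ge0.
  lra.
- by move=> x _; exact: esq_ge0.
- apply: continuous_in_subspaceT => x; rewrite inE/= in_itv/= andbT => ax.
  by apply: continuous_esq; exact: lt_le_trans ax.
- rewrite -oppr0; apply: cvgN; rewrite -[0](mulr0 2); apply: cvgM; first exact: cvg_cst.
  apply/cvgrPdist_le => e e0.
  near=> t; rewrite sub0r normrN ger0_norm ?expR_ge0//.
  rewrite -[leRHS]lnK// ler_expR lerNl.
  have t1 : `|ln e| `^ 2 <= t by near: t; apply: nbhs_pinfty_ge; exact: num_real.
  apply: (@le_trans _ _ `|ln e|); first by rewrite -normrN ler_norm.
  have := ge0_ler_powR (_ : 0 <= 1 / 2) _ _ t1.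
  rewrite -powRrM (_ : 2 * (1 / 2) = 1); last by field.
  rewrite powRr1//; apply; rewrite ?divr_ge0// ?nnegrE ?powR_ge0//.
- by move=> x ax; case: (is_derive_esq (lt_trans a0 ax)).
- have c1 : {for a, continuous (fun t => - (2 * expR (- (t `^ (1 / 2)))))}.
    by apply: differentiable_continuous; apply/derivable1_diffP; case: (is_derive_esq a0).
  exact: cvg_at_right_filter c1.
- move=> x; rewrite in_itv/= andbT => ax; rewrite derive1E; by case: (is_derive_esq (lt_trans a0 ax)).
Unshelve. all: by end_near. Qed.

Lemma integrable_esq : mu.-integrable pl (EFin \o esq).
Proof.
apply/integrableP; split; first by apply/measurable_EFinP; exact: measurable_esq.
(* As [esq] is unbounded at 0, the half-line is exhausted by closed ones, on each of which the
   integral is at most 2. *)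
have -> : pl = \bigcup_k (`[k.+1%:R^-1, +oo[%classic : set R).
  apply/seteqP; split => x /=; rewrite in_itv/= andbT.
    move=> x0; exists (Num.bound x^-1) => //=; rewrite in_itv/= andbT.
    rewrite -[leRHS]invrK lef_pV2 ?posrE ?invr_gt0//.
    apply: ltW; apply: (lt_trans (archi_boundP _)); first by rewrite invr_ge0 ltW.
    by rewrite ltr_nat.
  by move=> [k _] /=; rewrite in_itv/= andbT; apply: lt_le_trans; rewrite invr_gt0.
under eq_integral do rewrite gee0_abs ?lee_fin ?esq_ge0//.
apply: (@le_lt_trans _ _ 2%:E); last exact: ltry.
have C : (\int[mu]_(x in (`[i.+1%:R^-1%R, +oo[%classic : set R)) (esq x)%:E)%E @[i --> \oo] -->
  (\int[mu]_(x in \bigcup_i (`[i.+1%:R^-1%R, +oo[%classic : set R)) (esq x)%:E)%E.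
  apply: (@ge0_nondecreasing_set_cvg_integral _ _ R (fun k => (`[k.+1%:R^-1, +oo[%classic : set (measurableTypeR R))) (EFin \o esq) mu).
  - move=> i j ij; apply/subsetPset => x /=; rewrite !in_itv/= !andbT; apply: le_trans.
    by rewrite lef_pV2 ?posrE// ler_nat.
  - by move=> i; exact: measurable_itv.
  - by move=> i; apply/measurable_EFinP; exact: measurable_esq.
  - by move=> i x _; rewrite lee_fin esq_ge0.
rewrite -(cvg_lim _ C)//; apply: lime_le; first exact: (cvgP _ C).
by apply: nearW => i; apply: integral_esq_le; rewrite invr_gt0.
Qed.

(** The factor [1 + |ln t|] covers both the integrand and its derivative in [s]. It and [t ^ s] are
    absorbed by [exp (|ln t| / 2)], and [sqrt t <= (1 + t) / 2] gives the comparison at infinity. *)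
Lemma powR_exp_le_esq s t : `|s| <= 1 / 4 -> 0 < t ->
  t `^ s * (1 + `|ln t|) * expR (- t) <= 8 * expR (1 / 2) * esq t.
Proof.
move=> s4 t0; rewrite /esq (powR_expR s t0).
have x4 : 1 + `|ln t| <= 4 * expR (`|ln t| / 4).
  have := expR_ge1Dx (`|ln t| / 4); have := normr_ge0 (ln t); lra.
have sx : expR (s * ln t) <= expR (`|ln t| / 4).
  rewrite ler_expR; apply: (le_trans (ler_norm _)); rewrite normrM mulrC; apply: ler_wpM2l => //; lra.
have h1 : expR (s * ln t) * (1 + `|ln t|) <= 4 * expR (`|ln t| / 2).
  have -> : 4 * expR (`|ln t| / 2) = expR (`|ln t| / 4) * (4 * expR (`|ln t| / 4)).
    by rewrite mulrCA -expRD; congr (_ * expR _); field.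
  by apply: ler_pM => //; rewrite ?expR_ge0// addr_ge0.
have h2 : expR (`|ln t| / 2) <= t `^ (- (1 / 2)) * (1 + t).
  have p0 := powR_ge0 t (- (1 / 2)).
  have et : t `^ (- (1 / 2)) * t = expR (ln t / 2).
    transitivity (expR (- (1 / 2) * ln t) * expR (ln t)); first by rewrite lnK// powR_expR.
    by rewrite -expRD; congr expR; field.
  rewrite mulrDr mulr1 et (powR_expR _ t0).
  have e0 := expR_ge0 (ln t / 2); have e1 := expR_ge0 (- (1 / 2) * ln t).
  case: (lerP 0 (ln t)) => [l|l]; first by rewrite (ger0_norm l); lra.
  rewrite (ltr0_norm l).
  by rewrite (_ : - ln t / 2 = - (1 / 2) * ln t); [lra|field].
have h3 : 1 + t <= 2 * expR (t / 2) by have := expR_ge1Dx (t / 2); lra.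
have h4 : expR (t / 2) * expR (- t) <= expR (1 / 2) * expR (- t `^ (1 / 2)).
  rewrite -!expRD ler_expR.
  have : (t `^ (1 / 2)) ^+ 2 = t.
    by rewrite -powR_mulrn ?powR_ge0// -powRrM (_ : 1 / 2 * 2 = 1) ?powRr1 ?ltW//; field.
  have := sqr_ge0 (t `^ (1 / 2) - 1); move: (t `^ (1 / 2)) => p; nra.
have p0 := powR_ge0 t (- (1 / 2)).
apply: (@le_trans _ _ (4 * (t `^ (- (1 / 2)) * (2 * expR (t / 2))) * expR (- t))).
  apply: ler_wpM2r; first exact: expR_ge0.
  apply: (le_trans h1); apply: ler_wpM2l => //; apply: (le_trans h2).
  exact: ler_wpM2l.
have -> : 4 * (t `^ (- (1 / 2)) * (2 * expR (t / 2))) * expR (- t) = 8 * t `^ (- (1 / 2)) * (expR (t / 2) * expR (- t)) by ring.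
have -> : 8 * expR (1 / 2) * (t `^ (- (1 / 2)) * expR (- t `^ (1 / 2))) = 8 * t `^ (- (1 / 2)) * (expR (1 / 2) * expR (- t `^ (1 / 2))) by ring.
by apply: ler_wpM2l => //; rewrite mulr_ge0.
Qed.

Lemma is_derive_powR_exponent s t : 0 < t ->
  is_derive s 1 (fun u => t `^ u * expR (- t)) (t `^ s * ln t * expR (- t)).
Proof.
move=> t0; rewrite (_ : (fun u => _) = (fun u => expR (u * ln t) * expR (- t))); last first.
  by apply/funext => u; rewrite powR_expR.
rewrite powR_expR//; apply: is_derive_eq; rewrite /GRing.scale/=; ring.
Qed.

Lemma measurable_gamma s (D : set R) : measurable_fun (D : set (measurableTypeR R))
  (fun t : measurableTypeR R => ((t : R) `^ s * expR (- (t : R)) : measurableTypeR R)).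
Proof.
apply: measurable_funTS; apply: measurable_funM; first exact: measurable_powR.
by apply: (measurableT_comp (@measurable_expR R)); exact: measurable_funN.
Qed.

Lemma integrable_gamma s : `|s| <= 1 / 4 -> mu.-integrable pl (EFin \o (fun t => t `^ s * expR (- t))).
Proof.
move=> s4; have mp : measurable (pl : set (measurableTypeR R)) by exact: measurable_itv.
apply: (le_integrable mp _ _ (integrableZl mp (8 * expR (1 / 2)) integrable_esq)).
  by apply/measurable_EFinP; exact: measurable_gamma.
move=> t /=; rewrite in_itv/= andbT => t0; rewrite lee_fin.
rewrite ger0_norm ?mulr_ge0 ?powR_ge0 ?expR_ge0//; apply: le_trans (ler_norm _).
apply: le_trans (powR_exp_le_esq s4 t0); apply: ler_wpM2r; first exact: expR_ge0.
by apply: ler_peMr; [exact: powR_ge0|rewrite lerDl].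
Qed.

(** Differentiation under the integral for [|s| <= 1 / 4], dominated by a multiple of [esq]. The
    derivative stays unevaluated, since it enters every height as the same constant. *)
Lemma derivable_Gamma1 : derivable (@Gamma1 R) 0 1.
Proof.
have mp : measurable (pl : set (measurableTypeR R)) by exact: measurable_itv.
have small s : `](- (1 / 4)), (1 / 4)[%classic s -> `|s| <= 1 / 4.
  by rewrite /= in_itv/= => /andP[a b]; rewrite ler_norml !ltW.
have dpos s t : pl t -> is_derive s 1 (fun u => t `^ u * expR (- t)) (t `^ s * ln t * expR (- t)).
  by rewrite /= in_itv/= andbT; exact: is_derive_powR_exponent.
have := @derivable_under_integral R _ _ mu (fun s t => t `^ s * expR (- t)) pl mp 0 (- (1 / 4)) (1 / 4).
move=> /(_ _ _ _ (fun t => 8 * expR (1 / 2) * esq t)); apply.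
- by rewrite /= in_itv/=; apply/andP; split; lra.
- by move=> s /small; exact: integrable_gamma.
- by move=> s t _ /(dpos s); case.
- by move=> t; rewrite mulr_ge0 ?esq_ge0// mulr_ge0 ?expR_ge0.
- exact: (integrableZl mp _ integrable_esq).
- move=> s t /small s4 tp; rewrite /partial1of2 derive1E.
  have [_ ->] := dpos s t tp; move: tp; rewrite /= in_itv/= andbT => t0.
  rewrite normrM (ger0_norm (expR_ge0 _)) normrM (ger0_norm (powR_ge0 _ _)).
  apply: le_trans (powR_exp_le_esq s4 t0); apply: ler_wpM2r; first exact: expR_ge0.
  by apply: ler_wpM2l; [exact: powR_ge0|rewrite lerDr].
Qed.

Lemma Gamma1_0 : Gamma1 0 = 1 :> R.
Proof.
have i0 := integrable_gamma (s := 0) ltac:(rewrite normr0; lra).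
rewrite /Gamma1 (Rintegral_itv_obnd_cbnd i0).
have dF (x : R) : is_derive x 1 (fun t => - expR (- t)) (expR (- x)).
  by apply: is_derive_eq; rewrite /GRing.scale/=; ring.
rewrite (@Rintegral_ge0_continuous_FTC2y R _ (fun t => - expR (- t)) 0 0) /=.
- by rewrite oppr0 expR0 opprK add0r.
- by move=> x _; rewrite powRr0 mul1r expR_ge0.
- rewrite (_ : (fun t => _) = (fun t => expR (- t))); last by apply/funext => t; rewrite powRr0 mul1r.
  apply: continuous_subspaceT => x.
  have := @continuous_exp_decay R 1 x; rewrite (_ : (fun t => _) = (fun t => expR (- t)))//.
  by apply/funext => t; rewrite mul1r.
- rewrite -oppr0; apply: cvgN; have := @cvg_exp_decay R 1 ltr01.
  by rewrite (_ : (fun t => _) = (fun t => expR (- t)))//; apply/funext => t; rewrite mul1r.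
- by move=> x _; case: (dF x).
- have c1 : {for 0, continuous (fun t : R => - expR (- t))}.
    by apply: differentiable_continuous; apply/derivable1_diffP; case: (dF 0).
  exact: cvg_at_right_filter c1.
- by move=> x _; rewrite derive1E powRr0 mul1r; case: (dF x).
Qed.

End GammaAtZero.

(** * The height *)

Section Height.
Variable R : realType.
Local Notation mu := (@lebesgue_measure R).
Local Notation hl := (`[1%R, +oo[%classic : set R).
Implicit Types (n : nat) (a s t : R).

Lemma continuous_powR_exponent (c t x : R) : 0 < t -> {for x, continuous (fun u : R => c * t `^ (u - 1))}.
Proof.
move=> t0; apply: continuousM; first exact: cvg_cst.
rewrite (_ : (fun u : R => t `^ _) = (fun u : R => expR ((u - 1) * ln t))); last by apply/funext => u; rewrite powR_expR.
apply: differentiable_continuous; apply/derivable1_diffP.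
suff : is_derive x 1 (fun u : R => expR ((u - 1) * ln t)) (ln t * expR ((x - 1) * ln t)) by case.
by apply: is_derive_eq; rewrite /GRing.scale/=; ring.
Qed.

Lemma continuous_IM n (B : 'M[R]_n) a : B \in unitmx -> {for a, continuous (fun x => IM B 0 x)}.
Proof.
move=> uB; have mh := @measurable_hl R.
have g0 t : 1 <= t -> 0 <= radial_sum B (gm 0 t).
  by move=> t1; case/andP: (radial_gm_bound 0 uB (lt_le_trans ltr01 t1)).
pose f (x t : R) : R := radial_sum B (gm 0 t) * t `^ (x - 1).
have int_f x : mu.-integrable hl (EFin \o f x) by exact: integrable_radial_gm.
have Ia : a \in (`](a - 1), (a + 1)[%classic : set R).
  by rewrite inE/= in_itv/=; apply/andP; split; lra.
apply: (@continuity_under_integral R _ _ mu f hl mh (a - 1) (a + 1) _ _ (f (a + 1))) Ia => //.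
- apply/aeW => t; rewrite /= in_itv/= andbT => t1 x _.
  by apply: (@continuous_powR_exponent (radial_sum B (gm 0 t)) t x); lra.
move=> x; rewrite /= in_itv/= => /andP[_ xa]; apply/aeW => t; rewrite /= in_itv/= andbT => t1.
rewrite /f ger0_norm; last exact: mulr_ge0 (g0 t t1) (powR_ge0 _ _).
by apply: ler_wpM2l; [exact: g0|rewrite ler_powR//; lra].
Qed.

Lemma continuous_Lam n (B : 'M[R]_n) s : B \in unitmx -> {for s, continuous (fun x => Lam B x)}.
Proof.
move=> uB; rewrite (_ : (fun x => _) = (fun x => IM B 0 x + IM (dual B) 0 (n%:R / 2 - x))); last first.
  by apply/funext => x; rewrite Lam_IM.
apply: continuousD; first exact: continuous_IM.
apply: (@continuous_comp R R R (fun x => n%:R / 2 - x) (fun x => IM (dual B) 0 x) s).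
  by apply: continuousB; [exact: cvg_cst|exact: cvg_id].
by apply: continuous_IM; exact: dual_unit.
Qed.

(** The difference quotient of [s * G s] at 0 is [G] itself, so continuity of the theta integrals is
    enough to differentiate the zeta function at 0. *)
Lemma is_derive_mul_id (G : R -> R) : {for (0 : R), continuous G} -> is_derive (0 : R) 1 (fun s => s * G s) (G 0).
Proof.
move=> cG.
have C : h^-1 *: (((fun s => s * G s) \o shift 0) (h *: 1) - 0 * G 0) @[h --> (0 : R)^'] --> G 0.
  apply: (@cvg_trans _ (G h @[h --> (0 : R)^'])); last by move/continuous_withinNx: cG.
  apply: near_eq_cvg; near=> h.
  have h0 : h != 0 by near: h; exact: nbhs_dnbhs_neq.
  by rewrite /GRing.scale/= mulr1 addr0 mul0r subr0 mulKf.
apply: DeriveDef; first by apply/cvg_ex; exists (G 0).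
exact: (cvg_lim _ C).
Unshelve. all: by end_near. Qed.

Definition height_factor s : R := (4 * pi ^+ 2) `^ (- s) * (pi `^ s / Gamma1 s).

Lemma derivable_height_factor : derivable height_factor 0 1.
Proof.
have p0 := @pi_gt0 R.
have dexp (c : R) : derivable (fun s : R => expR (c * s)) 0 1.
  suff : is_derive (0 : R) 1 (fun s : R => expR (c * s)) (c * expR (c * 0)) by case.
  by apply: is_derive_eq; rewrite /GRing.scale/=; ring.
have q0 : 0 < 4 * pi ^+ 2 :> R by rewrite mulr_gt0// exprn_gt0.
rewrite (_ : height_factor = (fun s => expR (- ln (4 * pi ^+ 2) * s)) * ((fun s => expR (ln pi * s)) * (fun s => (Gamma1 s)^-1))); last first.
  apply/funext => s; rewrite /height_factor (powR_expR _ q0) (powR_expR _ p0) !fctE.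
  by rewrite mulNr -mulrN mulrC mulrC; congr (expR _ * (expR _ / _)); ring.
apply: derivableM; first exact: dexp.
apply: derivableM; first exact: dexp.
by apply: derivableV; [rewrite Gamma1_0 oner_neq0|exact: derivable_Gamma1].
Qed.

Lemma height_factor0 : height_factor 0 = 1.
Proof. by rewrite /height_factor Gamma1_0 oppr0 !powRr0 divr1 mulr1. Qed.

(** Near 0 the torus zeta function is [height_factor s * (-1 + s * G s)] with [height_factor 0 = 1];
    its derivative at 0 is [G 0] minus the derivative of the factor. *)
Lemma torus_height_Lam n (C : 'M[R]_n) : (0 < n)%N -> covol (dual C) = 1 ->
  torus_height C = Lam (dual C) 0 - (n%:R / 2)^-1 - 'D_1 height_factor 0.
Proof.
move=> n0 cD; have uD := covol1_unit cD.
have N0 : 0 < n%:R / 2 :> R by rewrite divr_gt0// ltr0n.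
pose G s := (s - n%:R / 2)^-1 + Lam (dual C) s.
have cG : {for 0, continuous G}.
  apply: continuousD; last exact: continuous_Lam.
  apply: continuousV; first by rewrite sub0r oppr_eq0 gt_eqF.
  by apply: continuousB; [exact: cvg_id|exact: cvg_cst].
have dG := is_derive_mul_id cG.
have dh : is_derive (0 : R) 1 height_factor ('D_1 height_factor 0) by apply/derivableP; exact: derivable_height_factor.
have dZ : is_derive (0 : R) 1 (fun s => height_factor s * (-1 + s * G s)) (G 0 - 'D_1 height_factor 0).
  apply: is_derive_eq; rewrite /GRing.scale/= height_factor0; ring.
rewrite /torus_height derive1E.
transitivity ('D_1 (fun s => height_factor s * (-1 + s * G s)) 0); last first.
  by case: dZ => _ ->; rewrite /G sub0r invrN; congr (_ - _); exact: addrC.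
apply: near_eq_derive; near=> s.
have sn : s <= n%:R / 2.
  by apply: ltW; near: s; exact: (cvgr_lt _ cvg_id).
by rewrite /torus_zeta (epstein_lt cD sn) /height_factor /G mulrA.
Unshelve. all: by end_near. Qed.

Lemma dualK n (B : 'M[R]_n) : B \in unitmx -> dual (dual B) = B.
Proof. by move=> uB; rewrite /dual trmx_inv trmxK invmxK. Qed.

Lemma covol_dual n (B : 'M[R]_n) : covol B = 1 -> covol (dual B) = 1.
Proof. by rewrite /covol /dual det_tr det_inv normfV => ->; rewrite invr1. Qed.

Lemma height_strict_min n (B : 'M[R]_n) : covol B = 1 -> all_layers_design 4 B ->
  strict_local_min (@torus_height R n) (dual B).
Proof.
move=> cB des; case: (posnP n) => [n0|n0].
  by move: n0 B cB des => -> B _ _; exact: strict_min_dim0.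
have uB := covol1_unit cB; have cD := covol_dual cB; have uD := covol1_unit cD.
have N0 : 0 < n%:R :> R by rewrite ltr0n.
have c0 : 0 < Lam_coef B 0.
  by rewrite /Lam_coef !mul0r addr0 mulr_gt0 ?divr_gt0// mulr_gt0// addr_gt0.
have sr : 0 <= (0 : R) <= n%:R / 2 by rewrite lexx ltW// divr_gt0.
have [K K0 HK] := Lam_expansion n0 cB des sr.
apply: (strict_min_of_expansion cD c0 K0).
  move=> B1 B2 c1 c2 G.
  rewrite (torus_height_Lam n0 (covol_dual c1)) (torus_height_Lam n0 (covol_dual c2)).
  have g := gram_dual (covol1_unit c1) (covol1_unit c2) G.
  by rewrite (Lam_gram 0 (covol1_unit (covol_dual c1)) (covol1_unit (covol_dual c2)) g).
move=> P h d PP h0 d8 hd.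
have cC := covol_orth cD PP; have cX := covol_exp_diag cC h0.
rewrite (torus_height_Lam n0 (covol_dual cC)) (torus_height_Lam n0 (covol_dual cX)).
(* Deforming the dual lattice by [h] deforms the lattice itself by [- h], so the expansion of [Lam]
   is used at [- h]. *)
rewrite (dual_frame h uD PP) (dualK uB).
have g := gram_dual (covol1_unit cC) uD (gram_orth (dual B) PP).
rewrite (dualK uB) in g.
rewrite (Lam_gram 0 (covol1_unit (covol_dual cC)) uB g).
have h0' : \sum_i (- h) 0 i = 0.
  by under eq_bigr do rewrite mxE; rewrite sumrN h0 oppr0.
have hd' i : `|(- h) 0 i| <= d by rewrite mxE normrN.
have := HK P (- h) d PP h0' d8 hd'.
have -> : sqnorm (- h) = sqnorm h by apply: eq_bigr => i _; rewrite mxE sqrrN.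
move: (Lam _ _) (Lam _ _) ('D_1 height_factor 0) => L1 L2 D; lra.
Qed.

End Height.

Theorem mainTheorem1 (R : realType) (n : nat) (B : 'M[R]_n) :
  covol B = 1 ->
  all_layers_design 4 B ->
  (forall s : R, n%:R / 2 < s -> zeta_extreme B s) /\
  strict_local_min (@torus_height R n) (dual B) /\
  ((forall s : R, 0 < s < n%:R / 2 -> epstein B s < 0) ->
   forall s : R, 0 < s -> s != n%:R / 2 -> zeta_extreme B s).
Proof.
move=> cB des; split; first by move=> s; exact: zeta_extreme_gt.
split; first exact: height_strict_min.
move=> neg s s0; rewrite neq_lt => /orP[sn|ns]; last exact: zeta_extreme_gt.
have s2 : 0 < s < n%:R / 2 by rewrite s0.
exact: (zeta_extreme_lt cB des s2 (neg s s2)).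
Qed.
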